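(* Let $A$ be a linear operator on $L^2(\mathcal G)$ extending $A_0$. Then $A$ is skew-self-adjoint (i.e. $A^*=-A$ with $D(A^* )=D(A)$) if and only if there exists a $w$-self-orthogonal subspace $X\subset \mathcal B_+\oplus\mathcal B_-$ such that $G(-A)=F^{-1}(X)$, where $G(-A)=\{(\mathbf U,-A\mathbf U):\mathbf U\in D(A)\}$.
   Context: Graph. Let $L>0$, $k\ge 1$ an integer, $N=2k$. The looping-edge graph $\mathcal G$ has edges $e_0=[-L,L]$ and $e_j=[L,\infty)$, $j=1,\dots,N$. A function on $\mathcal G$ is a tuple $\mathbf U=(\phi,\psi_1,\dots,\psi_N)$ with $\phi$ on $[-L,L]$ and $\psi_j$ on $[L,\infty)$ (complex valued). $L^2(\mathcal G)=L^2(-L,L)\oplus\bigoplus_{j=1}^N L^2(L,\infty)$ with the standard inner product, and $H^3(\mathcal G)=H^3(-L,L)\oplus\bigoplus_{j=1}^N H^3(L,\infty)$. Operator. Let $\alpha_j,\beta_j$ ($0\le j\le N$) be real numbers with $\alpha_j\ne 0$, $\alpha_j>0$ for odd $j$, and $\alpha_j<0$ for even $j\ge 2$ (so exactly half of the half-lines have positive leading coefficient). The Airy operator is $A_0\mathbf U=(\alpha_0\phi'''+\beta_0\phi',\ \alpha_1\psi_1'''+\beta_1\psi_1',\dots,\alpha_N\psi_N'''+\beta_N\psi_N')$ with domain $D(A_0)=C_0^\infty(-L,L)\oplus\bigoplus_{j=1}^N C_0^\infty(L,\infty)$. Its adjoint $A_0^*$ has domain $D(A_0^* )=H^3(\mathcal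 G)$ and acts as $A_0^*\mathbf U=-(\alpha_0\phi'''+\beta_0\phi',\dots,\alpha_N\psi_N'''+\beta_N\psi_N')$. Its graph is $G(A_0^* )=\{(\mathbf U,A_0^*\mathbf U):\mathbf U\in H^3(\mathcal G)\}$. Boundary data. For a function $f$ put $\partial f(x)=(f(x),f'(x),f''(x))^T$ (one-sided values at endpoints). Let $\partial\psi_{odd}(L)$ be the vertical stack of $\partial\psi_1(L),\partial\psi_3(L),\dots,\partial\psi_{2k-1}(L)$ and $\partial\psi_{even}(L)$ that of $\partial\psi_2(L),\partial\psi_4(L),\dots,\partial\psi_{2k}(L)$. Let $$B_j=\begin{pmatrix}\beta_j&0&\alpha_j\\0&-\alpha_j&0\\\alpha_j&0&0\end{pmatrix},\qquad B_+=\operatorname{diag}(B_0,B_1,B_3,\dots,B_{2k-1}),\qquad B_-=\operatorname{diag}(B_0,-B_2,-B_4,\dots,-B_{2k}).$$ $\mathcal B_\pm$ denotes $\mathbb C^{3(k+1)}$ with the indefinite inner product $(x\mid y)_\pm=(B_\pm x\mid y)$, where $(\cdot\mid\cdot)$ is the standard inner product. Define $$F:G(A_0^* )\to\mathcal B_+\oplus\mathcal B_-,\quad F(\mathbf U,A_0^*\mathbf U)=\left(\begin{pmatrix}\partial\phi(-L)\\\partial\psi_{odd}(L)\end{pmatrix},\begin{pmatrix}\partial\phi(L)\\\partial\psi_{even}(L)\end{pmatrix}\right)$$ and the sesquilinear form $w((x,y),(\tilde x,\tilde y))=(x\mid\tilde x)_+-(y\mid\tilde y)_-$ on $\mathcal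 B_+\oplus\mathcal B_-$. A subspace $X$ is $w$-self-orthogonal if $X=X^{\perp_w}:=\{(x,y)\in\mathcal B_+\oplus\mathcal B_-: w((x,y),(\tilde x,\tilde y))=0\ \text{for all }(\tilde x,\tilde y)\in X\}$. *)

(* Defs.v *)
From HB Require Import structures.
From mathcomp Require Import all_boot all_order all_algebra.
From mathcomp Require Import complex.
From mathcomp Require Import all_classical all_reals all_analysis.

Set Implicit Arguments.
Unset Strict Implicit.
Unset Printing Implicit Defensive.

Import Order.TTheory GRing.Theory Num.Theory.
Import numFieldNormedType.Exports.

Local Open Scope classical_set_scope.
Local Open Scope ring_scope.

(** ** Complex-valued functions of a real variable

Integrals, derivatives, measurability and continuity of [f : R -> R[i]] are
taken on the real and imaginary parts. *)

Definition re (R : realType) (f : R -> R[i]) : R -> R :=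
  fun x => complex.Re (f x).

Definition im (R : realType) (f : R -> R[i]) : R -> R :=
  fun x => complex.Im (f x).

Definition cint (R : realType) (I : set R) (f : R -> R[i]) : R[i] :=
  Complex (\int[@lebesgue_measure R]_(x in I) re f x)%R
          (\int[@lebesgue_measure R]_(x in I) im f x)%R.

Definition cderiv (R : realType) (n : nat) (f : R -> R[i]) : R -> R[i] :=
  fun x => Complex (derive1n n (re f) x) (derive1n n (im f) x).

Definition ceq_ae (R : realType) (I : set R) (f g : R -> R[i]) : Prop :=
  {ae @lebesgue_measure R, forall x, I x -> f x = g x}.

Definition csquare_integrable (R : realType) (I : set R) (f : R -> R[i]) :
    Prop :=
  [/\ measurable_fun I (re f), measurable_fun I (im f) &
      (@lebesgue_measure R).-integrable I
        (fun x => ((re f x) ^+ 2 + (im f x) ^+ 2)%:E)].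

Definition ccontinuous_on (R : realType) (K : set R) (f : R -> R[i]) : Prop :=
  {within K, continuous (re f)} /\ {within K, continuous (im f)}.

(** [C_0^oo(I)], its members being extended by zero to the whole line. *)
Definition test_fun (R : realType) (I : set R) (f : R -> R[i]) : Prop :=
  [/\ forall n x, derivable (derive1n n (re f)) x 1,
      forall n x, derivable (derive1n n (im f)) x 1 &
      exists K : set R, [/\ compact K, K `<=` I & forall x, ~ K x -> f x = 0]].

(** ** Sobolev spaces on an open interval *)

Definition weak_deriv (R : realType) (I : set R) (n : nat)
    (u g : R -> R[i]) : Prop :=
  forall f, test_fun I f ->
    cint I (fun x => u x * cderiv n f x) =
    (-1) ^+ n * cint I (fun x => g x * f x).

(** [H^m(I)] *)
Definition sobolev (R : realType) (m : nat) (I : set R) (u : R -> R[i]) :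
    Prop :=
  csquare_integrable I u /\
  forall n, (n <= m)%N -> exists g, csquare_integrable I g /\ weak_deriv I n u g.

(** The [n]-th weak derivative in [L^2(I)], unique up to a null set; junk value
    if there is none. *)
Definition wderiv (R : realType) (I : set R) (n : nat) (u : R -> R[i]) :
    R -> R[i] :=
  xget (fun=> 0) [set g | csquare_integrable I g /\ weak_deriv I n u g].

(** Value at [a] of the representative of [u] that is continuous on the closure
    of [I], i.e. the one-sided value when [a] is an endpoint of the open
    interval [I]; junk value if [u] has no such representative. *)
Definition cvalue (R : realType) (I : set R) (u : R -> R[i]) (a : R) : R[i] :=
  xget 0 [set c | exists g : R -> R[i],
    [/\ ccontinuous_on (closure I) g, ceq_ae I u g & c = g a]].

(** [(u(a), u'(a), u''(a))^T] *)
Definition bdata (R : realType) (I : set R) (u : R -> R[i]) (a : R) :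
    'cV[R[i]]_3 :=
  \col_(n < 3) cvalue I (wderiv I n u) a.

(** ** The looping-edge graph

The edges are indexed by [0, ..., N] with [N = 2 k]; index [0] is the loop.
Elements of [L^2(G)] are represented by functions, compared with [gequiv];
the values of a representative off the edge are irrelevant. *)

Definition gfun (R : realType) (k : nat) : Type :=
  'I_(2 * k).+1 -> R -> R[i].

Definition edge (R : realType) (k : nat) (L : R) (j : 'I_(2 * k).+1) : set R :=
  if j == ord0 then [set` `]- L, L[] else [set` `]L, +oo[].

Definition gequiv (R : realType) (k : nat) (L : R) (U V : gfun R k) : Prop :=
  forall j, ceq_ae (edge L j) (U j) (V j).

Definition gL2 (R : realType) (k : nat) (L : R) (U : gfun R k) : Prop :=
  forall j, csquare_integrable (edge L j) (U j).

Definition gH3 (R : realType) (k : nat) (L : R) (U : gfun R k) : Prop :=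
  forall j, sobolev 3 (edge L j) (U j).

Definition ginner (R : realType) (k : nat) (L : R) (U V : gfun R k) : R[i] :=
  \sum_j cint (edge L j) (fun x => U j x * (V j x)^*%C).

Definition gopp (R : realType) (k : nat) (U : gfun R k) : gfun R k :=
  fun j x => - U j x.

Definition glin (R : realType) (k : nat) (c : R[i]) (U V : gfun R k) :
    gfun R k :=
  fun j x => c * U j x + V j x.

(** ** Unbounded operators on [L^2(G)] *)

(** [dom] and [app] act on representatives; [dom_gequiv] and [app_gequiv] say
    that they descend to classes modulo [gequiv]. *)
Record operator (R : realType) (k : nat) (L : R) := Operator {
  dom : set (gfun R k);
  app : gfun R k -> gfun R k;
  dom_L2 : forall U, dom U -> gL2 L U;
  app_L2 : forall U, dom U -> gL2 L (app U);
  dom_gequiv : forall U V, dom U -> gL2 L V -> gequiv L U V -> dom V;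
  app_gequiv : forall U V, dom U -> dom V -> gequiv L U V ->
    gequiv L (app U) (app V);
  dom0 : dom (fun _ _ => 0);
  dom_lin : forall c U V, dom U -> dom V -> dom (glin c U V);
  app_lin : forall c U V, dom U -> dom V ->
    gequiv L (app (glin c U V)) (glin c (app U) (app V))
}.

(** The graph of [-A] *)
Definition opp_graph (R : realType) (k : nat) (L : R) (A : operator k L) :
    set (gfun R k * gfun R k) :=
  [set p | [/\ dom A p.1, gL2 L p.2 & gequiv L p.2 (gopp (app A p.1))]].

(** The graph of [A^*] *)
Definition adjoint_graph (R : realType) (k : nat) (L : R) (A : operator k L) :
    set (gfun R k * gfun R k) :=
  [set p | [/\ gL2 L p.1, gL2 L p.2 &
     forall U, dom A U -> ginner L (app A U) p.1 = ginner L U p.2]].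

(** [A^* = -A], including equality of the domains. *)
Definition skew_self_adjoint (R : realType) (k : nat) (L : R)
    (A : operator k L) : Prop :=
  adjoint_graph A = opp_graph A.

(** ** The Airy operator and its adjoint *)

Definition airy_dom (R : realType) (k : nat) (L : R) : set (gfun R k) :=
  [set U | forall j, test_fun (edge L j) (U j)].

Definition airy (R : realType) (k : nat) (alpha beta : 'I_(2 * k).+1 -> R)
    (U : gfun R k) : gfun R k :=
  fun j x => (alpha j)%:C%C * cderiv 3 (U j) x
           + (beta j)%:C%C * cderiv 1 (U j) x.

Definition extends_airy (R : realType) (k : nat) (L : R)
    (alpha beta : 'I_(2 * k).+1 -> R) (A : operator k L) : Prop :=
  forall U, airy_dom L U ->
    dom A U /\ gequiv L (app A U) (airy alpha beta U).

(** [A_0^* U] for [U] in [H^3(G)], the derivatives being the weak ones. *)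
Definition airy_adjoint (R : realType) (k : nat) (L : R)
    (alpha beta : 'I_(2 * k).+1 -> R) (U : gfun R k) : gfun R k :=
  fun j x => - ((alpha j)%:C%C * wderiv (edge L j) 3 (U j) x
              + (beta j)%:C%C * wderiv (edge L j) 1 (U j) x).

(** The graph of [A_0^*] *)
Definition airy_adjoint_graph (R : realType) (k : nat) (L : R)
    (alpha beta : 'I_(2 * k).+1 -> R) : set (gfun R k * gfun R k) :=
  [set p | [/\ gH3 L p.1, gL2 L p.2 &
               gequiv L p.2 (airy_adjoint L alpha beta p.1)]].

(** ** Boundary spaces

Blocks are indexed by [i = 0, ..., k].  Block [0] belongs to the loop; block
[i >= 1] belongs to the half-line [2 i - 1] in [B_+] and [2 i] in [B_-].
Note that [(2 * 0).-1 = 0]. *)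

Definition odd_edge (k : nat) (i : 'I_k.+1) : 'I_(2 * k).+1 :=
  inord (2 * i).-1.

Definition even_edge (k : nat) (i : 'I_k.+1) : 'I_(2 * k).+1 :=
  inord (2 * i).

(** [3 (k + 1)], in the form required by block matrices. *)
Definition bdim (k : nat) : nat := \sum_(i < k.+1) 3.

Definition Bblock (R : realType) (a b : R) : 'M[R[i]]_3 :=
  \matrix_(i, j) (match nat_of_ord i, nat_of_ord j with
                  | 0%N, 0%N => b
                  | 0%N, 2 | 2, 0%N => a
                  | 1%N, 1%N => - a
                  | _, _ => 0
                  end)%:C%C.

Definition Bplus (R : realType) (k : nat) (alpha beta : 'I_(2 * k).+1 -> R) :
    'M[R[i]]_(bdim k) :=
  \mxdiag_(i < k.+1) Bblock (alpha (odd_edge i)) (beta (odd_edge i)).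

Definition Bminus (R : realType) (k : nat) (alpha beta : 'I_(2 * k).+1 -> R) :
    'M[R[i]]_(bdim k) :=
  \mxdiag_(i < k.+1)
    (if i == ord0 then Bblock (alpha ord0) (beta ord0)
     else - Bblock (alpha (even_edge i)) (beta (even_edge i))).

Definition cdot (R : realType) (n : nat) (x y : 'cV[R[i]]_n) : R[i] :=
  \sum_i x i ord0 * (y i ord0)^*%C.

Definition wform (R : realType) (k : nat) (alpha beta : 'I_(2 * k).+1 -> R)
    (p q : 'cV[R[i]]_(bdim k) * 'cV[R[i]]_(bdim k)) : R[i] :=
  cdot (Bplus alpha beta *m p.1) q.1 - cdot (Bminus alpha beta *m p.2) q.2.

Definition w_self_orthogonal (R : realType) (k : nat)
    (alpha beta : 'I_(2 * k).+1 -> R)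
    (X : {vspace 'cV[R[i]]_(bdim k) * 'cV[R[i]]_(bdim k)}) : Prop :=
  forall p, p \in X <-> forall q, q \in X -> wform alpha beta p q = 0.

(** [F(U, A_0^* U)], which depends on [U] only. *)
Definition bmap (R : realType) (k : nat) (L : R) (U : gfun R k) :
    'cV[R[i]]_(bdim k) * 'cV[R[i]]_(bdim k) :=
  (\mxcol_(i < k.+1) bdata (edge L (odd_edge i)) (U (odd_edge i))
                       (if i == ord0 then - L else L),
   \mxcol_(i < k.+1) bdata (edge L (even_edge i)) (U (even_edge i)) L).

(** [F^{-1}(X)] *)
Definition bmap_preimage (R : realType) (k : nat) (L : R)
    (alpha beta : 'I_(2 * k).+1 -> R)
    (X : {vspace 'cV[R[i]]_(bdim k) * 'cV[R[i]]_(bdim k)}) :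
    set (gfun R k * gfun R k) :=
  [set p | airy_adjoint_graph L alpha beta p /\ bmap L p.1 \in X].

(* Main.v *)
(* Let [S] be the adjoint of [A0].  Integrating by parts three times on every edge
   gives Green's formula [<S U, V> + <U, S V> = w (F U, F V)] for [U], [V] in the
   domain of [S].  As [A] extends [A0], the adjoint of [A] is a restriction of [S], so
   its domain consists of the [U] for which [F U] is w-orthogonal to [F (G (-A))].
   Since [F] is onto and [w] is Hermitian, skew-self-adjointness of [A] says that
   [G (-A)] is the inverse image of the w-orthogonal of [F (G (-A))], and this
   subspace is then w-self-orthogonal.

   The analysis lies in showing that the adjoint of [A] is contained in [S].  If
   [al * v''' + be * v' = - z] weakly, the du Bois-Reymond lemma expresses [v], [v']
   and [v''] as primitives.  On a half-line, [v'] and [v''] are square integrable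
   because Taylor expansion at [x] bounds their values there by those of [v] at [x],
   [x + 1] and [x + 2] and by local integrals of [v] and [z]. *)
From HB Require Import structures.
Require Import Defs.
From mathcomp Require Import all_boot all_order all_algebra.
From mathcomp Require Import complex.
From mathcomp Require Import ring lra.
From mathcomp Require Import all_classical all_reals all_analysis.
From mathcomp Require Import measurable_realfun.

Set Implicit Arguments.
Unset Strict Implicit.
Unset Printing Implicit Defensive.

Import Order.TTheory GRing.Theory Num.Theory.
Import numFieldNormedType.Exports.

Local Open Scope classical_set_scope.
Local Open Scope ring_scope.

(** * Smooth bump functions *)

Section smooth_functions.
Variable R : realType.
Implicit Types (f g : R -> R) (p : {poly R}).

(** The obstacle that shapes the proof is that [wderiv] and [cvalue] are choices among
    representatives, from which nothing can be computed directly. The computations are therefore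
    made on jets of real functions, in which each of the first three entries is its value at the
    left end plus the integral of the next entry. Integration by parts then concerns primitives of
    merely integrable functions; it is obtained from Fubini's theorem on a half-plane instead of a
    product rule for derivatives. Complex Sobolev functions are translated into jets once, and the
    uniqueness of weak derivatives and of continuous representatives shows that the chosen objects
    agree with the jet. On a half-line, Green's formula has no contribution from infinity because
    the Lagrange bracket is integrable and has a limit. Test functions, as well as functions with
    prescribed boundary values, are built from [expR (- y^-1)]. *)

Definition smooth f := forall n x, derivable (derive1n n f) x 1.

Lemma is_derive_fun1 f g : (forall x : R, is_derive x 1 f (g x)) -> f^`()%classic = g.
Proof. by move=> fg; apply/funext => x; rewrite derive1E; apply: derive_val. Qed.

(** A coinduction principle: exhibiting a family stable under differentiation avoids any formula for
    higher derivatives. *)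
Lemma smooth_coind (S : (R -> R) -> Prop) :
  (forall f, S f -> exists2 g, S g & forall x : R, is_derive x 1 f (g x)) ->
  forall f, S f -> smooth f.
Proof.
move=> HS f Sf n; elim: n f Sf => [|n IH] f /HS [g Sg fg] x.
  by have [] := fg x.
by rewrite derive1Sn (is_derive_fun1 fg); exact: IH.
Qed.

Lemma smooth_is_derive f : smooth f -> forall x : R, is_derive x 1 f (f^`()%classic x).
Proof. by move=> sf x; rewrite derive1E; have := sf 0%N x; rewrite derive1n0 => /derivableP. Qed.

Lemma smooth_derive1 f : smooth f -> smooth f^`()%classic.
Proof. by move=> sf n x; rewrite -derive1Sn; exact: sf. Qed.

Lemma smooth_derive1n n f : smooth f -> smooth (derive1n n f).
Proof. move=> sf; elim: n => [|n IH]; first by rewrite derive1n0.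
rewrite derive1nS; exact: smooth_derive1.
Qed.

(** By the Leibniz rule this closure under sums and products is stable under differentiation, so
    [smooth_coind] applies to it. *)
Inductive smooth_alg : (R -> R) -> Prop :=
| smooth_alg_base f : smooth f -> smooth_alg f
| smooth_algD f g : smooth_alg f -> smooth_alg g -> smooth_alg (f \+ g)
| smooth_algM f g : smooth_alg f -> smooth_alg g -> smooth_alg (f \* g).

Lemma smooth_alg_smooth f : smooth_alg f -> smooth f.
Proof.
apply: smooth_coind => {}f; elim=> {f} [f sf|f g _ [f' Sf' ff'] _ [g' Sg' gg']
  |f g Sf [f' Sf' ff'] Sg [g' Sg' gg']].
- exists f^`()%classic; first by apply: smooth_alg_base; exact: smooth_derive1.
  exact: smooth_is_derive.
- by exists (f' \+ g') => [|x]; [exact: smooth_algD|exact: is_deriveD].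
- exists ((f \* g') \+ (g \* f')) => [|x].
    by apply: smooth_algD; exact: smooth_algM.
  exact: is_deriveM.
Qed.

Lemma smoothD f g : smooth f -> smooth g -> smooth (f \+ g).
Proof. by move=> sf sg; apply/smooth_alg_smooth/smooth_algD; exact: smooth_alg_base. Qed.

Lemma smoothM f g : smooth f -> smooth g -> smooth (f \* g).
Proof. by move=> sf sg; apply/smooth_alg_smooth/smooth_algM; exact: smooth_alg_base. Qed.

Lemma smooth_cst (c : R) : smooth (fun=> c).
Proof.
apply: (@smooth_coind (fun f => exists c, f = fun=> c)); last by exists c.
move=> f [{}c ->]; exists (fun=> 0); first by exists 0.
by move=> x; exact: is_derive_cst.
Qed.

Lemma smooth_continuous f : smooth f -> continuous f.
Proof.
move=> sf x; apply: differentiable_continuous.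
by apply/derivable1_diffP; have := sf 0%N x; rewrite derive1n0.
Qed.

(** Half of the exponent absorbs the new factor [t], by [1 + x <= expR x], and the other half is
    left to the induction hypothesis; hence the arbitrary [e]. *)
Lemma horner_le_expR p (e : R) : 0 < e ->
  exists C, forall t, 0 <= t -> `|p.[t]| <= C * expR (e * t).
Proof.
elim/poly_ind: p e => [|p c IH] e e0.
  by exists 0 => t _; rewrite horner0 normr0 mul0r.
have e20 : 0 < e / 2 by rewrite divr_gt0.
have [C HC] := IH _ e20.
exists ((e / 2)^-1 * `|C| + `|c|) => t t0.
rewrite hornerMXaddC (le_trans (ler_normD _ _))// mulrDl lerD//; last first.
  rewrite ler_peMr//.
  by rewrite (le_trans _ (expR_ge1Dx _))// lerDl mulr_ge0// ltW.
rewrite normrM (ger0_norm t0).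
have -> : e * t = (e / 2) * t + (e / 2) * t by field.
rewrite expRD mulrACA mulrC ler_pM//.
- rewrite ler_pdivlMl// (le_trans _ (expR_ge1Dx _))//.
  by rewrite lerDr.
- apply: (le_trans (HC _ t0)); rewrite ler_wpM2r// ?expR_ge0//.
  exact: ler_norm.
Qed.

(* With [p] a parameter, this family is stable under differentiation. *)
Definition flat p (s c x : R) : R :=
  let y := s * (x - c) in if 0 < y then p.[y^-1] * expR (- y^-1) else 0.

(** The quadratic bound yields derivative 0 at [c], the one point where the chain rule says nothing.
    It is the growth bound for ['X^2 * p] at [t = y^-1]. *)
Lemma flat_le p s c : exists C, forall x, `|flat p s c x| <= C * (x - c) ^+ 2.
Proof.
have [C HC] := horner_le_expR ('X^2 * p) ltr01.
exists (s ^+ 2 * `|C|) => x; rewrite /flat/=.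
case: ifPn => [y0|_]; last by rewrite normr0 mulr_ge0 ?sqr_ge0// mulr_ge0 ?sqr_ge0.
set y := s * _ in y0 *.
have -> : s ^+ 2 * `|C| * (x - c) ^+ 2 = `|C| * y ^+ 2 by rewrite /y; ring.
have yi0 : 0 <= y^-1 by rewrite invr_ge0 ltW.
have := HC _ yi0; rewrite mul1r hornerM hornerXn normrM ger0_norm ?exprn_ge0// => H.
rewrite normrM (ger0_norm (expR_ge0 _)) expRN ler_pdivrMr ?expR_gt0//.
rewrite mulrAC -ler_pdivrMr ?exprn_gt0// -exprVn mulrC.
by rewrite (le_trans H)// ler_wpM2r ?expR_ge0 ?ler_norm.
Qed.

Lemma is_derive_flat p s c x : s != 0 ->
  is_derive x (1:R) (flat p s c) (flat (s *: ('X^2 * (p - p^`()))) s c x).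
Proof.
move=> s0.
have nc : continuous (fun z : R => s * (z - c)).
  by move=> z; apply: cvgM; [exact: cvg_cst|apply: cvgB; [exact: cvg_id|exact: cvg_cst]].
have [y0|y0|y0] := ltgtP 0 (s * (x - c)).
- have yn0 : s * (x - c) != 0 by rewrite gt_eqF.
  rewrite {2}/flat y0.
  apply: (@near_eq_is_derive _ _ _ (fun z => p.[(s * (z - c))^-1] * expR (- (s * (z - c))^-1))).
  + near=> z; rewrite /flat ifT//; near: z.
    exact: (cvgr_gt (s * (x - c)) (nc x)).
  + have dy : is_derive x (1:R) (fun z : R => s * (z - c)) s.
      apply: is_derive_eq; rewrite subr0 ?scaler1 ?mulr1 /GRing.scale/=; ring.
    have dyi : is_derive x (1:R) (fun z : R => (s * (z - c))^-1) (- (s * (x - c)) ^- 2 * s).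
      exact: (@is_deriveV _ (fun z : R => s * (z - c)) _ _ _ yn0 dy).
    have d1 := @is_derive1_comp R (horner p) (fun z : R => (s * (z - c))^-1) x _ _ (is_derive_poly p _) dyi.
    have d2 := @is_derive1_comp R expR (fun z : R => - (s * (z - c))^-1) x _ _ (is_derive_expR _) (is_deriveN dyi).
    apply: (is_derive_eq (is_deriveM d1 d2)).
    rewrite /GRing.scale/= !hornerE/=.
    set y := s * (x - c) in yn0 *; set E := expR _; field.
    by rewrite /y in yn0.
- rewrite {2}/flat ltNge (ltW y0)/=.
  apply: (@near_eq_is_derive _ _ _ (cst 0)).
  + near=> z; rewrite /flat/=; case: ifPn => // z0.
    exfalso; move: z0; apply/negP; rewrite -leNgt ltW//.
    near: z; exact: (cvgr_lt (s * (x - c)) (nc x)).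
have xc : x = c.
  by move/eqP: y0; rewrite eq_sym mulf_eq0 (negbTE s0)/= subr_eq0 => /eqP.
have flatc q : flat q s c c = 0 by rewrite /flat subrr mulr0 ltxx.
rewrite xc flatc.
have [C HC] := flat_le p s c.
have H : (fun h : R => h^-1 *: ((flat p s c \o shift c) (h *: (1:R)) - flat p s c c)) @ 0^' --> (0:R).
  apply/cvgr0Pnorm_le => e e0.
  near=> h.
  rewrite flatc subr0 /= /GRing.scale/= mulr1 normrM normfV.
  have h0 : h != 0 by near: h; exact: nbhs_dnbhs_neq.
  rewrite ler_pdivrMl ?normr_gt0// (le_trans (HC _))// addrK.
  rewrite -real_normK ?num_real// expr2 mulrA mulrC ler_wpM2l//.
  have C0 : 0 < `|C| + 1 by rewrite ltr_wpDl.
  rewrite (@le_trans _ _ ((`|C| + 1) * `|h|))// ?ler_wpM2r//.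
    by rewrite (le_trans (ler_norm _))// lerDl.
  rewrite -ler_pdivlMl//; near: h.
  apply: dnbhs0_le; by rewrite mulr_gt0 ?invr_gt0.
split; first by apply/cvg_ex; exists 0.
by apply: cvg_lim => //.
Unshelve. all: end_near.
Qed.

Lemma smooth_flat p s c : s != 0 -> smooth (flat p s c).
Proof.
move=> s0; apply: (@smooth_coind (fun f => exists p, f = flat p s c)); last by exists p.
move=> f [{}p ->]; eexists; last by move=> x; exact: is_derive_flat.
by eexists.
Qed.

(** The factor [n.+1] steepens both flanks, so that the bumps tend pointwise to the indicator
    function of []c, d[]. *)
Definition bump (c d : R) (n : nat) : R -> R :=
  flat 1 n.+1%:R c \* flat 1 (- n.+1%:R) d.

Lemma smooth_bump c d n : smooth (bump c d n).
Proof. by apply: smoothM; apply: smooth_flat; rewrite ?oppr_eq0 pnatr_eq0. Qed.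

Lemma flat_01 s c x : 0 <= flat 1 s c x <= 1.
Proof.
rewrite /flat; case: ifPn => y0; last by rewrite lexx ler01.
by rewrite hornerC mul1r expR_ge0 expR_le1 oppr_le0 invr_ge0 ltW.
Qed.

Lemma bump_01 c d n x : 0 <= bump c d n x <= 1.
Proof.
have /andP[a0 a1] := flat_01 n.+1%:R c x; have /andP[b0 b1] := flat_01 (- n.+1%:R) d x.
by rewrite /bump/= mulr_ge0//= mulr_ile1.
Qed.

Lemma bump_out c d n x : ~ (c < x < d) -> bump c d n x = 0.
Proof.
move=> /negP; rewrite negb_and -!leNgt /bump/= => /orP[xc|dx].
  by rewrite {1}/flat ltNge mulr_ge0_le0 ?subr_le0//= mul0r.
by rewrite {2}/flat ltNge mulr_le0_ge0 ?oppr_le0 ?subr_ge0//= mulr0.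
Qed.

Lemma cvg_flat1 (s : nat -> R) (t c x : R) : (forall n, s n = n.+1%:R * t) ->
  0 < t * (x - c) -> flat 1 (s n) c x @[n --> \oo] --> (1:R).
Proof.
move=> st y0.
have -> : (fun n => flat 1 (s n) c x) = (fun n => expR (- ((t * (x - c))^-1 * n.+1%:R^-1))).
  apply/funext => n; rewrite /flat st -mulrA mulr_gt0// hornerC mul1r.
  by rewrite invfM mulrC.
have H : - ((t * (x - c))^-1 * n.+1%:R^-1) @[n --> \oo] --> (0 : R).
  have -> : (0 : R) = - ((t * (x - c))^-1 * 0) by rewrite mulr0 oppr0.
  by apply: cvgN; apply: cvgM; [exact: cvg_cst|exact: cvg_harmonic].
by rewrite -[X in _ --> X]expR0; apply: (cvg_comp _ _ H); exact: continuous_expR.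
Qed.

Lemma cvg_bump c d x :
  bump c d n x @[n --> \oo] --> ((c < x < d)%R%:R : R).
Proof.
case: (boolP (c < x < d)) => [/andP[cx xd]|/negP nx]; last first.
  under eq_cvg do rewrite bump_out//.
  exact: cvg_cst.
rewrite -[X in _ --> X](mulr1 (1:R)); apply: cvgM.
  by apply: (@cvg_flat1 _ 1) => [n|]; rewrite ?mulr1// mul1r subr_gt0.
by apply: (@cvg_flat1 _ (-1)) => [n|]; rewrite ?mulrN1// mulN1r opprB subr_gt0.
Qed.

End smooth_functions.

(** * Integration by parts for primitives of integrable functions *)

Section fubini_kernel.
Variable R : realType.
Notation mu := (@lebesgue_measure R).
Let TT := (measurableTypeR R * measurableTypeR R)%type.
Implicit Types (f g : R -> R) (k : TT -> R).

Lemma integrable_dom (D : set R) f g : measurable D -> measurable_fun D f ->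
  mu.-integrable D (EFin \o g) -> (forall x, D x -> `|f x| <= `|g x|) ->
  mu.-integrable D (EFin \o f).
Proof.
move=> mD mf gi fg; apply: (@le_integrable _ _ R mu _ mD _ (EFin \o g)) => //.
exact/measurable_EFinP.
Qed.

Lemma kernel_measurable f g k : measurable_fun setT f -> measurable_fun setT g ->
  measurable_fun setT k ->
  measurable_fun setT (fun z : TT => f z.1 * g z.2 * k z).
Proof.
move=> mf mg mk; apply: measurable_funM => //; apply: measurable_funM.
  exact: (measurableT_comp mf measurable_fst).
exact: (measurableT_comp mg measurable_snd).
Qed.

(** The kernels in view are indicators of half-planes. Being bounded by 1, they leave [f x * g y] as
    a majorant, which is integrable by Tonelli. *)
Lemma kernel_integrable f g k : mu.-integrable setT (EFin \o f) ->
  mu.-integrable setT (EFin \o g) -> measurable_fun setT k ->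
  (forall z, 0 <= k z <= 1) ->
  (mu \x mu)%E.-integrable setT (fun z : TT => (f z.1 * g z.2 * k z)%:E).
Proof.
move=> fi gi mk k01.
have mf : measurable_fun setT f by apply/measurable_EFinP; exact: measurable_int fi.
have mg : measurable_fun setT g by apply/measurable_EFinP; exact: measurable_int gi.
have fa := integrable_norm fi; have ga := integrable_norm gi.
have -> : (fun z : TT => (f z.1 * g z.2 * k z)%:E) =
  EFin \o (fun z : TT => f z.1 * g z.2 * k z) by [].
apply: (@le_integrable _ _ _ _ _ measurableT _
  (EFin \o (fun z : TT => f z.1 * g z.2 * cst 1 z))).
- by apply/measurable_EFinP; exact: kernel_measurable.
- move=> z _ /=; rewrite lee_fin mulr1 normrM ler_piMr//.
  by have /andP[k0 k1] := k01 z; rewrite ger0_norm.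
apply/integrable12ltyP.
  by apply/measurable_EFinP; apply: kernel_measurable.
rewrite (_ : (fun x => _) = (fun x => (`|f x|)%R%:E * (\int[mu]_y (`|g y|)%R%:E))%E).
  rewrite ge0_integralZr//.
  - by apply: lte_mul_pinfty => //; [exact: integral_ge0
     |exact: integrable_fin_num|exact: integrable_lty].
  - by apply/measurable_EFinP; exact: measurableT_comp.
  - exact: integral_ge0.
apply/funext => x; rewrite -ge0_integralZl//.
- by apply: eq_integral => y _; rewrite /= mulr1 normrM EFinM.
- by apply/measurable_EFinP; exact: measurableT_comp.
Qed.

Lemma integrable_mul01 f (l : R -> R) : mu.-integrable setT (EFin \o f) ->
  measurable_fun setT l -> (forall z, 0 <= l z <= 1) ->
  mu.-integrable setT (EFin \o (fun x => f x * l x)).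
Proof.
move=> fi ml l01; apply: (@integrable_dom _ _ f) => //.
  apply: measurable_funM => //.
  by apply/measurable_EFinP; exact: measurable_int fi.
move=> x _ /=; rewrite normrM ler_piMr//.
by have /andP[k0 k1] := l01 x; rewrite ger0_norm.
Qed.

Lemma integrable_kernelr g k x : mu.-integrable setT (EFin \o g) ->
  measurable_fun setT k -> (forall z, 0 <= k z <= 1) ->
  mu.-integrable setT (EFin \o (fun y => g y * k (x, y))).
Proof.
move=> gi mk k01; apply: integrable_mul01 => //.
exact: (measurableT_comp mk (measurable_pair1 x)).
Qed.

Lemma integrable_kernell f k y : mu.-integrable setT (EFin \o f) ->
  measurable_fun setT k -> (forall z, 0 <= k z <= 1) ->
  mu.-integrable setT (EFin \o (fun x => f x * k (x, y))).
Proof.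
move=> fi mk k01; apply: integrable_mul01 => //.
exact: (measurableT_comp mk (measurable_pair2 y)).
Qed.

Lemma fubini_kernel f g k : mu.-integrable setT (EFin \o f) ->
  mu.-integrable setT (EFin \o g) -> measurable_fun setT k ->
  (forall z, 0 <= k z <= 1) ->
  \int[mu]_x (f x * \int[mu]_y (g y * k (x, y))) =
  \int[mu]_y (g y * \int[mu]_x (f x * k (x, y))).
Proof.
move=> fi gi mk k01.
have I1 x := integrable_kernelr x gi mk k01.
have I2 y := integrable_kernell y fi mk k01.
have H : (\int[mu]_x \int[mu]_y (f x * g y * k (x, y))%:E =
          \int[mu]_y \int[mu]_x (f x * g y * k (x, y))%:E)%E.
  exact: (Fubini (kernel_integrable fi gi mk k01)).
rewrite /Rintegral; congr fine.
transitivity (\int[mu]_x \int[mu]_y (f x * g y * k (x, y))%:E)%E.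
  apply: eq_integral => x _; rewrite EFinM fineK; last exact: (integrable_fin_num measurableT (I1 x)).
  rewrite -(integralZl measurableT (I1 x)); apply: eq_integral => y _.
  by rewrite -EFinM mulrA.
rewrite H; apply: eq_integral => y _; rewrite EFinM fineK; last exact: (integrable_fin_num measurableT (I2 y)).
rewrite -(integralZl measurableT (I2 y)); apply: eq_integral => x _.
by rewrite -EFinM mulrCA mulrA.
Qed.

Lemma kernel_integrable1 f g k : mu.-integrable setT (EFin \o f) ->
  mu.-integrable setT (EFin \o g) -> measurable_fun setT k ->
  (forall z, 0 <= k z <= 1) ->
  mu.-integrable setT (EFin \o (fun x => f x * \int[mu]_y (g y * k (x, y)))).
Proof.
move=> fi gi mk k01.
apply: eq_integrable (integrable_fubini_F (kernel_integrable fi gi mk k01)) => // x _.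
rewrite /fubini_F /= /Rintegral EFinM.
rewrite fineK; last exact: (integrable_fin_num measurableT (integrable_kernelr x gi mk k01)).
rewrite -(integralZl measurableT (integrable_kernelr x gi mk k01)).
by apply: eq_integral => y _; rewrite -EFinM mulrA.
Qed.

Lemma Rintegral_mul_le f (x : R) :
  \int[mu]_y (f y * (y <= x)%R%:R) = \int[mu]_(y in `]-oo, x]) f y.
Proof.
rewrite [RHS]Rintegral_mkcond; apply: eq_Rintegral => y _; rewrite patchE.
by rewrite mem_setE in_itv/=; case: ifP; rewrite ?mulr1 ?mulr0.
Qed.

Lemma Rintegral_mul_ge f (x : R) :
  \int[mu]_y (f y * (x <= y)%R%:R) = \int[mu]_(y in `[x, +oo[) f y.
Proof.
rewrite [RHS]Rintegral_mkcond; apply: eq_Rintegral => y _; rewrite patchE.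
by rewrite mem_setE in_itv/= andbT; case: ifP; rewrite ?mulr1 ?mulr0.
Qed.

Lemma Rintegral_split f (x : R) : mu.-integrable setT (EFin \o f) ->
  \int[mu]_(y in `]-oo, x]) f y + \int[mu]_(y in `[x, +oo[) f y = \int[mu]_y f y.
Proof.
move=> fi; rewrite -(@Rintegral_itv_obnd_cbnd _ x +oo%O); last first.
  exact: integrableS fi.
have := @Rintegral_itvB _ f -oo%O +oo%O x; rewrite set_itvNyy => <- //.
by rewrite addrC subrK.
Qed.

Lemma measurable_ler_nat d (T : measurableType d) (h l : T -> R) :
  measurable_fun setT h -> measurable_fun setT l ->
  measurable_fun setT (fun z => (h z <= l z)%R%:R : R).
Proof.
move=> mh ml; apply: (measurableT_comp (f := fun b : bool => b%:R : R)) => //.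
exact: measurable_fun_ler.
Qed.

(** Exchanging the integrals in the second term, over the half-plane [x <= y], turns it into the
    integral of [f x] against that of [g] over [[x, +oo[]. Together with the first term, the inner
    integrals add up to the whole integral of [g]. *)
Lemma integration_by_parts_T f g : mu.-integrable setT (EFin \o f) ->
  mu.-integrable setT (EFin \o g) ->
  \int[mu]_x (f x * \int[mu]_(y in `]-oo, x]) g y) +
  \int[mu]_x (g x * \int[mu]_(y in `]-oo, x]) f y) =
  (\int[mu]_x f x) * \int[mu]_x g x.
Proof.
move=> fi gi.
pose k := fun z : TT => ((z.1 : R) <= z.2)%R%:R : R.
pose l := fun z : TT => ((z.2 : R) <= z.1)%R%:R : R.
have mk : measurable_fun setT k.
  by apply: measurable_ler_nat; [exact: measurable_fst|exact: measurable_snd].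
have ml : measurable_fun setT l.
  by apply: measurable_ler_nat; [exact: measurable_snd|exact: measurable_fst].
have b01 (b : bool) : 0 <= (b%:R : R) <= 1 by case: b; rewrite lexx ler01.
have H := fubini_kernel fi gi mk (fun=> b01 _).
under [X in _ + X]eq_Rintegral do rewrite -Rintegral_mul_le.
rewrite -H.
under [X in X + _]eq_Rintegral do rewrite -Rintegral_mul_le.
rewrite -RintegralD; last 3 first.
- exact: measurableT.
- exact: (kernel_integrable1 fi gi ml (fun=> b01 _)).
- exact: (kernel_integrable1 fi gi mk (fun=> b01 _)).
transitivity (\int[mu]_x (f x * \int[mu]_y g y)); last by rewrite RintegralZr.
apply: eq_Rintegral => x _.
by rewrite Rintegral_mul_le Rintegral_mul_ge -mulrDr Rintegral_split.
Qed.

End fubini_kernel.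

Section almost_everywhere_monotone.
Variable R : realType.
Notation mu := (@lebesgue_measure R).

Lemma ae_mono (P Q : R -> Prop) : (forall x, P x -> Q x) ->
  {ae mu, forall x, P x} -> {ae mu, forall x, Q x}.
Proof.
move=> PQ; apply: negligibleS => x /= nQ Px; exact/nQ/PQ.
Qed.

Lemma ae_mono2 (P Q S : R -> Prop) : (forall x, P x -> Q x -> S x) ->
  {ae mu, forall x, P x} -> {ae mu, forall x, Q x} -> {ae mu, forall x, S x}.
Proof.
move=> PQS Pae Qae; apply: negligibleS (negligibleU Pae Qae) => x /= nS.
by apply/not_andP => -[Px Qx]; apply/nS/PQS.
Qed.

End almost_everywhere_monotone.

Section real_integrable.
Variables (R : realType) (D : set R).
Hypothesis mD : measurable D.
Notation mu := (@lebesgue_measure R).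
Notation intble f := (mu.-integrable D (EFin \o f)).
Implicit Types (f g : R -> R).

Lemma intbleD f g : intble f -> intble g -> intble (fun x => f x + g x).
Proof. by move=> fi gi; have := @integrableD _ _ R mu D mD _ _ fi gi. Qed.

Lemma intbleB f g : intble f -> intble g -> intble (fun x => f x - g x).
Proof. by move=> fi gi; have := @integrableB _ _ R mu D mD _ _ fi gi. Qed.

Lemma intbleZ c f : intble f -> intble (fun x => c * f x).
Proof. by move=> fi; have := @integrableZl _ _ R mu D mD c _ fi. Qed.

Lemma intbleZr c f : intble f -> intble (fun x => f x * c).
Proof. by move=> /(intbleZ c); under eq_fun do rewrite mulrC. Qed.

Lemma eq_intble f g : {in D, f =1 g} -> intble f -> intble g.
Proof.
move=> fg; apply: (@eq_integrable _ _ R mu D mD (EFin \o f)) => x xD /=.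
by rewrite fg.
Qed.

Lemma intble_measurable f : intble f -> measurable_fun D f.
Proof. by move=> fi; apply/measurable_EFinP; exact: measurable_int fi. Qed.

End real_integrable.

(** * Primitives taken from the left end of an interval *)

Section primitive.
Variables (R : realType) (I : set R).
Hypothesis mI : measurable I.
Notation mu := (@lebesgue_measure R).
Implicit Types (f g h : R -> R).

Definition trunc (b : R) : set R := I `&` [set` `]-oo, b]].

(** Integrability up to the left end of [I], but only locally towards the right: this is what square
    integrability gives on a half-line. It lets [prim] start at the left end, where boundary values
    are read. *)
Definition left_integrable h := forall b, mu.-integrable (trunc b) (EFin \o h).

Definition prim h (x : R) : R := \int[mu]_(t in trunc x) h t.

Lemma measurable_trunc b : measurable (trunc b).
Proof. exact: measurableI. Qed.

Lemma integrable_trunc h b : left_integrable h ->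
  mu.-integrable setT (EFin \o (h \_ (trunc b))).
Proof.
move=> hi; rewrite -restrict_EFin; apply/integrable_restrict => //.
  exact: measurable_trunc.
by rewrite setTI.
Qed.

Lemma left_integrable_measurable h : left_integrable h ->
  forall b, measurable_fun (trunc b) h.
Proof. by move=> hi b; apply/measurable_EFinP; exact: measurable_int (hi b). Qed.

Lemma truncS x b : x <= b -> trunc b `&` [set` `]-oo, x]] = trunc x.
Proof.
move=> xb; rewrite /trunc -setIA; congr (_ `&` _); apply/setIidPr => y /=.
by rewrite !in_itv/= => /le_trans; apply.
Qed.

(** Restricting [h] to [trunc b] makes it integrable on the whole line without changing its
    primitive up to [b]; results on the line are transported this way. *)
Lemma primE h b x : x <= b ->
  prim h x = \int[mu]_(t in `]-oo, x]) (h \_ (trunc b)) t.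
Proof. by move=> xb; rewrite -Rintegral_mkcondl truncS. Qed.

Lemma Rintegral_trunc h b :
  \int[mu]_(t in trunc b) h t = \int[mu]_t (h \_ (trunc b)) t.
Proof. exact: Rintegral_mkcond. Qed.

Lemma restrictM f g (A : set R) : (fun x => f x * g x) \_ A = (fun x => (f \_ A) x * g x).
Proof. by apply/funext => x; rewrite !patchE; case: ifP => //; rewrite mul0r. Qed.

Lemma integrable_mul_prim f g b : left_integrable f -> left_integrable g ->
  mu.-integrable (trunc b) (EFin \o (fun x => f x * prim g x)).
Proof.
move=> fi gi; rewrite -(setTI (trunc b)).
apply/(integrable_restrict mu (measurable_trunc b) measurableT).
have k01 (c : bool) : 0 <= (c%:R : R) <= 1 by case: c; rewrite lexx ler01.
have mk : measurable_fun setT (fun z : measurableTypeR R * measurableTypeR R =>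
    ((z.2 : R) <= z.1)%R%:R : R).
  by apply: measurable_ler_nat; [exact: measurable_snd|exact: measurable_fst].
have := kernel_integrable1 (integrable_trunc b fi) (integrable_trunc b gi) mk (fun=> k01 _).
apply: eq_integrable => // x _ /=.
rewrite Rintegral_mul_le restrict_EFin/= restrictM.
case: (boolP (x \in trunc b)) => xb; last by rewrite patchE (negbTE xb) !mul0r.
have {}xb : x <= b by move: xb; rewrite inE /trunc => -[_] /=; rewrite in_itv.
by rewrite (primE g xb).
Qed.

Lemma prim_parts f g b : left_integrable f -> left_integrable g ->
  \int[mu]_(x in trunc b) (f x * prim g x) +
  \int[mu]_(x in trunc b) (g x * prim f x) = prim f b * prim g b.
Proof.
move=> fi gi.
have := integration_by_parts_T (integrable_trunc b fi) (integrable_trunc b gi).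
rewrite -!Rintegral_trunc => <-; rewrite !Rintegral_trunc.
congr (_ + _); apply: eq_Rintegral => x _; rewrite restrictM patchE.
- case: ifPn => [xb|_]; last by rewrite !mul0r.
  by rewrite (@primE g b)//; move: xb; rewrite inE => -[_] /=; rewrite in_itv.
- case: ifPn => [xb|_]; last by rewrite !mul0r.
  by rewrite (@primE f b)//; move: xb; rewrite inE => -[_] /=; rewrite in_itv.
Qed.

(** [c] and [d] stand for the values at the left end of [I], so the right-hand side is the increment
    of the product up to [b]. *)
Lemma prim_cst_parts f g (c d b : R) : left_integrable f -> left_integrable g ->
  \int[mu]_(x in trunc b) (f x * (d + prim g x) + g x * (c + prim f x)) =
  (c + prim f b) * (d + prim g b) - c * d.
Proof.
move=> fi gi; have mb := measurable_trunc b.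
have E h l e : left_integrable h -> left_integrable l ->
    mu.-integrable (trunc b) (EFin \o (fun x => h x * (e + prim l x))).
  move=> hi li; under eq_fun do rewrite mulrDr.
  by apply: intbleD => //; [exact: intbleZr|exact: integrable_mul_prim].
have E2 h l e : left_integrable h -> left_integrable l ->
    \int[mu]_(x in trunc b) (h x * (e + prim l x)) =
    prim h b * e + \int[mu]_(x in trunc b) (h x * prim l x).
  move=> hi li; under eq_Rintegral do rewrite mulrDr.
  rewrite RintegralD//; [|exact: intbleZr|exact: integrable_mul_prim].
  by rewrite RintegralZr.
rewrite RintegralD//; [|exact: E|exact: E].
rewrite !E2// addrACA prim_parts//; ring.
Qed.

Lemma continuous_prim h : left_integrable h -> continuous (prim h).
Proof.
move=> hi x.
(* Near [x] the primitive is a constant plus an integral, starting at [x - 1], of a function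
   integrable on the whole line. *)
pose F := h \_ (trunc (x + 1)).
have Fi : mu.-integrable setT (EFin \o F) by exact: integrable_trunc.
have Fii (A : set R) : measurable A -> mu.-integrable A (EFin \o F).
  by move=> mA; exact: integrableS Fi.
have E : {in `]x - 1, x + 1[, forall y, prim h y =
   \int[mu]_(t in `]-oo, x - 1]) F t + parameterized_integral mu (x - 1) y F}.
  move=> y; rewrite in_itv/= => /andP[xy yx].
  rewrite (primE _ (ltW yx)) -/F /parameterized_integral -Rintegral_itv_obnd_cbnd; last exact: Fii.
  rewrite -(@Rintegral_itvB _ F -oo%O (BRight y))//; first by rewrite addrC subrK.
  - exact: Fii.
  - by rewrite bnd_simp ltW.
have lt1 : x - 1 < x + 1 by rewrite ltrD2l gt0_cp.
have pc := parameterized_integral_continuous (ltW lt1) (Fii _ (measurable_itv _)).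
have xin : x \in `]x - 1, x + 1[ by rewrite in_itv/= ltrBlDr !ltrDl ltr01.
have {pc} /(_ x xin) pc := within_continuous_continuous lt1 pc.
pose G y := \int[mu]_(t in `]-oo, x - 1]) F t + parameterized_integral mu (x - 1) y F.
have GG : G @ x --> G x by apply: cvgD; [exact: cvg_cst|exact: pc].
rewrite /continuous_at E//; apply: cvg_trans GG.
apply: near_eq_cvg; near=> y; apply/esym/E; near: y.
exact: near_in_itvoo.
Unshelve. all: end_near.
Qed.

End primitive.

(** * Test functions and the du Bois-Reymond lemma *)

Section test_functions.
Variables (R : realType) (I : set R).
Hypotheses (oI : open I) (iI : is_interval I).
Notation mu := (@lebesgue_measure R).
Implicit Types (f g h : R -> R).

Let mI : measurable I := open_measurable oI.

(** Vanishing off a segment with ends in [I] is the form in which compact support is used; [d < c]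
    is allowed and forces [f] to be zero. *)
Definition rtest f := smooth f /\
  exists c d, [/\ I c, I d & forall x, ~ (c <= x <= d) -> f x = 0].

Lemma rtest_derive1 f : rtest f -> rtest f^`()%classic.
Proof.
move=> [sf [c [d [Ic Id f0]]]]; split; first exact: smooth_derive1.
exists c, d; split => // x /negP xcd.
rewrite derive1E; suff [_ ->] : is_derive x (1:R) f 0 by [].
apply: (near_eq_is_derive (f := cst 0)) => //.
move: xcd; rewrite negb_and -!ltNge => /orP[xc|dx].
- near=> z; rewrite f0// => /andP[cz _].
  by have : z < c by [near: z; exact: lt_nbhsl]; rewrite ltNge cz.
- near=> z; rewrite f0// => /andP[_ zd].
  by have : d < z by [near: z; exact: lt_nbhsr]; rewrite ltNge zd.
Unshelve. all: end_near.
Qed.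

Lemma rtest_continuous f : rtest f -> continuous f.
Proof. by move=> [/smooth_continuous]. Qed.

Lemma rtest_measurable f (D : set R) : measurable D -> rtest f -> measurable_fun D f.
Proof.
move=> mD /rtest_continuous cf; apply: measurable_funTS.
exact: continuous_measurable_fun.
Qed.

Lemma rtest_bounded f : rtest f -> exists M, forall x, `|f x| <= M.
Proof.
move=> tf; have cf := rtest_continuous tf; have [_ [c [d [_ _ f0]]]] := tf.
have [cd|dc] := leP c d; last first.
  exists 0 => x; rewrite f0 ?normr0// => /andP[cx xd].
  by move: dc; rewrite ltNge (le_trans cx).
have cn : {within `[c, d], continuous (fun x => `|f x|)}.
  by apply: continuous_subspaceT => x; apply: cvg_norm; exact: cf.
have [m _ Hm] := EVT_max cd cn.
exists `|f m| => x; have [xcd|/negP xcd] := boolP (c <= x <= d).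
  by apply: Hm; rewrite in_itv.
by rewrite f0// normr0.
Qed.

Lemma integrable_mul_bounded (D : set R) f g (M : R) : measurable D ->
  mu.-integrable D (EFin \o f) -> measurable_fun D g ->
  (forall x, D x -> `|g x| <= M) ->
  mu.-integrable D (EFin \o (fun x => f x * g x)).
Proof.
move=> mD fi mg gM; apply: (@integrable_dom _ _ _ (fun x => M * f x)) => //.
- by apply: measurable_funM => //; exact: intble_measurable fi.
- exact: intbleZ.
- move=> x Dx; rewrite !normrM mulrC ler_wpM2r// (le_trans (gM _ Dx))//.
  exact: ler_norm.
Qed.

Lemma rtest_integrable (D : set R) f : measurable D -> rtest f ->
  mu.-integrable D (EFin \o f).
Proof.
move=> mD tf; apply: (@integrableS _ _ _ mu setT) => //.
have [_ [c [d [_ _ f0]]]] := tf.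
have -> : f = f \_ `[c, d].
  apply/funext => x; rewrite patchE mem_setE in_itv/=; case: ifPn => // /negP.
  exact: f0.
rewrite -restrict_EFin; apply/integrable_restrict => //; rewrite setTI.
apply: (@continuous_compact_integrable R); first exact: segment_compact.
by apply: continuous_subspaceT; exact: rtest_continuous.
Qed.

Lemma rtest_left_integrable f : rtest f -> left_integrable I f.
Proof. by move=> tf b; apply: rtest_integrable => //; exact: measurable_trunc. Qed.

Lemma integrable_mul_test h f : left_integrable I h -> rtest f ->
  mu.-integrable I (EFin \o (fun x => h x * f x)).
Proof.
move=> hi tf; have [M fM] := rtest_bounded tf; have [_ [c [d [_ _ f0]]]] := tf.
apply: (@eq_intble _ _ mI (fun x => (h \_ (trunc I d)) x * f x)).
  move=> x; rewrite inE patchE => Ix; case: ifPn => // xd.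
  rewrite f0 ?mulr0// => /andP[_ xd']; move: xd; rewrite notin_setE; apply.
  by split => //=; rewrite in_itv.
apply: (@integrable_mul_bounded _ _ _ M) => //.
  by apply: integrableS (integrable_trunc mI d hi).
exact: rtest_measurable.
Qed.

Lemma prim_rtest_derive1 f : rtest f -> prim I f^`()%classic =1 f.
Proof.
move=> tf x; have [sf [c [d [Ic Id f0]]]] := tf.
have [_ [c' [d' [Ic' Id' f'0]]]] := rtest_derive1 tf.
(* [e] lies to the left of [x] and of both segments. It may fall outside [I], but [f] and its
   derivative vanish to the left of their segments. *)
pose e := Num.min (Num.min c c') x - 1.
have ec : e < c by rewrite /e ltrBlDr (@le_lt_trans _ _ c) ?ge_min ?lexx// ltrDl.
have ec' : e < c' by rewrite /e ltrBlDr (@le_lt_trans _ _ c') ?ge_min ?lexx ?orbT// ltrDl.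
have ex : e < x by rewrite /e ltrBlDr (@le_lt_trans _ _ x) ?ge_min ?lexx ?orbT// ltrDl.
transitivity (\int[mu]_(t in `[e, x]) f^`()%classic t); last first.
  rewrite /Rintegral (@continuous_FTC2 _ _ f)//.
  - by rewrite /= [f e]f0 ?subr0// => /andP[/(lt_le_trans ec)]; rewrite ltxx.
  - apply: continuous_subspaceT; exact/rtest_continuous/rtest_derive1.
  - split => [y _||]; first by have := sf 0%N y; rewrite derive1n0.
      by apply: cvg_at_right_filter; exact: rtest_continuous.
    by apply: cvg_at_left_filter; exact: rtest_continuous.
rewrite /prim [LHS]Rintegral_mkcond [RHS]Rintegral_mkcond.
apply: eq_Rintegral => y _; rewrite !patchE.
have [ycd|/negP ycd] := boolP (c' <= y <= d'); last first.
  by rewrite f'0//; case: ifP; case: ifP.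
have Iy : I y by exact: (iI Ic' Id').
rewrite mem_setE in_itv/= (le_trans (ltW ec')) ?(andP ycd).1//=.
rewrite /trunc; case: (boolP (y <= x)) => yx.
  by rewrite mem_set//; split=> //=; rewrite in_itv.
by rewrite memNset// => -[_ /=]; rewrite in_itv/=; apply/negP.
Qed.

Lemma test_parts h (k : R) f : left_integrable I h -> rtest f ->
  \int[mu]_(x in I) ((k + prim I h x) * f^`()%classic x) =
  - \int[mu]_(x in I) (h x * f x).
Proof.
move=> hi tf; have tf' := rtest_derive1 tf.
have [_ [c [d [Ic Id f0]]]] := tf; have [_ [c' [d' [Ic' Id' f'0]]]] := tf'.
(* [b] lies beyond both segments: integrals over [I] reduce to [trunc I b], and the boundary term at
   [b] vanishes with [f b]. *)
pose b := Num.max d d' + 1.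
have db : d < b by rewrite /b (@le_lt_trans _ _ (Num.max d d')) ?le_max ?lexx// ltrDl.
have db' : d' < b by rewrite /b (@le_lt_trans _ _ (Num.max d d')) ?le_max ?lexx ?orbT// ltrDl.
have fi := rtest_left_integrable tf; have fi' := rtest_left_integrable tf'.
have E (g l : R -> R) : (forall x, b < x -> g x = 0) ->
    \int[mu]_(x in I) (l x * g x) = \int[mu]_(x in trunc I b) (l x * g x).
  move=> g0; rewrite Rintegral_mkcondr; apply: eq_Rintegral => x _.
  rewrite patchE mem_setE in_itv/=; case: (leP x b) => // bx.
  by rewrite g0// mulr0.
have fb0 x : b < x -> f x = 0.
  by move=> bx; rewrite f0// => /andP[_ xd]; move: (lt_trans db bx); rewrite ltNge xd.
have fb0' x : b < x -> f^`()%classic x = 0.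
  by move=> bx; rewrite f'0// => /andP[_ xd]; move: (lt_trans db' bx); rewrite ltNge xd.
rewrite !E//; apply/eqP; rewrite -addr_eq0; apply/eqP.
have := @prim_cst_parts _ _ mI _ _ 0 k b fi' hi.
rewrite mul0r subr0 add0r prim_rtest_derive1// [f b]f0; last first.
  by move=> /andP[_]; rewrite leNgt db.
rewrite mul0r => <-; rewrite -RintegralD.
- apply: eq_Rintegral => x _.
  by rewrite add0r prim_rtest_derive1// mulrC.
- exact: measurable_trunc.
- under eq_fun do rewrite mulrC mulrDr.
  apply: intbleD; first exact: measurable_trunc.
    by apply: intbleZr => //; exact: measurable_trunc.
  exact: integrable_mul_prim.
- apply: integrableS (integrable_mul_test hi tf) => //; first exact: measurable_trunc.
  by move=> x [].
Qed.

Lemma rtest_bump c d n : I c -> I d -> rtest (bump c d n).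
Proof.
move=> Ic Id; split; first exact: smooth_bump.
exists c, d; split => // x xcd; apply: bump_out => /andP[cx xd].
by apply: xcd; rewrite !ltW.
Qed.

(** Dominated convergence, the bumps being bounded by 1. Smooth test functions thus determine the
    integrals over all intervals with ends in [I]. *)
Lemma cvg_int_bump h c d : left_integrable I h -> I c -> I d ->
  \int[mu]_(x in I) (h x * bump c d n x) @[n --> \oo] -->
  \int[mu]_(x in `]c, d[) h x.
Proof.
move=> hi Ic Id.
have sI : `]c, d[ `<=` trunc I d.
  move=> x; rewrite /= in_itv/= => /andP[cx xd]; split.
    by apply: (iI Ic Id); rewrite !ltW.
  by rewrite /= in_itv/= ltW.
have hii : mu.-integrable `]c, d[ (EFin \o h).
  by apply: integrableS (hi d) => //; exact: measurable_trunc.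
have mh : measurable_fun `]c, d[ h by exact: intble_measurable hii.
have E n : \int[mu]_(x in I) (h x * bump c d n x) =
    \int[mu]_(x in `]c, d[) (h x * bump c d n x).
  rewrite [LHS]Rintegral_mkcond [RHS]Rintegral_mkcond.
  apply: eq_Rintegral => x _; rewrite !patchE mem_setE in_itv/=.
  case: (boolP (c < x < d)) => [xcd|/negP xcd].
    rewrite mem_set//; apply: (iI Ic Id).
    by move/andP: xcd => [cx xd]; rewrite !ltW.
  by rewrite bump_out// mulr0; case: ifP.
under eq_cvg do rewrite E.
have mB n : measurable_fun `]c, d[ (fun x => h x * bump c d n x).
  by apply: measurable_funM => //; apply: rtest_measurable => //; exact: rtest_bump.
apply: fine_cvg.
rewrite /Rintegral fineK; last exact: integrable_fin_num.
have [] := @dominated_convergence _ _ R mu `]c, d[ (measurable_itv _)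
  (fun n => EFin \o (fun x => h x * bump c d n x)) (EFin \o h) (EFin \o (fun x => `|h x|)).
- by move=> n; apply/measurable_EFinP; exact: mB.
- by apply/measurable_EFinP; exact: mh.
- apply: aeW => x; rewrite /= in_itv/= => xcd.
  apply: cvg_EFin; first by apply: nearW.
  rewrite -[X in _ --> X]mulr1; apply: cvgM; first exact: cvg_cst.
  by have := @cvg_bump R c d x; rewrite xcd.
- exact: integrable_norm.
- apply: aeW => x n _ /=; rewrite lee_fin normrM ler_piMr//.
  by have /andP[b0 b1] := bump_01 c d n x; rewrite ger0_norm.
by [].
Qed.

Lemma left_integrable_cst (k : R) : (exists a, forall x, I x -> a < x) ->
  left_integrable I (fun=> k).
Proof.
move=> [a aI] b; apply: (@integrableS _ _ _ mu `[a, b]) => //.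
- exact: measurable_trunc.
- by move=> x [/aI ax] /=; rewrite !in_itv/= (ltW ax).
- apply: (@continuous_compact_integrable R); first exact: segment_compact.
  by apply: continuous_subspaceT => x; exact: cvg_cst.
Qed.

Lemma interior_point x : I x -> exists c d, [/\ I c, I d & c < x < d].
Proof.
move=> Ix; have /nbhs_ballP[e /= e0 xe] : nbhs x I by exact: open_nbhs_nbhs.
have e2 : 0 < e / 2 by rewrite divr_gt0.
have ee : e / 2 < e by rewrite ltr_pdivrMr// ltr_pMr// ltr1n.
exists (x - e / 2), (x + e / 2); split.
- by apply: xe; rewrite /ball/= opprB addrC subrK gtr0_norm.
- by apply: xe; rewrite /ball/= opprD addNKr normrN gtr0_norm.
- by rewrite ltrBlDr !ltrDl e2.
Qed.

(** Testing against bumps shows that [h] integrates to 0 over every interval with ends in [I], so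
    its primitive is locally constant on [I]; Lebesgue differentiation then gives [h = 0] almost
    everywhere. *)
Lemma fundamental_lemma h : left_integrable I h ->
  (forall f, rtest f -> \int[mu]_(x in I) (h x * f x) = 0) ->
  {ae mu, forall x, I x -> h x = 0}.
Proof.
move=> hi h0.
have int0 c d : I c -> I d -> \int[mu]_(x in `]c, d[) h x = 0.
  move=> Ic Id; have := cvg_int_bump hi Ic Id.
  rewrite (_ : (fun n => _) = fun=> 0); last first.
    by apply/funext => n; rewrite h0//; exact: rtest_bump.
  by move=> H; apply: (cvg_unique _ H) => //; exact: cvg_cst.
have primC c d : I c -> I d -> c <= d -> prim I h d = prim I h c.
  move=> Ic Id cd; apply/eqP; rewrite -subr_eq0; apply/eqP.
  have hii : mu.-integrable setT (EFin \o (h \_ (trunc I d))) by exact: integrable_trunc.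
  rewrite (primE _ _ (lexx d)) (primE _ _ cd) Rintegral_itvB; last 3 first.
  - exact: integrableS hii.
  - by [].
  - by rewrite bnd_simp.
  rewrite -Rintegral_itv_bndo_bndc; last exact: integrableS hii.
  rewrite -[RHS](int0 c d)//; apply: eq_Rintegral => x.
  rewrite inE/= in_itv/= patchE => /andP[cx xd]; rewrite mem_set//; split => /=.
    by apply: (iI Ic Id); rewrite !ltW.
  by rewrite in_itv/= ltW.
(* [h] is integrable only on truncations of [I], hence a countable exhaustion. *)
have H (n : nat) : {ae mu, forall x, I x -> x < n%:R -> h x = 0}.
  have hii : mu.-integrable setT (EFin \o (h \_ (trunc I n%:R))) by exact: integrable_trunc.
  have L : locally_integrable setT (h \_ (trunc I n%:R)).
    by apply: integrable_locally => //; exact: measurable_trunc.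
  have hiy y : mu.-integrable `]-oo, y] (EFin \o (h \_ (trunc I n%:R))).
    exact: integrableS hii.
  have := FTC1Ny hiy L; cbv zeta.
  apply: ae_mono => x [_ dx] Ix xn.
  have [c [d [Ic Id /andP[cx xd]]]] := interior_point Ix.
  move: dx; rewrite patchE mem_set; last by split=> //=; rewrite in_itv/= ltW.
  move=> <-; rewrite derive1E.
  suff [_ ->] : is_derive x (1:R) (fun x : R => \int[mu]_(t in `]-oo, x]) (h \_ (trunc I n%:R)) t) 0 by [].
  apply: (@near_eq_is_derive _ _ _ (cst (prim I h c))).
  near=> z; rewrite /= -primE; last by apply: ltW; near: z; exact: lt_nbhsl.
  have cz : c < z by near: z; exact: lt_nbhsr.
  have zd : z < d by near: z; exact: lt_nbhsl.
  by rewrite (primC c z) ?ltW//; apply: (iI Ic Id); rewrite !ltW.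
apply: ae_mono (ae_foralln H) => x Hx Ix.
apply: (Hx (Num.truncn x).+1) => //.
exact: truncnS_gt.
Unshelve. all: end_near.
Qed.

Hypothesis nI : I !=set0.
Hypothesis bI : exists a, forall x, I x -> a < x.

Lemma rtestZ f (s : R) : rtest f -> rtest (fun x => s * f x).
Proof.
move=> [sf [c [d [Ic Id f0]]]]; split; first exact: (smoothM (@smooth_cst _ s) sf).
by exists c, d; split => // x /f0 ->; rewrite mulr0.
Qed.

Lemma rtestD f g : rtest f -> rtest g -> rtest (fun x => f x + g x).
Proof.
move=> [sf [c [d [Ic Id f0]]]] [sg [c' [d' [Ic' Id' g0]]]].
split; first exact: smoothD.
exists (Num.min c c'), (Num.max d d'); split.
- by rewrite /Num.min; case: ifP.
- by rewrite /Num.max; case: ifP.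
- move=> x Hx; rewrite f0 ?g0 ?addr0// => /andP[cx xd]; apply: Hx.
    by rewrite ge_min le_max cx xd !orbT.
  by rewrite ge_min le_max cx xd.
Qed.

Lemma rtest_unit : exists2 f, rtest f & \int[mu]_(x in I) f x = 1.
Proof.
have [x Ix] := nI; have [c [d [Ic Id /andP[cx xd]]]] := interior_point Ix.
have := cvg_int_bump (left_integrable_cst 1 bI) Ic Id.
rewrite Rintegral_cst//= lebesgue_measure_itv/= lte_fin (lt_trans cx xd)/= mul1r.
have dc : 0 < d - c by rewrite subr_gt0 (lt_trans cx xd).
(* The integrals of the bumps tend to [d - c > 0], so one of them is positive and can be
   normalised. *)
move=> /(cvgr_gt _) /(_ _ dc) [n _ /(_ n (leqnn n))] /= H.
rewrite (@eq_Rintegral _ _ _ mu I (bump c d n)) in H; last by move=> y _; rewrite mul1r.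
exists (fun x => (\int[mu]_(x in I) bump c d n x)^-1 * bump c d n x).
  by apply: rtestZ; exact: rtest_bump.
rewrite RintegralZl//; first by rewrite mulVf// gt_eqF.
by apply: rtest_integrable => //; exact: rtest_bump.
Qed.

(** The zero mean makes the primitive vanish to the right of the support of [f]. *)
Lemma rtest_primitive f : rtest f -> \int[mu]_(x in I) f x = 0 ->
  exists2 g, rtest g & g^`()%classic = f.
Proof.
move=> tf f0; pose g (x : R) := \int[mu]_(t in `]-oo, x]) f t.
have cf := rtest_continuous tf.
have dg (x : R) : is_derive x (1:R) g (f x).
  have xu : x < x + 1 by rewrite ltrDl.
  have [dg Dg] : derivable g x 1 /\ g^`()%classic x = f x.
    apply: (@continuous_FTC1 _ f -oo%O x _ xu).
    - exact: rtest_integrable.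
    - exact: ltNyr.
    - exact: cf.
  by apply: DeriveDef; [exact: dg|rewrite -derive1E; exact: Dg].
have g' : g^`()%classic = f by exact: is_derive_fun1.
exists g => //; have [sf [c [d [Ic Id fcd]]]] := tf; split.
  apply: (@smooth_coind _ (fun h => smooth h \/ h = g)); last by right.
  move=> h [sh|->]; last by exists f => //; left.
  exists h^`()%classic; first by left; exact: smooth_derive1.
  exact: smooth_is_derive.
exists c, d; split=> // x /negP; rewrite negb_and -!ltNge => /orP[xc|dx].
- transitivity (\int[mu]_(y in `]-oo, x]) (0 : R)); last by rewrite Rintegral_cst ?mul0r.
  apply: eq_Rintegral => y; rewrite inE/= in_itv/= => yx.
  by rewrite fcd// => /andP[cy _]; move: (le_lt_trans yx xc); rewrite ltNge cy.
- rewrite -[RHS]f0 /g [LHS]Rintegral_mkcond [RHS]Rintegral_mkcond.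
  apply: eq_Rintegral => y _; rewrite !patchE mem_setE in_itv/=.
  have [ycd|/negP ycd] := boolP (c <= y <= d); last by rewrite fcd//; case: ifP; case: ifP.
  move/andP: (ycd) => [_ yd]; rewrite (le_trans yd (ltW dx)) mem_set//.
  exact: (iI Ic Id).
Qed.

(** Subtracting a multiple of a test function with integral 1 leaves zero mean, hence a derivative,
    on which [T] vanishes. [T] is an abstract functional because it will combine pairings with
    several derivatives of the test function. *)
Lemma du_bois_reymond (T : (R -> R) -> R) :
  (forall f g s, rtest f -> rtest g -> T (fun x => f x + s * g x) = T f + s * T g) ->
  (forall f, rtest f -> T f^`()%classic = 0) ->
  exists c, forall f, rtest f -> T f = c * \int[mu]_(x in I) f x.
Proof.
move=> TD T0; have [r tr r1] := rtest_unit.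
exists (T r) => f tf; set s := \int[mu]_(x in I) f x.
have tfr : rtest (fun x => f x + - s * r x) by apply: rtestD => //; exact: rtestZ.
have [|g tg Dg] := rtest_primitive tfr.
  rewrite RintegralD//; [|exact: rtest_integrable|exact/rtest_integrable/rtestZ].
  by rewrite RintegralZl//; [rewrite r1 mulr1 subrr|exact: rtest_integrable].
have := T0 _ tg; rewrite Dg TD// mulNr => /eqP; rewrite subr_eq0 => /eqP ->.
by rewrite mulrC.
Qed.

End test_functions.

(** * Local regularity *)

Section square_integrable.
Variables (R : realType) (I : set R).
Hypothesis mI : measurable I.
Notation mu := (@lebesgue_measure R).
Implicit Types (f g h : R -> R).

Definition sqint f :=
  measurable_fun I f /\ mu.-integrable I (EFin \o (fun x => f x ^+ 2)).

Lemma sqintM f g : sqint f -> sqint g ->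
  mu.-integrable I (EFin \o (fun x => f x * g x)).
Proof.
move=> [mf fi] [mg gi].
apply: (@integrable_dom _ _ _ (fun x => f x ^+ 2 + g x ^+ 2)) => //.
- exact: measurable_funM.
- exact: intbleD.
- move=> x _; rewrite normrM [leRHS]ger0_norm ?addr_ge0 ?sqr_ge0//.
  rewrite -(real_normK (num_real (f x))) -(real_normK (num_real (g x))).
  have := normr_ge0 (f x); have := normr_ge0 (g x); nra.
Qed.

Lemma sqintD f g : sqint f -> sqint g -> sqint (fun x => f x + g x).
Proof.
move=> sf sg; have [mf fi] := sf; have [mg gi] := sg.
split; first exact: measurable_funD.
have -> : (fun x => (f x + g x) ^+ 2) =
    (fun x => (f x ^+ 2 + 2 * (f x * g x)) + g x ^+ 2).
  by apply/funext => x; ring.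
by apply: intbleD => //; apply: intbleD => //; apply: intbleZ => //; exact: sqintM.
Qed.

Lemma sqintZ (c : R) f : sqint f -> sqint (fun x => c * f x).
Proof.
move=> [mf fi]; split; first exact: measurable_funM.
by under eq_fun do rewrite exprMn; exact: intbleZ.
Qed.

Lemma sqintN f : sqint f -> sqint (fun x => - f x).
Proof. by move=> /(sqintZ (-1)); under eq_fun do rewrite mulN1r. Qed.

Lemma sqintB f g : sqint f -> sqint g -> sqint (fun x => f x - g x).
Proof. by move=> sf /sqintN; exact: sqintD. Qed.

Lemma ae_eq_intble f g : measurable_fun I g ->
  {ae mu, forall x, I x -> f x = g x} ->
  mu.-integrable I (EFin \o f) -> mu.-integrable I (EFin \o g).
Proof.
move=> mg fg /integrableP[mf fi]; apply/integrableP; split; first exact/measurable_EFinP.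
apply: le_lt_trans fi; rewrite le_eqVlt; apply/orP; left; apply/eqP.
apply: ae_eq_integral => //.
- by apply: measurableT_comp => //; exact/measurable_EFinP.
- exact: measurableT_comp.
- by apply: ae_mono fg => x fg Ix /=; rewrite fg.
Qed.

Lemma ae_sqint f g : measurable_fun I g ->
  {ae mu, forall x, I x -> f x = g x} -> sqint f -> sqint g.
Proof.
move=> mg fg [mf fi]; split => //; apply: ae_eq_intble fi.
  by apply: measurable_funX.
by apply: ae_mono fg => x fg Ix; rewrite fg.
Qed.

Lemma ae_eq_Rintegral (D : set R) f g : measurable D -> measurable_fun D f ->
  measurable_fun D g -> {ae mu, forall x, D x -> f x = g x} ->
  \int[mu]_(x in D) f x = \int[mu]_(x in D) g x.
Proof.
move=> mD mf mg fg; congr fine; apply: ae_eq_integral => //.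
- exact/measurable_EFinP.
- exact/measurable_EFinP.
- by apply: ae_mono fg => x fg Ix /=; rewrite fg.
Qed.

Hypothesis bI : exists a, forall x, I x -> a < x.

Lemma left_integrable_continuous f : continuous f -> left_integrable I f.
Proof.
have [a aI] := bI; move=> cf b; apply: (@integrableS _ _ _ mu `[a, b]) => //.
- exact: measurable_trunc.
- by move=> x [/aI ax] /=; rewrite !in_itv/= (ltW ax).
- apply: (@continuous_compact_integrable R); first exact: segment_compact.
  exact: continuous_subspaceT.
Qed.

(** By [|f| <= 1 + f ^+ 2]; the constant is integrable on truncations because [I] is bounded
    below. *)
Lemma sqint_left_integrable f : sqint f -> left_integrable I f.
Proof.
move=> [mf fi] b.
apply: (@integrable_dom _ _ _ (fun x => 1 + f x ^+ 2)).
- exact: measurable_trunc.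
- by apply: measurable_funS mf => // x [].
- apply: intbleD; first exact: measurable_trunc.
    by apply: left_integrable_continuous => x; exact: cvg_cst.
  by apply: integrableS fi => //; [exact: measurable_trunc|move=> x []].
- move=> x _; rewrite [leRHS]ger0_norm ?addr_ge0 ?sqr_ge0//.
  rewrite -(real_normK (num_real (f x))).
  have := normr_ge0 (f x); nra.
Qed.

Lemma left_integrableD f g : left_integrable I f -> left_integrable I g ->
  left_integrable I (fun x => f x + g x).
Proof. by move=> fi gi b; apply: intbleD => //; exact: measurable_trunc. Qed.

Lemma left_integrableZ (c : R) f : left_integrable I f ->
  left_integrable I (fun x => c * f x).
Proof. by move=> fi b; apply: intbleZ => //; exact: measurable_trunc. Qed.

Lemma left_integrable_prim f : left_integrable I f -> left_integrable I (prim I f).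
Proof. by move=> fi; apply: left_integrable_continuous; exact: continuous_prim. Qed.

Lemma primD f g x : left_integrable I f -> left_integrable I g ->
  prim I (fun x => f x + g x) x = prim I f x + prim I g x.
Proof. by move=> fi gi; rewrite /prim RintegralD//; exact: measurable_trunc. Qed.

Lemma primZ (c : R) f x : left_integrable I f ->
  prim I (fun x => c * f x) x = c * prim I f x.
Proof. by move=> fi; rewrite /prim RintegralZl//; exact: measurable_trunc. Qed.

Lemma ae_prim f g x : left_integrable I f -> left_integrable I g ->
  {ae mu, forall x, I x -> f x = g x} -> prim I f x = prim I g x.
Proof.
move=> fi gi fg; apply: ae_eq_Rintegral.
- exact: measurable_trunc.
- exact: left_integrable_measurable.
- exact: left_integrable_measurable.
- by apply: ae_mono fg => y fg [Iy _]; exact: fg.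
Qed.

End square_integrable.

(** * Weak solutions of the Airy equation on an interval *)

Section local_regularity.
Variables (R : realType) (I : set R) (a : R).
Hypotheses (oI : open I) (iI : is_interval I) (nI : I !=set0).
Hypothesis aI : forall x, I x -> a < x.
Notation mu := (@lebesgue_measure R).
Implicit Types (f g h : R -> R).

Let mI : measurable I := open_measurable oI.
Let bI : exists a, forall x, I x -> a < x := ex_intro _ a aI.

Lemma prim_left h : prim I h a = 0.
Proof.
rewrite /prim (_ : trunc I a = set0) ?Rintegral_set0//.
apply/seteqP; split=> // x [/aI ax]; rewrite /= in_itv/= leNgt.
by rewrite ax.
Qed.

Definition pairing h f : R := \int[mu]_(x in I) (h x * f x).

Lemma pairingDr h f g s : left_integrable I h -> rtest I f -> rtest I g ->
  pairing h (fun x => f x + s * g x) = pairing h f + s * pairing h g.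
Proof.
move=> hi tf tg; rewrite /pairing.
have i1 := integrable_mul_test oI hi tf.
have i2 := integrable_mul_test oI hi tg.
rewrite -RintegralZl// -RintegralD//; last exact: intbleZ.
by apply: eq_Rintegral => x _; ring.
Qed.

Lemma pairingDl h l f s : left_integrable I h -> left_integrable I l -> rtest I f ->
  pairing (fun x => h x + s * l x) f = pairing h f + s * pairing l f.
Proof.
move=> hi li tf; rewrite /pairing.
have i1 := integrable_mul_test oI hi tf.
have i2 := integrable_mul_test oI li tf.
rewrite -RintegralZl// -RintegralD//; last exact: intbleZ.
by apply: eq_Rintegral => x _; ring.
Qed.

Lemma pairing_cst c f : rtest I f -> pairing (fun=> c) f = c * \int[mu]_(x in I) f x.
Proof. by move=> tf; rewrite /pairing RintegralZl//; exact: (rtest_integrable mI tf). Qed.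

Lemma pairing_prim h k f : left_integrable I h -> rtest I f ->
  pairing (fun x => k + prim I h x) f^`()%classic = - pairing h f.
Proof. exact: test_parts. Qed.

Lemma derive1_lin f g (s : R) : rtest I f -> rtest I g ->
  (fun x => f x + s * g x)^`()%classic = (fun x => f^`()%classic x + s * g^`()%classic x).
Proof.
move=> [sf _] [sg _]; apply: is_derive_fun1 => x.
have df := smooth_is_derive sf x; have dg := smooth_is_derive sg x.
apply: is_deriveD; exact: is_deriveZ.
Qed.

Lemma ae_pairing h l f : left_integrable I h -> left_integrable I l -> rtest I f ->
  {ae mu, forall x, I x -> h x = l x} -> pairing h f = pairing l f.
Proof.
move=> hi li tf hl; apply: ae_eq_Rintegral => //.
- exact: intble_measurable (integrable_mul_test oI hi tf).
- exact: intble_measurable (integrable_mul_test oI li tf).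
- by apply: ae_mono hl => x hl Ix; rewrite hl.
Qed.

Lemma pairing_inj h l : left_integrable I h -> left_integrable I l ->
  (forall f, rtest I f -> pairing h f = pairing l f) ->
  {ae mu, forall x, I x -> h x = l x}.
Proof.
move=> hi li hl.
have dI : left_integrable I (fun x => h x + -1 * l x).
  by apply: left_integrableD => //; exact: left_integrableZ.
have := @fundamental_lemma _ _ oI iI _ dI.
move=> H; apply: ae_mono (H _) => [x + Ix|f tf].
  by move=> /(_ Ix) /eqP; rewrite mulN1r subr_eq0 => /eqP.
by have := pairingDl (-1) hi li tf; rewrite hl// mulN1r subrr.
Qed.

(** Each use of the du Bois-Reymond lemma removes one derivative from the test function and yields
    one constant of integration: [c], [c2], [c3]. *)
Lemma local_regularity (al be : R) v z : al != 0 ->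
  left_integrable I v -> left_integrable I z ->
  (forall f, rtest I f ->
     al * pairing v (derive1n 3 f) + be * pairing v f^`()%classic = pairing z f) ->
  exists w : nat -> R -> R,
  [/\ {ae mu, forall x, I x -> v x = w 0%N x},
      forall i, (i < 3)%N -> left_integrable I (w i.+1) /\
        forall x, w i x = w i a + prim I (w i.+1) x &
      forall x, al * w 3 x + be * w 1%N x = - z x].
Proof.
move=> al0 vi zi Hv.
have r1 f : rtest I f -> rtest I f^`()%classic by exact: rtest_derive1.
have d3 f : derive1n 3 f = f^`()%classic^`()%classic^`()%classic by [].
pose Z := prim I z; have Zi : left_integrable I Z by exact: left_integrable_prim.
have lin3 (s a1 a2 a3 b1 b2 b3 : R) : al * (a1 + s * b1) + be * (a2 + s * b2) +
    (a3 + s * b3) = al * a1 + be * a2 + a3 + s * (al * b1 + be * b2 + b3) by ring.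
have lin2 (s a1 a2 b1 b2 : R) : (a1 + s * b1) + (a2 + s * b2) =
    a1 + a2 + s * (b1 + b2) by ring.
have Zp h f : left_integrable I h -> rtest I f ->
    pairing (prim I h) f^`()%classic = - pairing h f.
  move=> hi tf; rewrite -(pairing_prim 0 hi tf); apply: eq_Rintegral => x _.
  by rewrite add0r.
(* Weakly, [al * v'' + be * v + Z = c]: on a derivative the left-hand side vanishes by the equation,
   since [Z] is a primitive of [z]. *)
have [c Hc] : exists c, forall g, rtest I g ->
    al * pairing v g^`()%classic^`()%classic + be * pairing v g + pairing Z g =
    c * \int[mu]_(x in I) g x.
  apply: (@du_bois_reymond _ _ oI iI nI bI (fun g => al * pairing v g^`()%classic^`()%classic
    + be * pairing v g + pairing Z g)).
    move=> f g s tf tg; rewrite !derive1_lin//; try exact: r1.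
    rewrite (pairingDr _ vi (r1 _ (r1 _ tf)) (r1 _ (r1 _ tg))).
    rewrite (pairingDr _ vi tf tg) (pairingDr _ Zi tf tg).
    exact: lin3.
  move=> f tf; have := Hv f tf; rewrite d3 => ->.
  by rewrite Zp// subrr.
(* [h] is the weak second derivative of [v], obtained by solving the previous identity for it. *)
pose h x := (al^-1 * c + - al^-1 * Z x) + (- al^-1 * be) * v x.
have li_cst k : left_integrable I (fun=> k) by exact: left_integrable_cst.
have li1 : left_integrable I (fun x => al^-1 * c + - al^-1 * Z x).
  by apply: left_integrableD => //; exact: left_integrableZ.
have hi : left_integrable I h by apply: left_integrableD => //; exact: left_integrableZ.
have Hh g : rtest I g -> pairing h g = pairing v g^`()%classic^`()%classic.
  move=> tg; rewrite (pairingDl _ li1 vi tg) (pairingDl _ (li_cst _) Zi tg) (pairing_cst _ tg).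
  rewrite -mulrA -(Hc _ tg); move: (pairing v g^`()%classic^`()%classic) => p.
  by field.
have Hi : left_integrable I (prim I h) by exact: left_integrable_prim.
have [c2 Hc2] : exists c2, forall k, rtest I k ->
    pairing v k^`()%classic + pairing (prim I h) k = c2 * \int[mu]_(x in I) k x.
  apply: (@du_bois_reymond _ _ oI iI nI bI (fun k => pairing v k^`()%classic + pairing (prim I h) k)).
    move=> f g s tf tg; rewrite (derive1_lin _ tf tg).
    rewrite (pairingDr _ vi (r1 _ tf) (r1 _ tg)) (pairingDr _ Hi tf tg).
    exact: lin2.
  by move=> f tf; rewrite (Zp _ _ hi tf) (Hh _ tf) subrr.
(* [p] is minus the weak first derivative of [v]. *)
pose p x := c2 + -1 * prim I h x.
have pi : left_integrable I p by apply: left_integrableD => //; exact: left_integrableZ.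
have Hp k : rtest I k -> pairing p k = pairing v k^`()%classic.
  move=> tk; rewrite (pairingDl _ (li_cst _) Hi tk) (pairing_cst _ tk) -(Hc2 _ tk).
  by rewrite mulN1r addrK.
have Pi : left_integrable I (prim I p) by exact: left_integrable_prim.
have [c3 Hc3] : exists c3, forall m, rtest I m ->
    pairing v m + pairing (prim I p) m = c3 * \int[mu]_(x in I) m x.
  apply: (@du_bois_reymond _ _ oI iI nI bI (fun m => pairing v m + pairing (prim I p) m)).
    move=> f g s tf tg.
    rewrite (pairingDr _ vi tf tg) (pairingDr _ Pi tf tg).
    exact: lin2.
  by move=> f tf; rewrite (Zp _ _ pi tf) (Hp _ tf) subrr.
pose w0 x := c3 + -1 * prim I p x.
have w0i : left_integrable I w0 by apply: left_integrableD => //; exact: left_integrableZ.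
have vw0 : {ae mu, forall x, I x -> v x = w0 x}.
  apply: pairing_inj => // m tm.
  rewrite (pairingDl _ (li_cst _) Pi tm) (pairing_cst _ tm) -(Hc3 _ tm).
  by rewrite mulN1r addrK.
pose w1 x := -1 * p x.
have w1i : left_integrable I w1 by exact: left_integrableZ.
(* This is [h] with [v] replaced by its representative [w0], which makes [w2] continuous. *)
pose w2 x := (al^-1 * c + - al^-1 * Z x) + (- al^-1 * be) * w0 x.
have w2i : left_integrable I w2 by apply: left_integrableD => //; exact: left_integrableZ.
(* [w3] is read off the equation, which therefore holds at every point and not just almost
   everywhere. *)
pose w3 x := - al^-1 * z x + (- al^-1 * be) * w1 x.
have w3i : left_integrable I w3.
  by apply: left_integrableD => //; exact: left_integrableZ.
have w01 x : w0 x = w0 a + prim I w1 x.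
  by rewrite /w0 (primZ _ _ _ pi)// prim_left mulr0 addr0.
exists (fun i => match i with 0 => w0 | 1 => w1 | 2 => w2 | _ => w3 end)%N; split => //.
- move=> [|[|[|//]]] _; split => // x.
  + have hw2 : {ae mu, forall x, I x -> h x = w2 x}.
      by apply: ae_mono vw0 => y vw0 Iy; rewrite /h /w2 vw0.
    by rewrite -(ae_prim mI _ hi w2i hw2) /w1 /p prim_left; ring.
  + rewrite primD//; [|exact: left_integrableZ|exact: left_integrableZ].
    have Za : Z a = 0 by exact: prim_left.
    rewrite (primZ mI _ _ zi) (primZ mI _ _ w1i) -/Z /w2 Za (w01 x); ring.
- move=> x; change (al * w3 x + be * w1 x = - z x).
  by rewrite /w3; move: (w1 x) => y; field.
Qed.

End local_regularity.

(** * Jets and the Lagrange identity *)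

Section jets.
Variables (R : realType) (I : set R) (a : R).
Hypotheses (oI : open I) (iI : is_interval I) (nI : I !=set0).
Hypothesis aI : forall x, I x -> a < x.
Notation mu := (@lebesgue_measure R).
Implicit Types (f g h : R -> R) (u v w : nat -> R -> R).

Let mI : measurable I := open_measurable oI.
Let bI : exists a, forall x, I x -> a < x := ex_intro _ a aI.

(* [v 0, ..., v 3] stand for a function and its weak derivatives, [v 0], [v 1] and
   [v 2] being the continuous representatives; [v i] is irrelevant for [3 < i]. *)
Definition prejet v := forall i, (i < 3)%N -> left_integrable I (v i.+1) /\
  forall x, v i x = v i a + prim I (v i.+1) x.

Definition jet v := (forall i, (i <= 3)%N -> sqint I (v i)) /\ prejet v.

Lemma prejet_continuous v i : prejet v -> (i < 3)%N -> continuous (v i).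
Proof.
move=> jv i3; have [vi vp] := jv _ i3.
have -> : v i = (fun x => v i a + prim I (v i.+1) x) by apply/funext => x; exact: vp.
move=> x; apply: cvgD; first exact: cvg_cst.
exact: (continuous_prim mI).
Qed.

Lemma prejet_left_integrable v i : prejet v -> (i <= 3)%N -> left_integrable I (v i).
Proof.
case: i => [|i] jv i3; last by have [] := jv _ i3.
by apply: left_integrable_continuous => //; exact: prejet_continuous.
Qed.

Lemma pairing_prejet v i f : prejet v -> (i < 3)%N -> rtest I f ->
  pairing I (v i) f^`()%classic = - pairing I (v i.+1) f.
Proof.
move=> jv i3 tf; have [vi vp] := jv _ i3.
have -> : v i = (fun x => v i a + prim I (v i.+1) x) by apply/funext => x; exact: vp.
exact: pairing_prim.
Qed.

Lemma pairing_prejetn v n f : prejet v -> (n <= 3)%N -> rtest I f ->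
  pairing I (v 0%N) (derive1n n f) = (-1) ^+ n * pairing I (v n) f.
Proof.
move=> jv; elim: n f => [|n IH] f n3 tf; first by rewrite derive1n0 expr0 mul1r.
rewrite derive1Sn (IH _ (ltnW n3) (rtest_derive1 tf)) (pairing_prejet jv n3 tf).
by rewrite exprS mulN1r mulrN mulNr.
Qed.

Lemma rtest_derive1n n f : rtest I f -> rtest I (derive1n n f).
Proof.
by move=> tf; elim: n => [|m IH]; rewrite ?derive1n0// derive1nS; exact: rtest_derive1.
Qed.

(** Serves to identify a weak derivative, however chosen, with an entry of the jet: both have the
    same pairings with test functions. *)
Lemma wderiv_unique v n f0 g : prejet v -> (n <= 3)%N ->
  left_integrable I f0 -> {ae mu, forall x, I x -> f0 x = v 0%N x} ->
  left_integrable I g ->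
  (forall f, rtest I f -> pairing I f0 (derive1n n f) = (-1) ^+ n * pairing I g f) ->
  {ae mu, forall x, I x -> g x = v n x}.
Proof.
move=> jv n3 f0i f0v gi H; have vi := prejet_left_integrable jv.
apply: (pairing_inj oI iI gi (vi _ n3)) => f tf; have := H f tf.
rewrite (ae_pairing oI f0i (vi _ (leq0n 3)) (rtest_derive1n n tf) f0v).
rewrite (pairing_prejetn jv n3 tf) => /(congr1 (fun y => (-1) ^+ n * y)).
by rewrite !mulrA -exprMn mulrNN mulr1 expr1n !mul1r.
Qed.

Lemma ae_sqint_prejet v i g : prejet v -> (i < 3)%N -> sqint I g ->
  {ae mu, forall x, I x -> g x = v i x} -> sqint I (v i).
Proof.
move=> jv i3 sg gv; apply: (ae_sqint mI _ gv sg).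
apply: measurable_funTS; apply: continuous_measurable_fun.
exact: prejet_continuous.
Qed.

Lemma pairingZl s h f : left_integrable I h -> rtest I f ->
  pairing I (fun x => s * h x) f = s * pairing I h f.
Proof.
move=> hi tf; rewrite /pairing; under eq_Rintegral do rewrite -mulrA.
by rewrite RintegralZl//; exact: integrable_mul_test.
Qed.

(** The relation [v''' = g 3] is the Airy equation with [al = 1], [be = 0] and [z = - g 3].
    [local_regularity] provides the primitives, and uniqueness of weak derivatives makes the
    intermediate entries square integrable. *)
Lemma weak_jet (g : nat -> R -> R) : (forall n, (n <= 3)%N -> sqint I (g n)) ->
  (forall n f, (n <= 3)%N -> rtest I f ->
     pairing I (g 0%N) (derive1n n f) = (-1) ^+ n * pairing I (g n) f) ->
  exists2 v, jet v & {ae mu, forall x, I x -> g 0%N x = v 0%N x}.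
Proof.
move=> gs gw.
have gi n : (n <= 3)%N -> left_integrable I (g n).
  by move=> n3; apply: sqint_left_integrable => //; exact: gs.
have nzi : left_integrable I (fun x => -1 * g 3 x).
  by apply: left_integrableZ => //; exact: gi.
have [|w [gw0 jw w3]] := @local_regularity _ I a oI iI nI aI 1 0 _ _ (oner_neq0 R) (gi 0%N isT) nzi.
  move=> f tf; rewrite (pairingZl _ (gi 3 isT) tf) (gw 3 _ isT tf) mul1r mul0r addr0.
  by rewrite -signr_odd expr1.
have w3E : w 3 = g 3.
  by apply/funext => x; have := w3 x; rewrite mul1r mul0r addr0 mulN1r opprK.
exists w => //; split => // n; rewrite leq_eqVlt => /predU1P[->|n3].
  by rewrite w3E; exact: gs.
apply: (@ae_sqint_prejet w n (g n)) => //; first by apply: gs; exact: ltnW.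
apply: (@wderiv_unique w n (g 0%N)) => //; [exact: ltnW|exact: gi|by apply/gi/ltnW|].
by move=> f tf; apply: gw => //; exact: ltnW.
Qed.

Lemma prejet_parts u v i j b : prejet u -> prejet v -> (i < 3)%N -> (j < 3)%N ->
  \int[mu]_(x in trunc I b) (u i.+1 x * v j x + v j.+1 x * u i x) =
  u i b * v j b - u i a * v j a.
Proof.
move=> ju jv i3 j3; have [ui up] := ju _ i3; have [vi vp] := jv _ j3.
rewrite [u i b]up [v j b]vp -(prim_cst_parts mI)//.
by apply: eq_Rintegral => x _; rewrite [u i x]up [v j x]vp.
Qed.

(* The Lagrange bracket of [al * f''' + be * f']. *)
Definition bracket (al be : R) u v (x : R) : R :=
  al * (u 2 x * v 0%N x - u 1%N x * v 1%N x + u 0%N x * v 2 x) + be * (u 0%N x * v 0%N x).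

Definition airy_pair (al be : R) u v (x : R) : R :=
  (al * u 3 x + be * u 1%N x) * v 0%N x + u 0%N x * (al * v 3 x + be * v 1%N x).

Lemma airy_pair_integrable al be u v : jet u -> jet v ->
  mu.-integrable I (EFin \o airy_pair al be u v).
Proof.
move=> [us _] [vs _].
have sq w : (forall i, (i <= 3)%N -> sqint I (w i)) ->
    sqint I (fun x => al * w 3 x + be * w 1%N x).
  by move=> ws; apply: sqintD => //; apply: sqintZ => //; exact: ws.
by apply: intbleD => //; apply: sqintM => //; [exact: sq|exact: vs|exact: us|exact: sq].
Qed.

Lemma bracket_integrable al be u v : jet u -> jet v ->
  mu.-integrable I (EFin \o bracket al be u v).
Proof.
move=> [us _] [vs _]; have P i j : (i <= 3)%N -> (j <= 3)%N ->
    mu.-integrable I (EFin \o (fun x => u i x * v j x)).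
  by move=> i3 j3; apply: sqintM => //; [exact: us|exact: vs].
apply: intbleD => //; apply: intbleZ; rewrite ?P//.
by apply: intbleD => //; [apply: intbleB => //|]; exact: P.
Qed.

(** [airy_pair] is the derivative of [bracket], since the mixed terms [u 2 * v 1] and [u 1 * v 2]
    cancel; [e i j] is the derivative of [u i * v j]. *)
Lemma bracket_prim al be u v x : jet u -> jet v ->
  prim I (airy_pair al be u v) x = bracket al be u v x - bracket al be u v a.
Proof.
move=> [us ju] [vs jv]; have mt := measurable_trunc mI x.
have P i j : (i <= 3)%N -> (j <= 3)%N ->
    mu.-integrable (trunc I x) (EFin \o (fun x => u i x * v j x)).
  move=> i3 j3; apply: (@integrableS _ _ _ mu I) => //; first by move=> ? [].
  by apply: sqintM => //; [exact: us|exact: vs].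
pose e i j x := u i.+1 x * v j x + v j.+1 x * u i x.
have Pe i j : (i < 3)%N -> (j < 3)%N -> mu.-integrable (trunc I x) (EFin \o e i j).
  move=> i3 j3; rewrite /e; under eq_fun do rewrite (mulrC (v _ _)).
  by apply: intbleD => //; apply: P => //; exact: ltnW.
have lin A B C D : mu.-integrable (trunc I x) (EFin \o A) ->
    mu.-integrable (trunc I x) (EFin \o B) -> mu.-integrable (trunc I x) (EFin \o C) ->
    mu.-integrable (trunc I x) (EFin \o D) ->
    \int[mu]_(y in trunc I x) (al * (A y - B y + C y) + be * D y) =
    al * (\int[mu]_(y in trunc I x) A y - \int[mu]_(y in trunc I x) B y +
      \int[mu]_(y in trunc I x) C y) + be * \int[mu]_(y in trunc I x) D y.
  move=> Ai Bi Ci Di; have ABi := intbleB mt Ai Bi; have ABCi := intbleD mt ABi Ci.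
  rewrite RintegralD//; [|exact: intbleZ|exact: intbleZ].
  by rewrite !RintegralZl// RintegralD// RintegralB.
transitivity (\int[mu]_(y in trunc I x)
   (al * (e 2%N 0%N y - e 1%N 1%N y + e 0%N 2%N y) + be * e 0%N 0%N y)).
  by apply: eq_Rintegral => y _; rewrite /airy_pair /e; ring.
rewrite lin; rewrite ?Pe//.
by rewrite /e !prejet_parts// /bracket; ring.
Qed.

Lemma prim_cvg (q : R -> R) : mu.-integrable I (EFin \o q) ->
  prim I q x @[x --> +oo] --> \int[mu]_(x in I) q x.
Proof.
move=> qi; apply/cvg_pinftyP => s s_oo.
have mq := intble_measurable qi.
rewrite (_ : (fun n => _) = fun n => \int[mu]_(x in I) (q \_ [set` `]-oo, s n]]) x); last first.
  by apply/funext => n; rewrite /prim Rintegral_mkcondr.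
apply: fine_cvg.
rewrite /Rintegral fineK; last exact: integrable_fin_num.
have [] := @dominated_convergence _ _ R mu I mI
  (fun n => EFin \o (q \_ [set` `]-oo, s n]])) (EFin \o q) (EFin \o (fun x => `|q x|)).
- move=> n; apply/measurable_EFinP.
  apply/measurable_restrict => //; apply: measurable_funS mq => //.
- by apply/measurable_EFinP; exact: mq.
- apply: aeW => x Ix; apply: cvg_EFin; first by apply: nearW.
  apply: cvg_near_cst; near=> n.
  rewrite /= patchE mem_setE in_itv/= ifT//; near: n.
  exact: (cvgry_ge s_oo).
- exact: integrable_norm.
- apply: aeW => x n _ /=; rewrite lee_fin patchE; case: ifP => // _.
  by rewrite normr0.
by [].
Unshelve. all: end_near.
Qed.

Lemma integral_bracket_bounded al be u v b : (forall x, I x -> x <= b) ->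
  jet u -> jet v ->
  \int[mu]_(x in I) airy_pair al be u v x =
  bracket al be u v b - bracket al be u v a.
Proof.
move=> Ib ju jv; rewrite -(bracket_prim _ _ _ ju jv) /prim; congr (Rintegral _ _ _).
by apply/seteqP; split => [x Ix|x []//]; split => //; rewrite /= in_itv/= Ib.
Qed.

Lemma integrable_lim0 (q : R -> R) (l : R) : (forall x, a < x -> I x) ->
  mu.-integrable I (EFin \o q) -> q x @[x --> +oo] --> l -> l = 0.
Proof.
move=> Ia qi ql; apply/eqP/negPn/negP => l0.
have l20 : 0 < `|l| / 2 by rewrite divr_gt0 ?normr_gt0.
pose M := \int[mu]_(x in I) `|q x|.
have nqi := integrable_norm qi.
have [X [Xr HX]] : \forall x \near +oo, `|l| / 2 < `|q x|.
  apply: (cvgr_gt `|l|); first exact: cvg_norm.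
  by rewrite ltr_pdivrMr// ltr_pMr ?normr_gt0// ltr1n.
(* The length of []X', Y[] is such that [|l| / 2] integrates over it to [M + 1], one more than the
   integral of [|q|] over all of [I]. *)
pose X' := Num.max X a; pose Y := X' + (M + 1) / (`|l| / 2).
have M0 : 0 <= M by exact: Rintegral_ge0.
have XY : X' < Y by rewrite ltrDl divr_gt0// ltr_wpDl.
have sI : `]X', Y[ `<=` I.
  move=> x; rewrite /= in_itv/= => /andP[]; rewrite gt_max => /andP[_ ax] _.
  exact: Ia.
have qi' : mu.-integrable `]X', Y[ (EFin \o (fun x => `|q x|)).
  by apply: integrableS nqi.
suff : M + 1 <= M by rewrite gerDl ler10.
have <- : \int[mu]_(x in `]X', Y[) (`|l| / 2) = M + 1.
  rewrite Rintegral_cst//= lebesgue_measure_itv/= lte_fin XY/=.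
  by rewrite /Y addrC addKr mulrC divfK// gt_eqF.
apply: (@le_trans _ _ (\int[mu]_(x in `]X', Y[) `|q x|)).
  apply: le_Rintegral => //.
    apply: (@integrable_dom _ _ _ (fun x => `|q x|)) => //.
    move=> x; rewrite /= in_itv/= => /andP[]; rewrite gt_max => /andP[Xx _] _.
    by rewrite normr_id ger0_norm ?ltW//; exact: HX.
  move=> x; rewrite /= in_itv/= => /andP[]; rewrite gt_max => /andP[Xx _] _.
  by rewrite ltW//; exact: HX.
rewrite /M [leLHS]Rintegral_mkcond [leRHS]Rintegral_mkcond; apply: le_Rintegral => //.
- by rewrite -restrict_EFin; apply/integrable_restrict => //; rewrite setTI.
- by rewrite -restrict_EFin; apply/integrable_restrict => //; rewrite setTI.
- move=> x _; rewrite !patchE; case: ifPn => [xXY|_]; last by case: ifP => _; [exact: normr_ge0|exact: lexx].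
  by rewrite mem_set//; apply: sI; move: xXY; rewrite inE.
Qed.

(** The bracket is integrable, and it has a limit at infinity because it is a constant plus a
    primitive of an integrable function. The limit is then 0, so infinity contributes no boundary
    term. *)
Lemma integral_bracket_unbounded al be u v : (forall x, a < x -> I x) ->
  jet u -> jet v ->
  \int[mu]_(x in I) airy_pair al be u v x = - bracket al be u v a.
Proof.
move=> Ia ju jv; have H := prim_cvg (airy_pair_integrable al be ju jv).
set J := \int[mu]_(x in I) _ in H *.
apply/eqP; rewrite -addr_eq0 addrC; apply/eqP.
apply: (integrable_lim0 Ia (bracket_integrable al be ju jv)).
have -> : bracket al be u v = fun x => bracket al be u v a + prim I (airy_pair al be u v) x.
  by apply/funext => x; rewrite bracket_prim// addrC subrK.
rewrite /= (prim_left aI) addr0.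
by apply: cvgD => //; exact: cvg_cst.
Qed.

End jets.

(** * Jets with prescribed boundary values *)

Section jet_existence.
Variables (R : realType).
Notation mu := (@lebesgue_measure R).
Implicit Types (f g h : R -> R).

Lemma derive1_smoothM f g : smooth f -> smooth g ->
  (f \* g)^`()%classic = (f \* g^`()%classic) \+ (g \* f^`()%classic).
Proof.
move=> sf sg; apply: is_derive_fun1 => x.
exact: (is_deriveM (smooth_is_derive sf x) (smooth_is_derive sg x)).
Qed.

Lemma derive1_smoothD f g : smooth f -> smooth g ->
  (f \+ g)^`()%classic = f^`()%classic \+ g^`()%classic.
Proof.
move=> sf sg; apply: is_derive_fun1 => x.
exact: (is_deriveD (smooth_is_derive sf x) (smooth_is_derive sg x)).
Qed.

Lemma smooth_horner (p : {poly R}) : smooth (horner p).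
Proof.
apply: (@smooth_coind R (fun f => exists p, f = horner p)); last by exists p.
move=> f [{}p ->]; exists (horner p^`()); first by exists p^`().
move=> x; exact: is_derive_poly.
Qed.

Lemma derive1_horner (p : {poly R}) : (horner p)^`()%classic = horner p^`().
Proof. by apply: is_derive_fun1 => x; exact: is_derive_poly. Qed.

(** The sign of [s] selects the side of [b], so that one statement covers cutoffs on the left and on
    the right. *)
Lemma derive1n_zero g (s b : R) n x : (forall y, s * (y - b) < 0 -> g y = 0) ->
  s * (x - b) < 0 -> derive1n n g x = 0.
Proof.
move=> g0; elim: n x => [|n IH] x xb; first by rewrite derive1n0; exact: g0.
rewrite derive1nS derive1E; suff [_ ->] : is_derive x (1:R) (derive1n n g) 0 by [].
apply: (near_eq_is_derive (f := cst 0)); near=> z; rewrite IH//; near: z.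
have c : continuous (fun z : R => s * (z - b)).
  by move=> z; apply: cvgM; [exact: cvg_cst|apply: cvgB; [exact: cvg_id|exact: cvg_cst]].
exact: (cvgr_lt (s * (x - b)) (c x)).
Unshelve. all: end_near.
Qed.

(* A quadratic polynomial times a smooth cutoff which is positive at [p]. *)
Lemma smooth_germ (p s b c0 c1 c2 : R) : 0 < s * (p - b) ->
  exists g, [/\ smooth g, [/\ g p = c0, derive1n 1 g p = c1 & derive1n 2 g p = c2] &
    forall n x, s * (x - b) < 0 -> derive1n n g x = 0].
Proof.
move=> pb; have s0 : s != 0 by apply: contraTneq pb => ->; rewrite mul0r ltxx.
pose f := flat 1 s b; have sf : smooth f by exact: smooth_flat.
have f0 : f p != 0 by rewrite /f /flat pb hornerC mul1r gt_eqF// expR_gt0.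
have [y0 Ey0] : exists y, f p = y by eexists.
have [y1 Ey1] : exists y, f^`()%classic p = y by eexists.
have [y2 Ey2] : exists y, f^`()%classic^`()%classic p = y by eexists.
rewrite Ey0 in f0.
(* [A], [B], [C] solve the triangular system that the Leibniz rule gives for the value and the first
   two derivatives of [q * f] at [p]; its diagonal entries are multiples of [y0], which is
   non-zero. *)
pose A := c0 / y0; pose B := (c1 - A * y1) / y0.
pose C := (c2 - 2 * B * y1 - A * y2) / (2 * y0).
have [X dX X0] : exists2 X : {poly R}, X^`() = 1 & X.[p] = 0.
  by exists ('X - p%:P); [rewrite derivXsubC|rewrite !hornerE subrr].
pose q : {poly R} := A%:P + X * (B%:P + X * C%:P).
have dq : q^`() = B%:P + X * C%:P + X * C%:P.
  by rewrite /q derivD derivC add0r derivM dX mul1r derivD derivC add0r derivM dX derivC mulr0 addr0 mul1r.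
have ddq : q^`()^`() = C%:P + C%:P.
  by rewrite dq !derivD derivM dX !derivC mulr0 addr0 mul1r add0r.
have q0 : q.[p] = A by rewrite /q !(hornerD, hornerM, hornerC) X0; ring.
have q1 : q^`().[p] = B.
  by rewrite dq !(hornerD, hornerM, hornerC) X0; ring.
have q2 : q^`()^`().[p] = 2 * C.
  by rewrite ddq !(hornerD, hornerC); ring.
have sq := smooth_horner.
have sf' := smooth_derive1 sf.
have E1 : (horner q \* f)^`()%classic = (horner q \* f^`()%classic) \+ (f \* horner q^`()).
  by rewrite (derive1_smoothM (sq q) sf) derive1_horner.
have E2 : ((horner q \* f^`()%classic) \+ (f \* horner q^`()))^`()%classic =
    ((horner q \* f^`()%classic^`()%classic) \+ (f^`()%classic \* horner q^`())) \+
    ((f \* horner q^`()^`()) \+ (horner q^`() \* f^`()%classic)).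
  rewrite (derive1_smoothD (smoothM (sq q) sf') (smoothM sf (sq q^`()))).
  rewrite (derive1_smoothM (sq q) sf') (derive1_smoothM sf (sq q^`())).
  by rewrite !derive1_horner.
exists (horner q \* f); split.
- exact: (smoothM (sq q) sf).
- rewrite derive1n1 (derive1nS _ 1) derive1n1 E1 E2 /= q0 q1 q2 Ey0 Ey1 Ey2 /C /B /A.
  by split; field.
- move=> n x xb; apply: derive1n_zero xb => y yb /=.
  by rewrite /f /flat ltNge (ltW yb) mulr0.
Qed.

Section smooth_jets.
Variables (I : set R) (a : R).
Hypotheses (oI : open I) (aI : forall x, I x -> a < x).
Hypothesis Ia : forall x y, I x -> a < y <= x -> I y.

Let mI : measurable I := open_measurable oI.
Let bI : exists a, forall x, I x -> a < x := ex_intro _ a aI.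

Lemma sqint_bounded_support h (b : R) : continuous h ->
  (forall x, I x -> b < x -> h x = 0) -> sqint I h.
Proof.
move=> ch h0; split.
  by apply: measurable_funTS; exact: continuous_measurable_fun.
apply: (@eq_intble _ _ mI ((fun x => h x ^+ 2) \_ [set` `]-oo, b]])).
  move=> x; rewrite inE patchE mem_setE in_itv/= => Ix.
  by case: leP => // /(h0 _ Ix) ->; rewrite expr0n.
rewrite -restrict_EFin; apply/integrable_restrict => //.
apply: (left_integrable_continuous mI bI _ b).
by move=> x; apply: cvgM; exact: ch.
Qed.

Lemma prim_smooth g x : smooth g -> I x ->
  prim I g^`()%classic x = g x - g a.
Proof.
move=> sg Ix; have ax := aI Ix.
have cg := smooth_continuous sg; have cg' := smooth_continuous (smooth_derive1 sg).
have gi : mu.-integrable `[a, x] (EFin \o g^`()%classic).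
  apply: (@continuous_compact_integrable R); first exact: segment_compact.
  exact: continuous_subspaceT.
have -> : prim I g^`()%classic x = \int[mu]_(t in `]a, x]) g^`()%classic t.
  congr (Rintegral _ _ _); apply/seteqP; split => y /=; rewrite !in_itv/=.
    by move=> [/aI -> /=]; rewrite in_itv.
  by move=> yx; split; [exact: Ia yx|move/andP: yx => [_]; rewrite /= in_itv].
rewrite Rintegral_itv_obnd_cbnd; last first.
  by apply: integrableS gi => // y; rewrite /= !in_itv/= => /andP[/ltW -> ->].
rewrite /Rintegral (@continuous_FTC2 _ _ g)//; first exact: continuous_subspaceT.
split => [y _||]; first by have := sg 0%N y; rewrite derive1n0.
  by apply: cvg_at_right_filter; exact: cg.
by apply: cvg_at_left_filter; exact: cg.
Qed.

Lemma smooth_jet g : smooth g -> (forall n, sqint I (derive1n n g)) ->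
  exists v, [/\ jet I a v, forall i, (i < 3)%N -> v i a = derive1n i g a &
    forall i x, (i < 3)%N -> I x -> v i x = derive1n i g x].
Proof.
move=> sg gs.
have gi n : left_integrable I (derive1n n g) by apply: sqint_left_integrable => //; exact: gs.
(* The first three entries cannot be the derivatives of [g] as they stand: the jet identity is
   required on the whole line, and [prim I] is constant to the right of [I]. Agreement is kept on
   [I] and at [a]. *)
pose v i x := if (i < 3)%N then derive1n i g a + prim I (derive1n i.+1 g) x
  else derive1n i g x.
have vI i x : (i <= 3)%N -> I x -> v i x = derive1n i g x.
  move=> _ Ix; rewrite /v; case: ifP => // i3.
  by rewrite derive1nS (prim_smooth (@smooth_derive1n _ i _ sg) Ix) addrC subrK.
have va i : (i < 3)%N -> v i a = derive1n i g a.
  by move=> i3; rewrite /v i3 (prim_left aI) addr0.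
have pv i x : (i <= 3)%N -> prim I (v i) x = prim I (derive1n i g) x.
  by move=> i3; apply: eq_Rintegral => y; rewrite inE => -[Iy _]; exact: vI.
have mv i : (i <= 3)%N -> measurable_fun I (v i).
  move=> i3; have [+ _] := gs i; apply: eq_measurable_fun => x; rewrite inE => Ix.
  by rewrite vI.
exists v; split => //; last by move=> i x i3; apply: vI; exact: ltnW.
split => i i3.
  apply: (ae_sqint mI (mv _ i3) _ (gs i)).
  by apply: aeW => x Ix; rewrite vI.
split.
  move=> b; apply: eq_intble (gi i.+1 b); first exact: measurable_trunc.
  by move=> x; rewrite inE => -[Ix _]; rewrite vI.
by move=> x; rewrite pv// va// /v i3.
Qed.

End smooth_jets.

Lemma jet_exists_unbounded (I : set R) (a c0 c1 c2 : R) : open I ->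
  (forall x, I x <-> a < x) ->
  exists v, [/\ jet I a v, v 0%N a = c0, v 1%N a = c1 & v 2 a = c2].
Proof.
move=> oI Ia; have aI x : I x -> a < x by move/Ia.
(* With [s = -1] and [b = a + 1] the cutoff is positive at [a] and vanishes beyond [a + 1], which
   gives square integrability on the half-line. *)
have ab : 0 < -1 * (a - (a + 1)) by rewrite opprD addNKr mulrNN mulr1.
have [g [sg [g0 g1 g2] gb]] := smooth_germ c0 c1 c2 ab.
have [||v [jv va _]] := @smooth_jet I a oI aI _ g sg.
- move=> x y Ix /andP[ay _]; exact/Ia.
- move=> n; apply: (sqint_bounded_support oI aI (b := a + 1)).
    by apply: smooth_continuous; exact: smooth_derive1n.
  by move=> x Ix xb; apply: gb; rewrite mulN1r oppr_lt0 subr_gt0.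
by exists v; split; rewrite ?va.
Qed.

Lemma jet_exists_bounded (a b : R) (c d : 'I_3 -> R) : a < b ->
  exists v, jet `]a, b[%classic a v /\
    forall i : 'I_3, v i a = c i /\ v i b = d i.
Proof.
move=> ab; set I := `]a, b[%classic.
have oI : open I by exact: interval_open.
have aI x : I x -> a < x by rewrite /I /= in_itv/= => /andP[].
have Ia x y : I x -> a < y <= x -> I y.
  by rewrite /I /= !in_itv/= => /andP[_ xb] /andP[-> /le_lt_trans]; apply.
(* The germs at [a] and at [b] are cut off at the midpoint, so that neither disturbs the data of the
   other. *)
pose m := (a + b) / 2.
have am : a < m by rewrite midf_lt.
have mb : m < b by rewrite midf_lt.
have [g [sg [g0 g1 g2] gm]] : exists g, [/\ smooth g, [/\ g a = c (@Ordinal 3 0 isT),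
    derive1n 1 g a = c (@Ordinal 3 1 isT) & derive1n 2 g a = c (@Ordinal 3 2 isT)] &
    forall n x, -1 * (x - m) < 0 -> derive1n n g x = 0].
  by apply: smooth_germ; rewrite mulN1r oppr_gt0 subr_lt0.
have [h [sh [h0 h1 h2] hm]] : exists g, [/\ smooth g, [/\ g b = d (@Ordinal 3 0 isT),
    derive1n 1 g b = d (@Ordinal 3 1 isT) & derive1n 2 g b = d (@Ordinal 3 2 isT)] &
    forall n x, 1 * (x - m) < 0 -> derive1n n g x = 0].
  by apply: smooth_germ; rewrite mul1r subr_gt0.
have sgh : smooth (g \+ h) by exact: smoothD.
have dD n : derive1n n (g \+ h) = derive1n n g \+ derive1n n h.
  elim: n => [|n IH]; first by rewrite !derive1n0.
  by rewrite !derive1nS IH (derive1_smoothD (@smooth_derive1n _ n _ sg) (@smooth_derive1n _ n _ sh)).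
have [n|v [jv va vI]] := @smooth_jet I a oI aI Ia _ sgh.
  apply: (sqint_bounded_support oI aI (b := b)).
    by apply: smooth_continuous; exact: smooth_derive1n.
  by move=> x; rewrite /I/= in_itv/= => /andP[_ xb]; rewrite ltNge (ltW xb).
exists v; split => // i.
have i3 : (i < 3)%N := ltn_ord i.
have cv : continuous (v i) := @prejet_continuous _ I a oI v i (proj2 jv) i3.
(* The jet agrees with the derivatives only inside [I]; at the right end the equality is a limit
   from the left. *)
have vb : v i b = derive1n i (g \+ h) b.
  have cG : continuous (derive1n i (g \+ h)).
    by apply: smooth_continuous; exact: smooth_derive1n.
  apply: (@cvg_unique _ (@norm_hausdorff _ _) (v i @ b^'-)).
    by apply: cvg_at_left_filter; exact: cv.
  apply: cvg_trans (cvg_at_left_filter (cG b)).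
  apply: near_eq_cvg; near=> x; apply/esym; apply: vI => //.
  by rewrite /I/= in_itv/=; apply/andP; split; near: x; [exact: nbhs_left_gt|exact: nbhs_left_lt].
have gb0 : derive1n i g b = 0 by apply: gm; rewrite mulN1r oppr_lt0 subr_gt0.
have ha0 : derive1n i h a = 0 by apply: hm; rewrite mul1r subr_lt0.
rewrite vb va// !dD/= gb0 ha0.
rewrite add0r addr0; case: i {cv vb i3 gb0 ha0} => -[|[|[|//]]] Hi.
- by rewrite !derive1n0 g0 h0; split; congr (_ _); exact: val_inj.
- by rewrite g1 h1; split; congr (_ _); exact: val_inj.
- by rewrite g2 h2; split; congr (_ _); exact: val_inj.
Unshelve. all: end_near.
Qed.

End jet_existence.

(** * Square integrability of the derivatives on a half-line *)

Section taylor_bound.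
Variable R : realFieldType.

Lemma sqr_sum5 (a b c d e : R) :
  (a + b + c + d + e) ^+ 2 <= 5 * (a ^+ 2 + b ^+ 2 + c ^+ 2 + d ^+ 2 + e ^+ 2).
Proof.
rewrite -subr_ge0.
have -> : 5 * (a ^+ 2 + b ^+ 2 + c ^+ 2 + d ^+ 2 + e ^+ 2) - (a + b + c + d + e) ^+ 2 =
  (a - b) ^+ 2 + (a - c) ^+ 2 + (a - d) ^+ 2 + (a - e) ^+ 2 + (b - c) ^+ 2 +
  (b - d) ^+ 2 + (b - e) ^+ 2 + (c - d) ^+ 2 + (c - e) ^+ 2 + (d - e) ^+ 2 by ring.
by rewrite !addr_ge0// sqr_ge0.
Qed.

(* The first two Taylor coefficients [w], [g] at a point are recovered from the
   values [p0], [p1], [p2] at three equidistant points up to the remainders. *)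
Lemma taylor_bound (p0 p1 p2 w g k n m : R) : 0 <= m -> n ^+ 2 <= 4 * m ->
  `|p1 - p0 - w - 2^-1 * g| <= 2 * (k * n) ->
  `|p2 - p0 - 2 * w - 2 * g| <= 2 * (k * n) ->
  let C := (20 + 400 * k ^+ 2) * (p0 ^+ 2 + p1 ^+ 2 + p2 ^+ 2 + m) in
  w ^+ 2 <= C /\ g ^+ 2 <= C.
Proof.
move=> m0 nm h1 h2 C.
set d1 := p1 - p0 - w - 2^-1 * g in h1; set d2 := p2 - p0 - 2 * w - 2 * g in h2.
have sq d : `|d| <= 2 * (k * n) -> d ^+ 2 <= 16 * k ^+ 2 * m.
  move=> hd; rewrite -(real_normK (num_real d)).
  apply: (@le_trans _ _ ((2 * (k * n)) ^+ 2)).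
    by rewrite ler_sqr ?nnegrE// (le_trans _ hd).
  have := ler_wpM2l (sqr_ge0 k) nm; rewrite !exprMn; lra.
have q1 := sq _ h1; have q2 := sq _ h2.
have km : 0 <= k ^+ 2 * m by rewrite mulr_ge0 ?sqr_ge0.
have kp p : 0 <= k ^+ 2 * p ^+ 2 by rewrite mulr_ge0 ?sqr_ge0.
have kp0 := kp p0; have kp1 := kp p1; have kp2 := kp p2.
have s0 := sqr_ge0 p0; have s1 := sqr_ge0 p1; have s2 := sqr_ge0 p2.
(* [4 * d1 - d2] is free of [g] and [d2 - 2 * d1] is free of [w]. In the estimate of [g ^+ 2], 20 is
   [5 * 2 ^+ 2] and 400 is [5 * (1 + 2 ^+ 2) * 16]; the constants for [w ^+ 2] are no larger. *)
have := sqr_sum5 (4 * p1) (- p2) (- (3 * p0)) (- (4 * d1)) d2.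
have -> : 4 * p1 + - p2 + - (3 * p0) + - (4 * d1) + d2 = 2 * w by rewrite /d1 /d2; field.
have := sqr_sum5 p2 (- (2 * p1)) p0 (- d2) (2 * d1).
have -> : p2 + - (2 * p1) + p0 + - d2 + 2 * d1 = g by rewrite /d1 /d2; field.
rewrite /C; split; lra.
Qed.

End taylor_bound.

(** * The Airy equation on a half-line *)

Section half_line.
Variables (R : realType) (I : set R) (a : R).
Hypothesis Ia : forall x, I x <-> a < x.
Notation mu := (@lebesgue_measure R).
Implicit Types (f g h : R -> R).

Let I_itv : I = `]a, +oo[%classic.
Proof. by apply/seteqP; split => x; rewrite /= in_itv/= andbT => /Ia. Qed.

Let oI : open I.
Proof. by rewrite I_itv; exact: interval_open. Qed.

Let mI : measurable I := open_measurable oI.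

Let aI x : I x -> a < x. Proof. by move/Ia. Qed.

Let bI : exists a, forall x, I x -> a < x := ex_intro _ a aI.

Lemma trunc_half_line y : trunc I y = `]a, y]%classic.
Proof.
apply/seteqP; split => x; rewrite /= !in_itv/=.
  by move=> [/Ia -> /=]; rewrite in_itv.
by move=> /andP[ax xy]; split; [exact/Ia|rewrite /= in_itv].
Qed.

Lemma integrable_itv_half_line h x y : left_integrable I h -> a <= x ->
  mu.-integrable `]x, y] (EFin \o h).
Proof.
move=> hi ax; have := hi y; rewrite trunc_half_line; apply: integrableS => //.
by move=> t; rewrite /= !in_itv/= => /andP[/(le_lt_trans ax) -> ->].
Qed.

Lemma prim_sub h x y : left_integrable I h -> a <= x <= y ->
  prim I h y - prim I h x = \int[mu]_(t in `]x, y]) h t.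
Proof.
move=> hi /andP[ax xy]; rewrite /prim !trunc_half_line.
rewrite (@Rintegral_itvB _ h (BRight a) (BRight y)) ?bnd_simp//.
exact: integrable_itv_half_line.
Qed.

Lemma integral_identity (x y : R) : x <= y ->
  \int[mu]_(t in `]x, y]) (t - x) = (y - x) ^+ 2 / 2.
Proof.
rewrite le_eqVlt => /predU1P[<-|xy].
  by rewrite set_itvoc0 Rintegral_set0 subrr expr0n mul0r.
pose p : {poly R} := (2^-1 : R) *: ('X - x%:P) ^+ 2.
have dp : p^`() = 'X - x%:P.
  rewrite /p derivZ expr2 derivM derivXsubC mul1r mulr1 -mulr2n -scalerMnr scalerMnl.
  by rewrite -mulr_natr mulVf ?scale1r// pnatr_eq0.
have H := @prim_smooth R `]x, +oo[%classic x _ _ (horner p) y (@smooth_horner _ p).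
have -> : \int[mu]_(t in `]x, y]) (t - x) = prim `]x, +oo[%classic (horner p)^`()%classic y.
  rewrite derive1_horner /prim (_ : trunc _ y = `]x, y]%classic).
    by apply: eq_Rintegral => t _; rewrite dp !hornerE.
  apply/seteqP; split => t; rewrite /trunc /= !in_itv/= andbT; first by move=> [-> ->].
  by move=> /andP[].
rewrite H.
- by rewrite /p !hornerE/= subrr; field.
- by move=> t; rewrite /= in_itv/= andbT.
- by move=> s t _ /andP[xt _]; rewrite /= in_itv/= andbT.
- by rewrite /= in_itv/= andbT.
Qed.

Lemma integrable_itv_continuous f x y : continuous f ->
  mu.-integrable `]x, y] (EFin \o f).
Proof.
move=> cf; apply: (@integrableS _ _ _ mu `[x, y]) => //.
  by move=> t; rewrite /= !in_itv/= => /andP[/ltW -> ->].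
apply: (@continuous_compact_integrable R); first exact: segment_compact.
exact: continuous_subspaceT.
Qed.

Lemma integral_itv_cst (x y E : R) : x <= y ->
  \int[mu]_(t in `]x, y]) E = (y - x) * E.
Proof.
rewrite le_eqVlt => /predU1P[<-|xy].
  by rewrite set_itvoc0 Rintegral_set0 subrr mul0r.
by rewrite Rintegral_cst//= lebesgue_measure_itv/= lte_fin xy/= mulrC.
Qed.

Lemma integral_near h x y (E : R) (p : R -> R) : x <= y ->
  mu.-integrable `]x, y] (EFin \o h) -> mu.-integrable `]x, y] (EFin \o p) ->
  (forall t, x < t <= y -> `|h t - p t| <= E) ->
  `|\int[mu]_(t in `]x, y]) h t - \int[mu]_(t in `]x, y]) p t| <= (y - x) * E.
Proof.
move=> xy hi pi hp.
have di := intbleB (measurable_itv `]x, y]) hi pi.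
rewrite -RintegralB// -integral_itv_cst//.
apply: le_trans; first exact: (le_normr_Rintegral _ di).
apply: le_Rintegral => //.
- exact: integrable_norm di.
- by apply: integrable_itv_continuous => z; exact: cvg_cst.
Qed.

Lemma integrable_shift g (s : R) : continuous g -> 0 < s -> (forall x, 0 <= g x) ->
  mu.-integrable I (EFin \o g) -> mu.-integrable I (EFin \o (fun x => g (x + s))).
Proof.
move=> cg s0 g0 /integrableP[_ gi].
pose F (x : R) := x + s.
have dF (x : R) : is_derive x (1:R) F 1.
  by apply: is_derive_eq; rewrite addr0.
have F' : F^`()%classic = cst 1 by exact: is_derive_fun1.
have cF : continuous F.
  by move=> x; apply: cvgD; [exact: cvg_id|exact: cvg_cst].
have cgF : continuous (g \o F).
  by move=> x; apply: (@continuous_comp _ _ _ F g); [exact: cF|exact: cg].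
have H : (\int[mu]_(x in `[(a + s)%R, +oo[) (g x)%:E =
    \int[mu]_(x in `[a, +oo[) (((g \o F) * F^`()%classic) x)%:E)%E.
  apply: (@increasing_ge0_integration_by_substitutiony R F g a).
  - by move=> x y _ _ xy; rewrite ltrD2r.
  - by rewrite F' => x _; exact: cvg_cst.
  - by rewrite F'; apply: is_cvg_cst.
  - by rewrite F'; apply: is_cvg_cst.
  - split; first by move=> x _; case: (dF x).
    by apply: cvg_at_right_filter; exact: cF.
  - exact: cvg_addrr.
  - exact: continuous_subspaceT.
  - by move=> x _; exact: g0.
apply/integrableP; split.
  apply/measurable_EFinP; apply: measurable_funTS.
  exact: (continuous_measurable_fun cgF).
apply: le_lt_trans gi.
apply: (@le_trans _ _ (\int[mu]_(x in `[a, +oo[) (g (x + s))%:E)%E).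
  under eq_integral do rewrite gee0_abs ?lee_fin//.
  apply: ge0_subset_integral => //.
  - apply/measurable_EFinP; apply: measurable_funTS.
    exact: (continuous_measurable_fun cgF).
  - by move=> x _; rewrite lee_fin.
  - by move=> x /Ia /ltW ax; rewrite /= in_itv/= ax.
rewrite [leLHS](_ : _ = \int[mu]_(x in `[(a + s)%R, +oo[) (g x)%:E)%E; last first.
  by rewrite H; apply: eq_integral => x _; rewrite F' /= fctE mulr1.
under [leRHS]eq_integral do rewrite gee0_abs ?lee_fin//.
apply: ge0_subset_integral => //.
- apply/measurable_EFinP; apply: measurable_funTS.
  exact: (continuous_measurable_fun cg).
- by move=> x _; rewrite lee_fin.
- move=> x; rewrite /= in_itv/= andbT => ax; apply/Ia; apply: lt_le_trans ax.
  by rewrite ltrDl.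
Qed.

(** By Tonelli: each [t] lies in the windows []x, x + 2]] of the [x] in [[t - 2, t[], so the
    integral at most doubles. *)
Lemma integrable_window g : (forall x, 0 <= g x) -> mu.-integrable I (EFin \o g) ->
  mu.-integrable I (EFin \o (fun x => \int[mu]_(t in `]x, x + 2]) g t)).
Proof.
move=> g0 gi.
pose gI := g \_ I.
have gIi : mu.-integrable setT (EFin \o gI).
  by rewrite -restrict_EFin; apply/integrable_restrict => //; rewrite setTI.
have gI0 x : 0 <= gI x by rewrite /gI patchE; case: ifP.
have mgI : measurable_fun setT gI := intble_measurable gIi.
pose kk := fun z : measurableTypeR R * measurableTypeR R =>
  ((z.1 : R) < z.2)%R%:R * ((z.2 : R) <= z.1 + 2)%R%:R : R.
have kkE x y : kk (x, y) = \1_(`]x, x + 2]%classic) y.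
  by rewrite /kk indicE mem_setE in_itv/= -natrM mulnb.
have kkE' x y : kk (x, y) = \1_(`[y - 2, y[%classic) x.
  by rewrite /kk indicE mem_setE in_itv/= -natrM mulnb andbC lerBlDr.
have mkk : measurable_fun setT kk.
  apply: measurable_funM.
    apply: (measurableT_comp (f := fun b : bool => b%:R : R)) => //.
    by apply: measurable_fun_ltr; [exact: measurable_fst|exact: measurable_snd].
  apply: measurable_ler_nat; first exact: measurable_snd.
  by apply: measurable_funD => //; exact: measurable_fst.
have kk0 z : 0 <= kk z by rewrite mulr_ge0.
pose h (z : measurableTypeR R * measurableTypeR R) := (gI z.2 * kk z)%:E.
have mh : measurable_fun setT h.
  apply/measurable_EFinP; apply: measurable_funM => //.
  exact: (measurableT_comp mgI measurable_snd).
have h0 z : (0 <= h z)%E by rewrite lee_fin mulr_ge0.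
have inner x : (\int[mu]_y h (x, y) = (\int[mu]_(t in `]x, (x + 2)%R]) gI t)%:E)%E.
  rewrite /Rintegral fineK; last first.
    apply: integrable_fin_num => //; exact: integrableS gIi.
  rewrite [RHS]integral_mkcond; apply: eq_integral => y _.
  rewrite restrict_EFin /h /= patchE kkE indicE.
  by case: (_ \in _); rewrite ?mulr1 ?mulr0.
have outer y : (\int[mu]_x h (x, y) = (gI y)%:E * 2%:E)%E.
  transitivity (\int[mu]_x ((gI y)%:E * (\1_(`[(y - 2)%R, y[%classic) x)%:E))%E.
    by apply: eq_integral => x _; rewrite /h /= kkE' EFinM.
  rewrite ge0_integralZl//; last 2 first.
  - by apply/measurable_EFinP; exact: measurable_indic.
  - by rewrite lee_fin.
  rewrite integral_indic// setIT/= lebesgue_measure_itv/= lte_fin ltrBlDr ltrDl ltr0n/=.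
  by rewrite -EFinB opprB addrC subrK.
have F0 x : (0 <= \int[mu]_y h (x, y))%E by apply: integral_ge0 => y _; exact: h0.
have total : (\int[mu]_x \int[mu]_y h (x, y) < +oo)%E.
  rewrite (fubini_tonelli h mh h0).
  have -> : (\int[mu]_y \int[mu]_x h (x, y) = 2%:E * \int[mu]_y (gI y)%:E)%E.
    rewrite -ge0_integralZl//; last 2 first.
    - by apply/measurable_EFinP; exact: mgI.
    - by move=> y _; rewrite lee_fin; exact: gI0.
    by apply: eq_integral => y _; rewrite outer muleC.
  apply: lte_mul_pinfty => //.
  by apply: integrable_lty => //; exact: gIi.
have I1 : mu.-integrable setT (fun x => \int[mu]_y h (x, y))%E.
  apply/integrableP; split.
    by apply: (@measurable_fun_fubini_tonelli_F _ _ _ _ R mu h mh).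
  have -> : (\int[mu]_x `| \int[mu]_y h (x, y) | = \int[mu]_x \int[mu]_y h (x, y))%E.
    by apply: eq_integral => x _; apply: gee0_abs; exact: F0.
  exact: total.
apply: (@eq_intble _ _ mI (fun x => \int[mu]_(t in `]x, x + 2]) gI t)).
  move=> x; rewrite inE => Ix; apply: eq_Rintegral => t.
  rewrite inE /= in_itv/= => /andP[xt _].
  by rewrite /gI patchE mem_set//; apply/Ia; apply: lt_trans xt; exact/Ia.
apply: (@integrableS _ _ _ mu setT) => //.
by apply: (eq_integrable _ _ _ _ I1) => // x _; rewrite inner.
Qed.

Variables (al be : R) (w : nat -> R -> R) (z : R -> R).
Hypotheses (al0 : al != 0) (jw : prejet I a w) (zs : sqint I z) (w0s : sqint I (w 0%N)).
Hypothesis w3z : forall x, al * w 3 x + be * w 1%N x = - z x.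

Let zi : left_integrable I z := sqint_left_integrable mI bI zs.

Let wi i : (i <= 3)%N -> left_integrable I (w i).
Proof. exact: (prejet_left_integrable oI aI jw). Qed.

Lemma prejet_sub i x y : (i < 3)%N -> a <= x <= y ->
  w i y - w i x = \int[mu]_(t in `]x, y]) w i.+1 t.
Proof.
move=> i3 axy; have [wi' wp] := jw i3.
by rewrite -(prim_sub wi' axy) (wp y) (wp x) opprD addrACA subrr add0r.
Qed.

(** By the equation the derivative of [G] is [- al^-1 * z], so its increments involve neither [w 1]
    nor [w 3], whose square integrability is not known yet. *)
Let G x := w 2 x + al^-1 * be * w 0%N x.

(** The window []x, x + 2]] contains the points [x + 1] and [x + 2] at which the Taylor expansions
    at [x] are evaluated. *)
Let n x := \int[mu]_(t in `]x, x + 2]) (`|w 0%N t| + `|z t|).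

Let k t := w 0%N t ^+ 2 + z t ^+ 2.

Let m x := \int[mu]_(t in `]x, x + 2]) k t.

Let abs_int x y : a <= x ->
  mu.-integrable `]x, y] (EFin \o (fun t => `|w 0%N t| + `|z t|)).
Proof.
move=> ax; apply: intbleD => //.
  exact: integrable_norm (integrable_itv_half_line y (wi (leq0n 3)) ax).
exact: integrable_norm (integrable_itv_half_line y zi ax).
Qed.

Let n_ge0 x : 0 <= n x.
Proof. by apply: Rintegral_ge0 => t _; rewrite addr_ge0. Qed.

Let le_n x y h : a <= x -> x <= y <= x + 2 -> mu.-integrable `]x, y] (EFin \o h) ->
  (forall t, x < t <= y -> `|h t| <= `|w 0%N t| + `|z t|) ->
  `|\int[mu]_(t in `]x, y]) h t| <= n x.
Proof.
move=> ax /andP[xy yx] hi hle.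
apply: le_trans; first exact: (le_normr_Rintegral _ hi).
apply: (@le_trans _ _ (\int[mu]_(t in `]x, y]) (`|w 0%N t| + `|z t|))).
  apply: le_Rintegral => //; first exact: integrable_norm.
  exact: abs_int.
rewrite /n [leLHS]Rintegral_mkcond [leRHS]Rintegral_mkcond; apply: le_Rintegral => //.
- by rewrite -restrict_EFin; apply/integrable_restrict => //; rewrite setTI; exact: abs_int.
- by rewrite -restrict_EFin; apply/integrable_restrict => //; rewrite setTI; exact: abs_int.
- move=> t _; rewrite !patchE !mem_setE !in_itv/=.
  case: ifPn => [/andP[xt ty]|_]; first by rewrite xt (le_trans ty yx).
  by case: ifP => _; rewrite ?lexx// addr_ge0.
Qed.

Let G_sub x y : a <= x -> x <= y <= x + 2 -> `|G y - G x| <= `|al^-1| * n x.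
Proof.
move=> ax xyx; have /andP[xy yx] := xyx; have axy : a <= x <= y by rewrite ax xy.
have i1 := integrable_itv_half_line y (wi (isT : 1 <= 3)%N) ax.
have i3 := integrable_itv_half_line y (wi (isT : 3 <= 3)%N) ax.
have iz := integrable_itv_half_line y zi ax.
have -> : G y - G x = - al^-1 * \int[mu]_(t in `]x, y]) z t.
  rewrite /G opprD addrACA -mulrBr (prejet_sub (isT : 2 < 3)%N axy).
  rewrite (prejet_sub (isT : 0 < 3)%N axy).
  rewrite -RintegralZl// -RintegralD//; last exact: intbleZ.
  rewrite -RintegralZl//; apply: eq_Rintegral => t _.
  by rewrite -[z t]opprK -w3z; field.
rewrite normrM normrN ler_wpM2l// le_n// => t _.
by rewrite lerDr.
Qed.

(** Over a length of at most 2, replacing [G] by [G x] costs [2 * |al^-1| * n x], and the term in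
    [w 0] that separates [w 2] from [G] costs [|al^-1| * |be| * n x]. *)
Let K := `|al^-1| * (2 + `|be|).

Let K_ge0 : 0 <= K. Proof. by rewrite mulr_ge0// addr_ge0. Qed.

Let w1_taylor x y : a <= x -> x <= y <= x + 2 ->
  `|w 1%N y - w 1%N x - (y - x) * G x| <= K * n x.
Proof.
move=> ax xyx; have /andP[xy yx] := xyx; have axy : a <= x <= y by rewrite ax xy.
have i0 := integrable_itv_half_line y (wi (isT : 0 <= 3)%N) ax.
have i2 := integrable_itv_half_line y (wi (isT : 2 <= 3)%N) ax.
rewrite (prejet_sub (isT : 1 < 3)%N axy).
have bi : mu.-integrable `]x, y] (EFin \o (fun t => - (al^-1 * be) * w 0%N t)) by exact: intbleZ.
have Gi : mu.-integrable `]x, y] (EFin \o G) by apply: intbleD => //; exact: intbleZ.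
have -> : \int[mu]_(t in `]x, y]) w 2 t =
    \int[mu]_(t in `]x, y]) G t - (al^-1 * be) * \int[mu]_(t in `]x, y]) w 0%N t.
  rewrite -mulNr -RintegralZl// -RintegralD//; apply: eq_Rintegral => t _.
  by rewrite /G; ring.
rewrite -integral_itv_cst// addrAC.
have cG : mu.-integrable `]x, y] (EFin \o (fun=> G x)).
  by apply: integrable_itv_continuous => t; exact: cvg_cst.
have H1 := @integral_near G x y (`|al^-1| * n x) (fun=> G x) xy Gi cG.
have {}H1 : `|\int[mu]_(t in `]x, y]) G t - \int[mu]_(t in `]x, y]) G x| <= 2 * (`|al^-1| * n x).
  apply: (le_trans (H1 _)).
    by move=> t /andP[/ltW xt ty]; apply: G_sub; rewrite ?xt ?(le_trans ty yx).
  by rewrite ler_wpM2r ?mulr_ge0// lerBlDl.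
have H2 : `|\int[mu]_(t in `]x, y]) w 0%N t| <= n x.
  by apply: le_n => // t _; rewrite lerDl.
apply: (le_trans (ler_normB _ _)).
rewrite normrM normrM /K mulrDr mulrDl; apply: lerD.
  by rewrite (mulrC _ 2) -mulrA.
by rewrite ler_wpM2l// mulr_ge0.
Qed.

Let w0_taylor x y : a <= x -> x <= y <= x + 2 ->
  `|w 0%N y - w 0%N x - (y - x) * w 1%N x - (y - x) ^+ 2 / 2 * G x| <= 2 * (K * n x).
Proof.
move=> ax xyx; have /andP[xy yx] := xyx; have axy : a <= x <= y by rewrite ax xy.
rewrite (prejet_sub (isT : 0 < 3)%N axy).
have c1 : mu.-integrable `]x, y] (EFin \o (fun=> w 1%N x)).
  by apply: integrable_itv_continuous => t; exact: cvg_cst.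
have c2 : mu.-integrable `]x, y] (EFin \o (fun t => G x * (t - x))).
  apply: integrable_itv_continuous => t; apply: cvgM; first exact: cvg_cst.
  by apply: cvgB; [exact: cvg_id|exact: cvg_cst].
have c2' : mu.-integrable `]x, y] (EFin \o (fun t => (t - x))).
  apply: integrable_itv_continuous => t.
  by apply: cvgB; [exact: cvg_id|exact: cvg_cst].
have -> : \int[mu]_(t in `]x, y]) w 1%N t - (y - x) * w 1%N x - (y - x) ^+ 2 / 2 * G x =
    \int[mu]_(t in `]x, y]) w 1%N t -
    \int[mu]_(t in `]x, y]) (w 1%N x + G x * (t - x)).
  rewrite RintegralD// RintegralZl// integral_itv_cst// integral_identity//.
  by rewrite opprD addrA (mulrC (G x)).
apply: (@le_trans _ _ ((y - x) * (K * n x))).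
  apply: integral_near => //.
  - exact: (integrable_itv_half_line y (wi (isT : 1 <= 3)%N) ax).
  - exact: intbleD.
  - move=> t /andP[/ltW xt ty]; rewrite opprD addrA (mulrC (G x)).
    by apply: w1_taylor; rewrite ?xt ?(le_trans ty yx).
by rewrite ler_wpM2r ?mulr_ge0// lerBlDl.
Qed.

Let n_sqr x : a <= x -> n x ^+ 2 <= 4 * m x.
Proof.
(* Cauchy-Schwarz in the form [2 * N * s <= N ^+ 2 + s ^+ 2] with [s = |w 0| + |z|], integrated over
   a window of length 2; [N = n x / 2] is the optimal choice. *)
move=> ax; pose N := n x / 2.
have ki : mu.-integrable `]x, x + 2] (EFin \o k).
  apply: (@integrableS _ _ _ mu I) => //.
    by move=> t; rewrite /= in_itv/= => /andP[xt _]; apply/Ia; exact: le_lt_trans xt.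
  by apply: intbleD => //; [case: w0s|case: zs].
have xx : x <= x + 2 by rewrite lerDl.
have ci : mu.-integrable `]x, x + 2] (EFin \o (fun=> N ^+ 2)).
  by apply: integrable_itv_continuous => t; exact: cvg_cst.
have : 2 * N * n x <= 2 * N ^+ 2 + 2 * m x.
  rewrite /n -RintegralZl//; last exact: abs_int.
  apply: (@le_trans _ _ (\int[mu]_(t in `]x, x + 2]) (N ^+ 2 + 2 * k t))).
    apply: le_Rintegral => //.
    - by apply: intbleZ => //; exact: abs_int.
    - by apply: intbleD => //; exact: intbleZ.
    - move=> t _; rewrite /k -(real_normK (num_real (w 0%N t))) -(real_normK (num_real (z t))).
      set p := `|w 0%N t|; set q := `|z t|.
      have : 0 <= (N - (p + q)) ^+ 2 + (p - q) ^+ 2 by rewrite addr_ge0 ?sqr_ge0.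
      by nra.
  rewrite RintegralD//; last exact: intbleZ.
  by rewrite RintegralZl// integral_itv_cst// addrAC subrr add0r.
by rewrite /N; nra.
Qed.

(** [S] is integrable because translates and window integrals of the squares are. A multiple of it
    dominates the squares of [w 1] and [G], from which [w 2] and [w 3] are recovered. *)
Lemma half_line_jet : jet I a w.
Proof.
have cw i (i3 : (i < 3)%N) : continuous (w i) := @prejet_continuous _ I a oI w i jw i3.
pose S x := w 0%N x ^+ 2 + w 0%N (x + 1) ^+ 2 + w 0%N (x + 2) ^+ 2 + m x.
have m0 x : 0 <= m x by apply: Rintegral_ge0 => t _; rewrite addr_ge0 ?sqr_ge0.
have Si : mu.-integrable I (EFin \o S).
  have c0 : continuous (fun x => w 0%N x ^+ 2) by move=> x; apply: cvgM; exact: cw.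
  have i0 : mu.-integrable I (EFin \o (fun x => w 0%N x ^+ 2)) by case: w0s.
  apply: intbleD => //; last first.
    apply: integrable_window; first by move=> x; rewrite addr_ge0 ?sqr_ge0.
    by apply: intbleD => //; case: zs.
  apply: intbleD => //; last first.
    by apply: (integrable_shift c0) => // x; exact: sqr_ge0.
  apply: intbleD => //.
  by apply: (integrable_shift c0) => // x; exact: sqr_ge0.
pose C := 20 + 400 * K ^+ 2.
have bound x : I x -> w 1%N x ^+ 2 <= C * S x /\ G x ^+ 2 <= C * S x.
  move=> /Ia /ltW ax; have n4 := n_sqr ax.
  have e1 : x + 1 - x = 1 by rewrite addrC addrA addNr add0r.
  have e2 : x + 2 - x = 2 by rewrite addrC addrA addNr add0r.
  have e3 : (2 : R) ^+ 2 / 2 = 2 by field.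
  apply: taylor_bound (m0 x) n4 _ _.
    have x1 : x <= x + 1 <= x + 2 by rewrite lerDl ler01 lerD2l ler1n.
    by have := w0_taylor ax x1; rewrite e1 expr1n !mul1r.
  have x2 : x <= x + 2 <= x + 2 by rewrite lerDl ler0n lexx.
  by have := w0_taylor ax x2; rewrite e2 e3.
have C0 : 0 <= C.
  by apply: addr_ge0; [exact: ler0n|apply: mulr_ge0; [exact: ler0n|exact: sqr_ge0]].
have S0 x : 0 <= S x by rewrite !addr_ge0// sqr_ge0.
have CSi : mu.-integrable I (EFin \o (fun x => C * S x)) by exact: intbleZ.
have domsq f : continuous f -> (forall x, I x -> f x ^+ 2 <= C * S x) -> sqint I f.
  move=> cf fS; have mf : measurable_fun I f.
    by apply: measurable_funTS; exact: continuous_measurable_fun.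
  split => //; apply: (integrable_dom mI _ CSi); first exact: measurable_funX.
  by move=> x Ix; rewrite !ger0_norm ?sqr_ge0 ?mulr_ge0//; exact: fS.
have s1 : sqint I (w 1%N) by apply: domsq; [exact: cw|move=> x /bound[]].
have sG : sqint I G.
  apply: domsq => [x|x /bound[]//].
  by apply: cvgD; [exact: cw|apply: cvgM; [exact: cvg_cst|exact: cw]].
have s2 : sqint I (w 2).
  have -> : w 2 = (fun x => G x - al^-1 * be * w 0%N x).
    by apply/funext => x; rewrite /G addrK.
  by apply: sqintB => //; exact: sqintZ.
have s3 : sqint I (w 3).
  have -> : w 3 = (fun x => - al^-1 * z x + - (al^-1 * be) * w 1%N x).
    by apply/funext => x; rewrite -[z x]opprK -w3z; field.
  by apply: sqintD => //; exact: sqintZ.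
by split => // -[|[|[|[|//]]]] _.
Qed.

End half_line.

(** * Regularity for the adjoint on one edge *)

Section adjoint_regularity.
Variables (R : realType) (I : set R) (a : R).
Hypotheses (oI : open I) (iI : is_interval I) (nI : I !=set0).
Hypothesis aI : forall x, I x -> a < x.
Hypothesis Iend : (exists b, forall x, I x -> x <= b) \/ (forall x, a < x -> I x).
Notation mu := (@lebesgue_measure R).

Let mI : measurable I := open_measurable oI.
Let bI : exists a, forall x, I x -> a < x := ex_intro _ a aI.

(** On a bounded interval, continuity on the whole line makes [w 0], [w 1] and [w 2] square
    integrable, and [w 3] comes from the equation; the half-line is where the Taylor bound is
    needed. *)
Lemma adjoint_regularity (al be : R) v z : al != 0 -> sqint I v -> sqint I z ->
  (forall f, rtest I f ->
     al * pairing I v (derive1n 3 f) + be * pairing I v f^`()%classic = pairing I z f) ->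
  exists w, [/\ jet I a w, {ae mu, forall x, I x -> v x = w 0%N x} &
    forall x, al * w 3 x + be * w 1%N x = - z x].
Proof.
move=> al0 vs zs H.
have [w [vw jw w3]] := @local_regularity _ I a oI iI nI aI al be v z al0
  (sqint_left_integrable mI bI vs) (sqint_left_integrable mI bI zs) H.
exists w; split => //.
have cw i (i3 : (i < 3)%N) : continuous (w i) := @prejet_continuous _ I a oI w i jw i3.
have w0s : sqint I (w 0%N) by exact: (ae_sqint_prejet oI jw (isT : 0 < 3)%N vs vw).
have [[b Ib]|Ia] := Iend; last first.
  apply: (half_line_jet _ al0 jw zs w0s w3) => x; split; [exact: aI|exact: Ia].
have sw i : (i < 3)%N -> sqint I (w i).
  move=> i3; apply: (sqint_bounded_support oI aI (b := b)); first exact: cw.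
  by move=> x /Ib xb; rewrite ltNge xb.
split => // i; rewrite leq_eqVlt => /predU1P[->|]; last exact: sw.
have -> : w 3 = (fun x => - al^-1 * z x + - (al^-1 * be) * w 1%N x).
  by apply/funext => x; rewrite -[z x]opprK -w3; field.
by apply: sqintD => //; apply: sqintZ => //; exact: sw.
Qed.

End adjoint_regularity.

(** * Boundary values of continuous representatives *)

Section boundary_value.
Variable R : realType.
Notation mu := (@lebesgue_measure R).

Lemma ae_open_ex (U : set R) (P : R -> Prop) : open U -> U !=set0 ->
  {ae mu, forall x, P x} -> exists2 x, U x & P x.
Proof.
move=> oU [x Ux] [N [mN N0 PN]]; apply: contrapT => nU.
have UN : U `<=` N by move=> y Uy; apply: PN => /= Py; apply: nU; exists y.
have /nbhs_ballP[e /= e0 xe] : nbhs x U by exact: open_nbhs_nbhs.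
have xN : `]x - e, x + e[%classic `<=` N.
  by apply: subset_trans UN; apply: subset_trans xe; rewrite ball_itv.
have lt : x - e < x + e by rewrite ltrBlDr -addrA ltrDl addr_gt0.
have : (mu `](x - e)%R, (x + e)%R[%classic <= mu N)%E by apply: le_measure; rewrite ?inE.
rewrite N0 lebesgue_measure_itv/= lte_fin lt -EFinD lee_fin leNgt subr_gt0.
by rewrite lt.
Qed.

(** A nearby point of [I] at which the functions agree exists off any null set, because [I] meets
    each ball around [x] in a non-empty open set. This makes [cvalue] independent of the
    representative. *)
Lemma within_continuous_unique (I : set R) (g h : R -> R) (x : R) : open I ->
  closure I x -> {within closure I, continuous g} -> continuous h ->
  {ae mu, forall y, I y -> g y = h y} -> g x = h x.
Proof.
move=> oI cIx cg ch gh; apply/eqP/negPn/negP => gh0.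
pose d y := g y - h y.
have cd : {within closure I, continuous d}.
  by move=> y; apply: cvgB; [exact: cg|exact: (continuous_subspaceT ch)].
have d0 : d x != 0 by rewrite subr_eq0.
have : d y @[y --> within (closure I) (nbhs x)] --> d x.
  by move/subspace_continuousP: cd; apply.
move=> /cvgrPdist_lt /(_ `|d x|); rewrite normr_gt0 => /(_ d0) /nbhs_ballP[e /= e0 xe].
have [y [Iy xy]] := cIx _ (nbhsx_ballx x e e0).
have [||t [It xt] /(_ It) dt] := @ae_open_ex (I `&` ball x e) _ _ _ gh.
- by apply: openI => //; exact: ball_open.
- by exists y.
have := xe t xt (subset_closure It).
by rewrite /d dt subrr subr0 ltxx.
Qed.

End boundary_value.

(** * Complex-valued functions *)

Section complex_valued.
Variables (R : realType).

Lemma Re_mul (x y : R[i]) : complex.Re (x * y) =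
  complex.Re x * complex.Re y - complex.Im x * complex.Im y.
Proof. by case: x y => ? ? [? ?]. Qed.

Lemma Im_mul (x y : R[i]) : complex.Im (x * y) =
  complex.Re x * complex.Im y + complex.Im x * complex.Re y.
Proof. by case: x y => ? ? [? ?]. Qed.

Lemma Re_conj (x : R[i]) : complex.Re (x^*)%C = complex.Re x.
Proof. by case: x. Qed.

Lemma Im_conj (x : R[i]) : complex.Im (x^*)%C = - complex.Im x.
Proof. by case: x. Qed.

Lemma Re_add (x y : R[i]) : complex.Re (x + y) = complex.Re x + complex.Re y.
Proof. by case: x y => ? ? [? ?]. Qed.

Lemma Im_add (x y : R[i]) : complex.Im (x + y) = complex.Im x + complex.Im y.
Proof. by case: x y => ? ? [? ?]. Qed.

Lemma Re_opp (x : R[i]) : complex.Re (- x) = - complex.Re x.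
Proof. by case: x. Qed.

Lemma Im_opp (x : R[i]) : complex.Im (- x) = - complex.Im x.
Proof. by case: x. Qed.

Lemma complex_eq (x y : R[i]) : complex.Re x = complex.Re y ->
  complex.Im x = complex.Im y -> x = y.
Proof. by case: x y => ? ? [? ?] /= -> ->. Qed.

Lemma sign_real (n : nat) : (-1) ^+ n = ((-1) ^+ n : R)%:C%C :> R[i].
Proof. by rewrite rmorphXn rmorphN1. Qed.

End complex_valued.

Section complex_interval.
Variables (R : realType) (I : set R) (a : R).
Hypotheses (oI : open I) (iI : is_interval I) (nI : I !=set0).
Hypothesis aI : forall x, I x -> a < x.
Notation mu := (@lebesgue_measure R).
Implicit Types (u v f g : R -> R[i]).

Let mI : measurable I := open_measurable oI.
Let bI : exists a, forall x, I x -> a < x := ex_intro _ a aI.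

Lemma csquare_integrableP f :
  csquare_integrable I f <-> sqint I (re f) /\ sqint I (im f).
Proof.
split=> [[mr mi H]|[[mr hr] [mi hi]]].
  split; split => //; apply: (integrable_dom mI _ H).
  - exact: measurable_funX.
  - by move=> x _; rewrite !ger0_norm ?addr_ge0 ?sqr_ge0// lerDl sqr_ge0.
  - exact: measurable_funX.
  - by move=> x _; rewrite !ger0_norm ?addr_ge0 ?sqr_ge0// lerDr sqr_ge0.
by split => //; exact: intbleD.
Qed.

Lemma derive1n_cst0 n : derive1n n (fun=> 0 : R) = (fun=> 0) :> (R -> R).
Proof.
elim: n => [|n IH]; first by rewrite derive1n0.
by rewrite derive1nS IH; apply: is_derive_fun1 => x; exact: is_derive_cst.
Qed.

Lemma rtest_test_fun (f : R -> R) : rtest I f -> test_fun I (fun x => (f x)%:C%C).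
Proof.
move=> [sf [c [d [Ic Id f0]]]]; split.
- exact: sf.
- have -> : im (fun x => (f x)%:C%C) = (fun=> 0) by [].
  exact: (@smooth_cst R 0).
- exists `[c, d]%classic; split.
  + exact: segment_compact.
  + by move=> x; rewrite /= in_itv/= => /(iI Ic Id).
  + by move=> x; rewrite /= in_itv/= => /f0 ->.
Qed.

Lemma test_fun_rtest f : test_fun I f -> rtest I (re f) /\ rtest I (im f).
Proof.
move=> [sr si [K [cK KI f0]]].
(* A non-empty compact set contains its minimum and its maximum, which serve as ends; for an empty
   support any point of [I] does. *)
have [c [d [Ic Id Kcd]]] : exists c d, [/\ I c, I d & K `<=` `[c, d]].
  have [->|/set0P K0] := eqVneq K set0.
    by have [x Ix] := nI; exists x, x; split => //; exact: sub0set.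
  have cid : {within K, continuous (fun x : R => x)}.
    by apply: continuous_subspaceT => x; exact: cvg_id.
  have [c cK' Hc] := compact_EVT_min K0 cK cid.
  have [d dK' Hd] := compact_EVT_max K0 cK cid.
  exists c, d; split; [by apply: KI; rewrite -inE|by apply: KI; rewrite -inE|].
  by move=> x Kx; rewrite /= in_itv/= Hc ?Hd// inE.
have z x : ~ (c <= x <= d) -> f x = 0.
  by move=> xcd; apply: f0 => /Kcd; rewrite /= in_itv.
split; split; [exact: sr| |exact: si|]; exists c, d; split => // x /z.
  by rewrite /re => ->.
by rewrite /im => ->.
Qed.

Lemma cint_re (h : R -> R[i]) : complex.Re (cint I h) = \int[mu]_(x in I) re h x.
Proof. by []. Qed.

Lemma cint_im (h : R -> R[i]) : complex.Im (cint I h) = \int[mu]_(x in I) im h x.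
Proof. by []. Qed.

Lemma cint_mul_rtest u (h : R -> R) :
  cint I (fun x => u x * (h x)%:C%C) = Complex (pairing I (re u) h) (pairing I (im u) h).
Proof.
apply: complex_eq; rewrite ?cint_re ?cint_im /=; apply: eq_Rintegral => x _.
  by rewrite /re /im Re_mul /= mulr0 subr0.
by rewrite /re /im Im_mul /= mulr0 add0r.
Qed.

Lemma cderiv_real n (h : R -> R) :
  cderiv n (fun x => (h x)%:C%C) = (fun x => (derive1n n h x)%:C%C).
Proof.
by apply/funext => x; rewrite /cderiv -[im _]/(fun=> 0 : R) derive1n_cst0.
Qed.

Lemma cint_mul u v : csquare_integrable I u -> csquare_integrable I v \/
    (rtest I (re v) /\ rtest I (im v)) ->
  cint I (fun x => u x * v x) =
  Complex (pairing I (re u) (re v) - pairing I (im u) (im v))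
          (pairing I (re u) (im v) + pairing I (im u) (re v)).
Proof.
move=> /csquare_integrableP[ur ui] H.
have P (s t : R -> R) : sqint I s -> sqint I t \/ rtest I t ->
    mu.-integrable I (EFin \o (fun x => s x * t x)).
  move=> ss [st|tt]; first exact: sqintM.
  by apply: integrable_mul_test => //; exact: sqint_left_integrable.
have vr : sqint I (re v) \/ rtest I (re v).
  by case: H => [/csquare_integrableP[]|[]]; [left|right].
have vi : sqint I (im v) \/ rtest I (im v).
  by case: H => [/csquare_integrableP[]|[]]; [left|right].
apply: complex_eq; rewrite ?cint_re ?cint_im /= /pairing.
  rewrite -RintegralB//; [|exact: P|exact: P].
  by apply: eq_Rintegral => x _; rewrite /re /im Re_mul.
rewrite -RintegralD//; [|exact: P|exact: P].
by apply: eq_Rintegral => x _; rewrite /re /im Im_mul.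
Qed.

Definition real_weak_deriv n (u g : R -> R) : Prop := forall f : R -> R, rtest I f ->
  pairing I u (derive1n n f) = (-1) ^+ n * pairing I g f.

Lemma weak_derivP n u g : csquare_integrable I u -> csquare_integrable I g ->
  weak_deriv I n u g <->
  real_weak_deriv n (re u) (re g) /\ real_weak_deriv n (im u) (im g).
Proof.
move=> us gs; split => [H|[Hr Hi] f tf].
  have E (f : R -> R) : rtest I f -> Complex (pairing I (re u) (derive1n n f))
     (pairing I (im u) (derive1n n f)) = (-1) ^+ n *
     Complex (pairing I (re g) f) (pairing I (im g) f).
    by move=> tf; have := H _ (rtest_test_fun tf); rewrite cderiv_real !cint_mul_rtest.
  split=> f /E; rewrite sign_real => EE.
    have := congr1 (@complex.Re R) EE; rewrite Re_mul /= => ->.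
    by rewrite mul0r subr0.
  have := congr1 (@complex.Im R) EE; rewrite Im_mul /= => ->.
  by rewrite mul0r addr0.
have [tr ti] := test_fun_rtest tf.
rewrite !cint_mul//; [|by right|by right; split; exact: rtest_derive1n].
rewrite sign_real; apply: complex_eq; rewrite ?Re_mul ?Im_mul /= mul0r ?subr0 ?addr0.
  by rewrite -[re (cderiv n f)]/(derive1n n (re f)) -[im (cderiv n f)]/(derive1n n (im f)) Hr// Hi// mulrBr.
by rewrite -[re (cderiv n f)]/(derive1n n (re f)) -[im (cderiv n f)]/(derive1n n (im f)) Hr// Hi// mulrDr.
Qed.

Definition cjet u (p q : nat -> R -> R) : Prop :=
  [/\ jet I a p, jet I a q, {ae mu, forall x, I x -> re u x = p 0%N x} &
      {ae mu, forall x, I x -> im u x = q 0%N x}].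

Definition cjet_fun (p q : nat -> R -> R) n (x : R) : R[i] := Complex (p n x) (q n x).

Lemma cjet_of_sobolev u : sobolev 3 I u -> exists p q, cjet u p q.
Proof.
move=> [us H]; have /csquare_integrableP[ur ui] := us.
have [g1 [g1s H1]] := H 1%N isT; have [g2 [g2s H2]] := H 2 isT.
have [g3 [g3s H3]] := H 3 isT.
pose g n := match n with 0 => u | 1 => g1 | 2 => g2 | _ => g3 end%N.
have gs n : (n <= 3)%N -> csquare_integrable I (g n).
  by case: n => [|[|[|[|//]]]].
have gw n : (n <= 3)%N -> real_weak_deriv n (re u) (re (g n)) /\
    real_weak_deriv n (im u) (im (g n)).
  case: n => [|[|[|[|//]]]] _; last 3 first.
  - by apply/(weak_derivP 1 us g1s).
  - by apply/(weak_derivP 2 us g2s).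
  - by apply/(weak_derivP 3 us g3s).
  by split => f _; rewrite derive1n0 expr0 mul1r.
have [||p jp up] := @weak_jet _ I a oI iI nI aI (fun n => re (g n)).
- by move=> n /gs /csquare_integrableP[].
- by move=> n f n3 tf; have [+ _] := gw n n3; apply.
have [||q jq uq] := @weak_jet _ I a oI iI nI aI (fun n => im (g n)).
- by move=> n /gs /csquare_integrableP[].
- by move=> n f n3 tf; have [_] := gw n n3; apply.
by exists p, q; split.
Qed.

Section cjet_theory.
Variables (u : R -> R[i]) (p q : nat -> R -> R).
Hypotheses (us : csquare_integrable I u) (jpq : cjet u p q).

Lemma cjet_fun_csq n : (n <= 3)%N -> csquare_integrable I (cjet_fun p q n).
Proof.
move=> n3; have [[ps _] [qs _] _ _] := jpq.
by apply/csquare_integrableP; split; [exact: ps|exact: qs].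
Qed.

Lemma cjet_weak_deriv n : (n <= 3)%N -> weak_deriv I n u (cjet_fun p q n).
Proof.
move=> n3; have [[_ jp] [_ jq] up uq] := jpq.
have /csquare_integrableP[ur ui] := us.
apply/weak_derivP => //; first exact: cjet_fun_csq.
split=> f tf.
  rewrite (ae_pairing oI _ _ (rtest_derive1n n tf) up).
  - exact: (pairing_prejetn oI iI jp n3 tf).
  - exact: (sqint_left_integrable mI bI ur).
  - exact: (prejet_left_integrable oI aI jp (leq0n 3)).
rewrite (ae_pairing oI _ _ (rtest_derive1n n tf) uq).
- exact: (pairing_prejetn oI iI jq n3 tf).
- exact: (sqint_left_integrable mI bI ui).
- exact: (prejet_left_integrable oI aI jq (leq0n 3)).
Qed.

Lemma sobolev_of_cjet : sobolev 3 I u.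
Proof.
split => // n n3; exists (cjet_fun p q n).
by split; [exact: cjet_fun_csq|exact: cjet_weak_deriv].
Qed.

(** The jet entry is a candidate, so the choice in [wderiv] is not its junk value; uniqueness of
    weak derivatives then identifies it. *)
Lemma cjet_wderiv n : (n <= 3)%N -> csquare_integrable I (wderiv I n u) /\
  ceq_ae I (wderiv I n u) (cjet_fun p q n).
Proof.
move=> n3; have [[_ jp] [_ jq] up uq] := jpq.
have /csquare_integrableP[ur ui] := us.
have [gs gw] : csquare_integrable I (wderiv I n u) /\ weak_deriv I n u (wderiv I n u).
  apply: (@xgetPex _ _ [set g | csquare_integrable I g /\ weak_deriv I n u g]).
  by exists (cjet_fun p q n); split; [exact: cjet_fun_csq|exact: cjet_weak_deriv].
split => //; have /csquare_integrableP[gr gi] := gs.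
have [Hr Hi] := (weak_derivP n us gs).1 gw.
have li (h : R -> R) : sqint I h -> left_integrable I h by exact: sqint_left_integrable.
have wr := wderiv_unique oI iI aI jp n3 (li _ ur) up (li _ gr) Hr.
have wi := wderiv_unique oI iI aI jq n3 (li _ ui) uq (li _ gi) Hi.
apply: ae_mono2 wr wi => x wr wi Ix; apply: complex_eq; [exact: wr|exact: wi].
Qed.

(** The jet entry is a continuous representative, so [cvalue] is not junk, and any other
    representative has the same value on the closure. *)
Lemma cjet_cvalue n x : (n < 3)%N -> closure I x ->
  cvalue I (wderiv I n u) x = cjet_fun p q n x.
Proof.
move=> n3 cIx; have [[_ jp] [_ jq] up uq] := jpq.
have cp : continuous (p n) := @prejet_continuous _ I a oI p n jp n3.
have cq : continuous (q n) := @prejet_continuous _ I a oI q n jq n3.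
have [gs ge] := cjet_wderiv (ltnW n3).
have [g [[gr gi] gu ->]] : exists g : R -> R[i], [/\ ccontinuous_on (closure I) g,
    ceq_ae I (wderiv I n u) g & cvalue I (wderiv I n u) x = g x].
  apply: (@xgetPex _ 0 [set c | exists g : R -> R[i],
    [/\ ccontinuous_on (closure I) g, ceq_ae I (wderiv I n u) g & c = g x]]).
  exists (cjet_fun p q n x), (cjet_fun p q n); split => //.
  by split; apply: continuous_subspaceT; [exact: cp|exact: cq].
apply: complex_eq.
  apply: (within_continuous_unique oI cIx gr cp).
  by apply: ae_mono2 ge gu => y ge gu Iy; rewrite /re -gu// ge.
apply: (within_continuous_unique oI cIx gi cq).
by apply: ae_mono2 ge gu => y ge gu Iy; rewrite /im -gu// ge.
Qed.

End cjet_theory.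

End complex_interval.

(** * Green's formula on one edge *)

Section complex_green.
Variables (R : realType) (I : set R) (a : R).
Hypotheses (oI : open I) (iI : is_interval I) (nI : I !=set0).
Hypothesis aI : forall x, I x -> a < x.
Notation mu := (@lebesgue_measure R).
Implicit Types (u v w z : R -> R[i]) (p q : nat -> R -> R).

Let mI : measurable I := open_measurable oI.
Let bI : exists a, forall x, I x -> a < x := ex_intro _ a aI.

Definition sesq u v : R[i] := cint I (fun x => u x * (v x)^*%C).

Lemma sesq_re u v : complex.Re (sesq u v) =
  \int[mu]_(x in I) (re u x * re v x + im u x * im v x).
Proof.
rewrite /sesq cint_re; apply: eq_Rintegral => x _.
by rewrite /re /im Re_mul Re_conj Im_conj mulrN opprK.
Qed.

Lemma sesq_im u v : complex.Im (sesq u v) =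
  \int[mu]_(x in I) (im u x * re v x - re u x * im v x).
Proof.
rewrite /sesq cint_im; apply: eq_Rintegral => x _.
by rewrite /re /im Im_mul Re_conj Im_conj mulrN addrC.
Qed.

Lemma ae_sesq u u' v v' : csquare_integrable I u -> csquare_integrable I u' ->
  csquare_integrable I v -> csquare_integrable I v' ->
  ceq_ae I u u' -> ceq_ae I v v' -> sesq u v = sesq u' v'.
Proof.
move=> [ur ui _] [ur' ui' _] [vr vi _] [vr' vi' _] uu vv.
apply: complex_eq; rewrite ?sesq_re ?sesq_im; apply: ae_eq_Rintegral => //.
- by apply: measurable_funD; apply: measurable_funM.
- by apply: measurable_funD; apply: measurable_funM.
- by apply: ae_mono2 uu vv => x uu vv Ix; rewrite /re /im uu// vv.
- by apply: measurable_funB; apply: measurable_funM.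
- by apply: measurable_funB; apply: measurable_funM.
- by apply: ae_mono2 uu vv => x uu vv Ix; rewrite /re /im uu// vv.
Qed.

(** [A_0^*] on one edge, expressed through the jets so that no choice of weak derivative enters. *)
Definition adj_fun (al be : R) p q (x : R) : R[i] :=
  - (al%:C%C * cjet_fun p q 3 x + be%:C%C * cjet_fun p q 1 x).

Lemma re_adj_fun al be p q x : re (adj_fun al be p q) x = - (al * p 3 x + be * p 1%N x).
Proof. by rewrite /re /adj_fun Re_opp Re_add !Re_mul /= !mul0r !subr0. Qed.

Lemma im_adj_fun al be p q x : im (adj_fun al be p q) x = - (al * q 3 x + be * q 1%N x).
Proof. by rewrite /im /adj_fun Im_opp Im_add !Im_mul /= !mul0r !addr0. Qed.

Lemma adj_fun_csq al be p q : jet I a p -> jet I a q ->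
  csquare_integrable I (adj_fun al be p q).
Proof.
move=> [ps _] [qs _]; apply/(csquare_integrableP oI); split.
  have -> : re (adj_fun al be p q) = fun x => - (al * p 3 x + be * p 1%N x).
    by apply/funext => x; exact: re_adj_fun.
  by apply: sqintN => //; apply: sqintD => //; apply: sqintZ => //; exact: ps.
have -> : im (adj_fun al be p q) = fun x => - (al * q 3 x + be * q 1%N x).
  by apply/funext => x; exact: im_adj_fun.
by apply: sqintN => //; apply: sqintD => //; apply: sqintZ => //; exact: qs.
Qed.

Definition int_pair (al be : R) p q : R := \int[mu]_(x in I) airy_pair al be p q x.

Lemma sesq_adj al be p q p' q' : jet I a p -> jet I a q -> jet I a p' -> jet I a q' ->
  sesq (adj_fun al be p q) (cjet_fun p' q' 0) + sesq (cjet_fun p q 0) (adj_fun al be p' q') =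
  - Complex (int_pair al be p p' + int_pair al be q q')
            (int_pair al be q p' - int_pair al be p q').
Proof.
move=> jp jq jp' jq'.
have A r : jet I a r -> sqint I (fun x => - (al * r 3 x + be * r 1%N x)).
  move=> [rs _]; apply: sqintN => //; apply: sqintD => //; apply: sqintZ => //; exact: rs.
have Z r : jet I a r -> sqint I (r 0%N) by move=> [rs _]; exact: rs.
have AZ r s : jet I a r -> jet I a s ->
    mu.-integrable I (EFin \o (fun x => - (al * r 3 x + be * r 1%N x) * s 0%N x)).
  by move=> jr js; apply: sqintM => //; [exact: A|exact: Z].
have ZA r s : jet I a r -> jet I a s ->
    mu.-integrable I (EFin \o (fun x => r 0%N x * - (al * s 3 x + be * s 1%N x))).
  by move=> jr js; apply: sqintM => //; [exact: Z|exact: A].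
have AP r s : jet I a r -> jet I a s ->
    \int[mu]_(x in I) (- (al * r 3 x + be * r 1%N x) * s 0%N x) +
    \int[mu]_(x in I) (r 0%N x * - (al * s 3 x + be * s 1%N x)) = - int_pair al be r s.
  move=> jr js; rewrite -RintegralD//; [|exact: AZ|exact: ZA].
  rewrite /int_pair -mulN1r -RintegralZl//; last exact: (airy_pair_integrable oI al be jr js).
  by apply: eq_Rintegral => x _; rewrite /airy_pair; ring.
apply: complex_eq; rewrite ?Re_add ?Im_add ?Re_opp ?Im_opp.
  rewrite !sesq_re [complex.Re _]/=.
  under eq_Rintegral do rewrite re_adj_fun im_adj_fun.
  rewrite RintegralD//; [|exact: AZ|exact: AZ].
  under [X in _ + X]eq_Rintegral do rewrite re_adj_fun im_adj_fun.
  rewrite RintegralD//; [|exact: ZA|exact: ZA].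
  by rewrite addrACA !AP// opprD.
rewrite !sesq_im [complex.Im _]/=.
under eq_Rintegral do rewrite re_adj_fun im_adj_fun.
rewrite RintegralB//; [|exact: AZ|exact: AZ].
under [X in _ + X]eq_Rintegral do rewrite re_adj_fun im_adj_fun.
rewrite RintegralB//; [|exact: ZA|exact: ZA].
by rewrite addrACA -opprD !AP// opprB opprK addrC.
Qed.

(** The bilinear [bracket] of [p + i q] and the conjugate of [p' + i q'], expanded. *)
Definition cbracket (al be : R) p q p' q' (x : R) : R[i] :=
  Complex (bracket al be p p' x + bracket al be q q' x)
          (bracket al be q p' x - bracket al be p q' x).

(** The real bracket is symmetric, the operator having only terms of odd order; the Hermitian
    symmetry of [w] on boundary values comes from here. *)
Lemma cbracketC al be p q p' q' x :
  cbracket al be p' q' p q x = (cbracket al be p q p' q' x)^*%C.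
Proof. by apply: complex_eq; rewrite /cbracket /= /bracket; ring. Qed.

Section green.
Variables (al be : R) (u v w z : R -> R[i]) (p q p' q' : nat -> R -> R).
Hypotheses (us : csquare_integrable I u) (vs : csquare_integrable I v).
Hypotheses (ws : csquare_integrable I w) (zs : csquare_integrable I z).
Hypotheses (ju : cjet I a u p q) (jv : cjet I a v p' q').
Hypotheses (wE : ceq_ae I w (adj_fun al be p q)) (zE : ceq_ae I z (adj_fun al be p' q')).

Let sesq_green : sesq w v + sesq u z =
  - Complex (int_pair al be p p' + int_pair al be q q')
            (int_pair al be q p' - int_pair al be p q').
Proof.
have [jp jq up uq] := ju; have [jp' jq' vp vq] := jv.
rewrite -sesq_adj//; congr (_ + _); apply: ae_sesq => //.
- exact: adj_fun_csq.
- by apply: (@cjet_fun_csq _ I a oI v).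
- by apply: ae_mono2 vp vq => x vp vq Ix; apply: complex_eq; [exact: vp|exact: vq].
- by apply: (@cjet_fun_csq _ I a oI u).
- exact: adj_fun_csq.
- by apply: ae_mono2 up uq => x up uq Ix; apply: complex_eq; [exact: up|exact: uq].
Qed.

Lemma green_bounded b : (forall x, I x -> x <= b) ->
  sesq w v + sesq u z = cbracket al be p q p' q' a - cbracket al be p q p' q' b.
Proof.
move=> Ib; have [jp jq _ _] := ju; have [jp' jq' _ _] := jv.
have B r s (jr : jet I a r) (js : jet I a s) := integral_bracket_bounded oI al be Ib jr js.
rewrite sesq_green /int_pair !B//.
by apply: complex_eq; rewrite /cbracket /=; ring.
Qed.

Lemma green_unbounded : (forall x, a < x -> I x) ->
  sesq w v + sesq u z = cbracket al be p q p' q' a.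
Proof.
move=> Ia; have [jp jq _ _] := ju; have [jp' jq' _ _] := jv.
have B r s (jr : jet I a r) (js : jet I a s) :=
  integral_bracket_unbounded oI aI al be Ia jr js.
rewrite sesq_green /int_pair !B//.
by apply: complex_eq; rewrite /cbracket /=; ring.
Qed.

End green.

(** The matrix [B_j] is the Gram matrix of the Lagrange bracket in the coordinates
    [(u, u', u'')]. *)
Lemma cdot_Bblock al be u v p q p' q' x : csquare_integrable I u ->
  csquare_integrable I v -> cjet I a u p q -> cjet I a v p' q' -> closure I x ->
  cdot (Bblock al be *m bdata I u x) (bdata I v x) = cbracket al be p q p' q' x.
Proof.
move=> us vs ju jv cIx.
have E (f : R -> R[i]) r s : csquare_integrable I f -> cjet I a f r s ->
    forall i : 'I_3, bdata I f x i ord0 = cjet_fun r s i x.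
  by move=> fs jf i; rewrite mxE (cjet_cvalue oI iI nI aI fs jf).
move: (bdata I u x) (bdata I v x) (E u p q us ju) (E v p' q' vs jv) => X Y EX EY.
rewrite /cdot (eq_bigr (fun i => (\sum_j Bblock al be i j * cjet_fun p q j x) *
  (cjet_fun p' q' i x)^*%C)); last first.
  move=> i _; rewrite EY mxE; congr (_ * _); apply: eq_bigr => j _.
  by rewrite EX.
rewrite !big_ord_recl !big_ord0 /Bblock !mxE /=.
apply: complex_eq; rewrite /cbracket /bracket /=; ring.
Qed.

(** Real test functions decouple the hypothesis into one equation for the real parts and one for the
    imaginary parts. *)
Lemma cadjoint_regularity (al be : R) v z :
  (exists b, forall x, I x -> x <= b) \/ (forall x, a < x -> I x) ->
  al != 0 -> csquare_integrable I v -> csquare_integrable I z ->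
  (forall f, rtest I f ->
     sesq (fun x => (al * derive1n 3 f x + be * derive1n 1 f x)%:C%C) v =
     sesq (fun x => (f x)%:C%C) z) ->
  exists p q, cjet I a v p q /\ ceq_ae I z (adj_fun al be p q).
Proof.
move=> Iend al0 /(csquare_integrableP oI)[vr vi] /(csquare_integrableP oI)[zr zi] H.
have li (h : R -> R) : sqint I h -> left_integrable I h by exact: (sqint_left_integrable mI bI).
have S (h : R -> R) u : rtest I h -> sqint I (im u) -> sesq (fun x => (h x)%:C%C) u =
    Complex (pairing I (re u) h) (- pairing I (im u) h).
  move=> th us; apply: complex_eq; rewrite ?sesq_re ?sesq_im /=.
    by apply: eq_Rintegral => x _; rewrite /re /im /= mul0r addr0 mulrC.
  rewrite -mulN1r -(pairingZl oI _ (li _ us) th); apply: eq_Rintegral => x _.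
  by rewrite /re /im /= mul0r add0r mulN1r mulNr mulrC.
have L (h : R -> R) f : sqint I h -> rtest I f ->
    pairing I h (fun x => al * derive1n 3 f x + be * derive1n 1 f x) =
    al * pairing I h (derive1n 3 f) + be * pairing I h f^`()%classic.
  move=> hs tf; have t3 := rtest_derive1n 3 tf; have t1 := rtest_derive1n 1 tf.
  have i3 := integrable_mul_test oI (li _ hs) t3.
  have i1 := integrable_mul_test oI (li _ hs) t1.
  rewrite -derive1n1 /pairing -RintegralZl// -RintegralZl// -RintegralD//; last 2 first.
  - exact: intbleZ.
  - exact: intbleZ.
  by apply: eq_Rintegral => x _; rewrite mulrDr mulrCA (mulrCA _ be).
have tL f : rtest I f -> rtest I (fun x => al * derive1n 3 f x + be * derive1n 1 f x).
  by move=> tf; apply: rtestD => //; apply: rtestZ; exact: rtest_derive1n.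
have H' f : rtest I f -> Complex
    (al * pairing I (re v) (derive1n 3 f) + be * pairing I (re v) f^`()%classic)
    (- (al * pairing I (im v) (derive1n 3 f) + be * pairing I (im v) f^`()%classic)) =
    Complex (pairing I (re z) f) (- pairing I (im z) f).
  by move=> tf; have := H f tf; rewrite (S _ _ (tL _ tf) vi) (S _ _ tf zi) !L.
have Hr f : rtest I f -> al * pairing I (re v) (derive1n 3 f) +
    be * pairing I (re v) f^`()%classic = pairing I (re z) f.
  by move=> /H' [].
have Hi f : rtest I f -> al * pairing I (im v) (derive1n 3 f) +
    be * pairing I (im v) f^`()%classic = pairing I (im z) f.
  by move=> /H' [_ /oppr_inj].
have [p [jp vp zp]] := adjoint_regularity oI iI nI aI Iend al0 vr zr Hr.
have [q [jq vq zq]] := adjoint_regularity oI iI nI aI Iend al0 vi zi Hi.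
exists p, q; split; first by split.
apply: aeW => x _; apply: complex_eq.
  by rewrite -[RHS]/(re (adj_fun al be p q) x) re_adj_fun zp opprK.
by rewrite -[RHS]/(im (adj_fun al be p q) x) im_adj_fun zq opprK.
Qed.

End complex_green.

(** * The looping-edge graph *)

Section block_sums.
Variables (R : realType).

Lemma cdot_mxcol (k : nat) (X Y : 'I_k -> 'cV[R[i]]_3) :
  cdot (\mxcol_i X i) (\mxcol_i Y i) = \sum_i cdot (X i) (Y i).
Proof.
have E n (x y : 'cV[R[i]]_n) : cdot x y = ((map_mx (fun c => (c^*)%C) y)^T *m x) ord0 ord0.
  by rewrite !mxE; apply: eq_bigr => i _; rewrite !mxE mulrC.
rewrite E (_ : map_mx _ _ = \mxcol_i map_mx (fun c => (c^*)%C) (Y i)); last first.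
  by apply/matrixP => i j; rewrite !mxE.
rewrite tr_mxcol mul_mxrow_mxcol summxE; apply: eq_bigr => i _.
by rewrite E.
Qed.

Lemma sum_odd_even (V : nmodType) (k : nat) (f : nat -> V) :
  \sum_(j < (2 * k).+1) f j = f 0%N + \sum_(i < k) (f (2 * i).+1 + f (2 * i).+2).
Proof.
elim: k => [|k IH]; first by rewrite muln0 big_ord_recl !big_ord0.
rewrite [in RHS]big_ord_recr /= addrA -IH mulnS.
by rewrite !addSn add0n !big_ord_recr /= -!addrA.
Qed.

(** [X] has maximal dimension among the subspaces contained in [P]: a vector of [P] outside it would
    enlarge it. *)
Lemma vspace_of_linear (F : fieldType) (vT : vectType F) (P : vT -> Prop) :
  P 0 -> (forall c x y, P x -> P y -> P (c *: x + y)) ->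
  exists X : {vspace vT}, forall x, x \in X <-> P x.
Proof.
move=> P0 PD.
pose Q n := `[< exists X : {vspace vT}, \dim X = n /\ forall x, x \in X -> P x >].
have Q0 : exists n, Q n.
  exists 0%N; apply/asboolP; exists 0%VS; split; first by rewrite dimv0.
  by move=> x; rewrite memv0 => /eqP ->.
have Qb n : Q n -> (n <= \dim {:vT})%N.
  by move=> /asboolP [X [<- _]]; apply: dimvS; exact: subvf.
case: (ex_maxnP Q0 Qb) => n /asboolP[X [dX XP]] nmax.
exists X => x; split; first exact: XP.
move=> Px; apply/negPn/negP => xX.
have : Q (\dim (X + <[x]>)%VS).
  apply/asboolP; exists (X + <[x]>)%VS; split => // y /memv_addP[y1 y1X [y2 /vlineP[c ->] ->]].
  by rewrite addrC; apply: PD => //; exact: XP.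
move/nmax; rewrite -dX leqNgt => /negP; apply.
rewrite ltn_neqAle dimvS ?addvSl// andbT; apply/negP => /eqP e.
have : (X == X + <[x]>)%VS by rewrite eqEdim addvSl e leqnn.
move/eqP => XE; move/negP: xX; apply; rewrite XE.
by rewrite (subvP (addvSr _ _))// memv_line.
Qed.

End block_sums.

(** * Green's formula and boundary values on the looping-edge graph *)

Section graph.
Variables (R : realType) (L : R) (k : nat) (alpha beta : 'I_(2 * k).+1 -> R).
Hypotheses (L_gt0 : 0 < L) (alpha_neq0 : forall j, alpha j != 0).
Notation mu := (@lebesgue_measure R).
Implicit Types (j : 'I_(2 * k).+1) (U V W Z : gfun R k).

Definition left_end j : R := if j == ord0 then - L else L.

Let NLL : - L < L. Proof. by rewrite -subr_gt0 opprK addr_gt0. Qed.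

Lemma edge_open j : open (edge L j).
Proof. by rewrite /edge; case: ifP => _; exact: interval_open. Qed.

Lemma edge_interval j : is_interval (edge L j).
Proof. by rewrite /edge; case: ifP => _; exact: interval_is_interval. Qed.

Lemma edge_nonempty j : edge L j !=set0.
Proof.
rewrite /edge; case: ifP => _; [exists 0|exists (L + 1)]; rewrite /= in_itv/=.
  by rewrite oppr_lt0 L_gt0.
by rewrite ltrDl ltr01.
Qed.

Lemma edge_left j x : edge L j x -> left_end j < x.
Proof. by rewrite /edge /left_end; case: ifP => _; rewrite /= in_itv/= => /andP[]. Qed.

Lemma edge_loop_right x : edge L (ord0 : 'I_(2 * k).+1) x -> x <= L.
Proof. by rewrite /edge eqxx /= in_itv/= => /andP[_ /ltW]. Qed.

Lemma edge_half_line j x : j != ord0 -> left_end j < x -> edge L j x.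
Proof. by rewrite /edge /left_end => /negPf ->; rewrite /= in_itv/= andbT. Qed.

Lemma edge_end j : (exists b, forall x, edge L j x -> x <= b) \/
  (forall x, left_end j < x -> edge L j x).
Proof.
have [->|j0] := eqVneq j ord0; [left|right].
  by exists L; exact: edge_loop_right.
by move=> x; exact: edge_half_line.
Qed.

Lemma closure_near (I : set R) (x : R) :
  (forall e, 0 < e -> exists2 y, I y & `|x - y| < e) -> closure I x.
Proof.
move=> H B /nbhs_ballP[e /= e0 xB]; have [y Iy xy] := H e e0.
by exists y; split => //; apply: xB.
Qed.

Lemma closure_left_end j : closure (edge L j) (left_end j).
Proof.
(* The loop has length [2 * L], so a step of half of [Num.min e L] stays inside every edge. *)
apply: closure_near => e e0; have m0 : 0 < Num.min e L by rewrite lt_min e0 L_gt0.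
have [me mL] : Num.min e L <= e /\ Num.min e L <= L by rewrite !ge_min !lexx orbT.
move: (Num.min e L) m0 me mL => m m0 me mL.
exists (left_end j + m / 2).
  by rewrite /edge /left_end; case: ifP => _; rewrite /= in_itv/= ?andbT; [apply/andP; split|]; lra.
by rewrite ltr_norml; apply/andP; split; lra.
Qed.

Lemma closure_loop_right : closure (edge L (ord0 : 'I_(2 * k).+1)) L.
Proof.
apply: closure_near => e e0; have m0 : 0 < Num.min e L by rewrite lt_min e0 L_gt0.
have [me mL] : Num.min e L <= e /\ Num.min e L <= L by rewrite !ge_min !lexx orbT.
move: (Num.min e L) m0 me mL => m m0 me mL.
exists (L - m / 2).
  by rewrite /edge eqxx /= in_itv/=; apply/andP; split; lra.
by rewrite ltr_norml; apply/andP; split; lra.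
Qed.

Definition gjet U (P Q : 'I_(2 * k).+1 -> nat -> R -> R) : Prop :=
  forall j, cjet (edge L j) (left_end j) (U j) (P j) (Q j).

Lemma gH3_gL2 U : gH3 L U -> gL2 L U.
Proof. by move=> H j; have [] := H j. Qed.

Lemma gH3_gjet U : gH3 L U -> exists P Q, gjet U P Q.
Proof.
move=> H.
have H1 j : exists p : (nat -> R -> R) * (nat -> R -> R),
    cjet (edge L j) (left_end j) (U j) p.1 p.2.
  have [p [q jpq]] := cjet_of_sobolev (@edge_open j) (@edge_interval j) (@edge_nonempty j)
    (@edge_left j) (H j).
  by exists (p, q).
have [f Hf] := choice H1.
by exists (fun j => (f j).1), (fun j => (f j).2).
Qed.

Definition edge_bracket j (P Q P' Q' : 'I_(2 * k).+1 -> nat -> R -> R) (x : R) : R[i] :=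
  cbracket (alpha j) (beta j) (P j) (Q j) (P' j) (Q' j) x.

Definition edge_term P Q P' Q' j : R[i] :=
  if j == ord0 then edge_bracket j P Q P' Q' (- L) - edge_bracket j P Q P' Q' L
  else edge_bracket j P Q P' Q' L.

Lemma airy_adjoint_gjet U P Q : gL2 L U -> gjet U P Q -> forall j,
  ceq_ae (edge L j) (airy_adjoint L alpha beta U j) (adj_fun (alpha j) (beta j) (P j) (Q j)).
Proof.
move=> Us jU j.
have C n n3 := @cjet_wderiv _ _ _ (@edge_open j) (@edge_interval j) (@edge_nonempty j)
   (@edge_left j) _ _ _ (Us j) (jU j) n n3.
have [_ w3] := C 3 isT; have [_ w1] := C 1%N isT.
by apply: ae_mono2 w3 w1 => x w3 w1 Ix; rewrite /airy_adjoint /adj_fun w3// w1.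
Qed.

Lemma ginner_green U V W Z P Q P' Q' : gL2 L U -> gL2 L V -> gL2 L W -> gL2 L Z ->
  gjet U P Q -> gjet V P' Q' ->
  gequiv L W (airy_adjoint L alpha beta U) -> gequiv L Z (airy_adjoint L alpha beta V) ->
  ginner L W V + ginner L U Z = \sum_j edge_term P Q P' Q' j.
Proof.
move=> Us Vs Ws Zs jU jV WU ZV; rewrite /ginner -big_split /=.
apply: eq_bigr => j _; rewrite -!/(sesq (edge L j) _ _).
have wE : ceq_ae (edge L j) (W j) (adj_fun (alpha j) (beta j) (P j) (Q j)).
  apply: ae_mono2 (WU j) (airy_adjoint_gjet Us jU j) => x H1 H2 Ix.
  by rewrite H1// H2.
have zE : ceq_ae (edge L j) (Z j) (adj_fun (alpha j) (beta j) (P' j) (Q' j)).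
  apply: ae_mono2 (ZV j) (airy_adjoint_gjet Vs jV j) => x H1 H2 Ix.
  by rewrite H1// H2.
rewrite /edge_term /edge_bracket; case: ifPn => j0.
  rewrite (green_bounded (@edge_open j) (Us j) (Vs j) (Ws j) (Zs j) (jU j) (jV j) wE zE (b := L)).
    by rewrite /left_end j0.
  by move/eqP: j0 => ->; exact: edge_loop_right.
rewrite (green_unbounded (@edge_open j) (@edge_left j) (Us j) (Vs j) (Ws j) (Zs j) (jU j) (jV j) wE zE).
  by rewrite /left_end (negbTE j0).
by move=> x; exact: edge_half_line.
Qed.

(** An even half-line carries [- B_j] in [B_-], and [w] subtracts the form of [B_-]; the signs
    cancel, so every half-line contributes its bracket at [L] with the sign plus. The two blocks of
    index 0 give the two ends of the loop. *)
Lemma wform_bmap U V P Q P' Q' : gL2 L U -> gL2 L V -> gjet U P Q -> gjet V P' Q' ->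
  wform alpha beta (bmap L U) (bmap L V) = \sum_j edge_term P Q P' Q' j.
Proof.
move=> Us Vs jU jV.
have C j x : closure (edge L j) x -> cdot (Bblock (alpha j) (beta j) *m
    bdata (edge L j) (U j) x) (bdata (edge L j) (V j) x) = edge_bracket j P Q P' Q' x.
  move=> cx; exact: (cdot_Bblock (@edge_open j) (@edge_interval j) (@edge_nonempty j)
    (@edge_left j) _ _ (Us j) (Vs j) (jU j) (jV j) cx).
pose f n := edge_term P Q P' Q' (inord n).
rewrite (eq_bigr (fun j => f (nat_of_ord j))); last by move=> j _; rewrite /f inord_val.
rewrite (sum_odd_even _ f) big_split /= addrA.
rewrite /wform /bmap /Bplus /Bminus /= !mul_mxdiag_mxcol !cdot_mxcol !big_ord_recl /=.
have i0 : (inord 0 : 'I_(2 * k).+1) = ord0 by apply: val_inj; rewrite /= inordK.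
have o0 : odd_edge ord0 = ord0 :> 'I_(2 * k).+1 by rewrite /odd_edge muln0.
have e0 : even_edge ord0 = ord0 :> 'I_(2 * k).+1 by rewrite /even_edge muln0.
have inz n : (n < 2 * k)%N -> (inord n.+1 : 'I_(2 * k).+1) != ord0.
  by move=> nk; apply/eqP => /(congr1 val); rewrite /= inordK.
rewrite o0 e0 !C//; last 2 first.
- exact: closure_loop_right.
- by have := @closure_left_end ord0; rewrite /left_end eqxx.
rewrite /f i0 /edge_term eqxx opprD addrACA -!addrA; congr (_ + _).
have cL j : j != ord0 -> closure (edge L j) L.
  by move=> j0; have := @closure_left_end j; rewrite /left_end (negbTE j0).
congr (_ + (_ + _)); last rewrite -sumrN; apply: eq_bigr => i _.
  have oi : odd_edge (lift ord0 i) = inord (2 * i).+1 by rewrite /odd_edge lift0 mulnS.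
  have j0 := inz (2 * i)%N (ltac:(by rewrite ltn_pmul2l)).
  by rewrite oi (negbTE j0) C//; exact: cL.
have ei : even_edge (lift ord0 i) = inord (2 * i).+2 by rewrite /even_edge lift0 mulnS.
have j0 := inz (2 * i).+1 (ltac:(by rewrite !mul2n ltn_Sdouble)).
rewrite ei (negbTE j0) -C ?mulNmx; last exact: cL.
by rewrite /cdot -sumrN; apply: eq_bigr => n _; rewrite mxE mulNr opprK.
Qed.

Lemma edge_termC P Q P' Q' j : edge_term P' Q' P Q j = (edge_term P Q P' Q' j)^*%C.
Proof.
rewrite /edge_term /edge_bracket; case: ifP => _; rewrite !(cbracketC _ _ (P j))//.
by rewrite rmorphB.
Qed.

(** Replaces the Sobolev condition and the chosen weak derivatives by jets, so that membership can
    be proved by exhibiting them. *)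
Lemma airy_adjoint_graphP p : airy_adjoint_graph L alpha beta p <->
  exists P Q, [/\ gL2 L p.1, gL2 L p.2, gjet p.1 P Q & forall j,
     ceq_ae (edge L j) (p.2 j) (adj_fun (alpha j) (beta j) (P j) (Q j))].
Proof.
split=> [[p3 p2 pe]|[P [Q [p1 p2 jp pe]]]].
  have p1 := gH3_gL2 p3; have [P [Q jp]] := gH3_gjet p3; exists P, Q; split => // j.
  apply: ae_mono2 (pe j) (airy_adjoint_gjet p1 jp j) => x H1 H2 Ix.
  by rewrite H1// H2.
split => // j.
  exact: (sobolev_of_cjet (@edge_open j) (@edge_interval j) (@edge_nonempty j)
    (@edge_left j) (p1 j) (jp j)).
apply: ae_mono2 (pe j) (airy_adjoint_gjet p1 jp j) => x H1 H2 Ix.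
by rewrite H1// H2.
Qed.

Lemma green_graph p q : airy_adjoint_graph L alpha beta p ->
  airy_adjoint_graph L alpha beta q ->
  ginner L p.2 q.1 + ginner L p.1 q.2 = wform alpha beta (bmap L p.1) (bmap L q.1).
Proof.
move=> [p3 p2 pe] [q3 q2 qe]; have p1 := gH3_gL2 p3; have q1 := gH3_gL2 q3.
have [P [Q jp]] := gH3_gjet p3; have [P' [Q' jq]] := gH3_gjet q3.
by rewrite (wform_bmap p1 q1 jp jq) (ginner_green p1 q1 p2 q2 jp jq pe qe).
Qed.

Lemma wform_bmapC p q : airy_adjoint_graph L alpha beta p ->
  airy_adjoint_graph L alpha beta q ->
  wform alpha beta (bmap L q.1) (bmap L p.1) =
  (wform alpha beta (bmap L p.1) (bmap L q.1))^*%C.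
Proof.
move=> [p3 p2 pe] [q3 q2 qe]; have p1 := gH3_gL2 p3; have q1 := gH3_gL2 q3.
have [P [Q jp]] := gH3_gjet p3; have [P' [Q' jq]] := gH3_gjet q3.
apply: (etrans (wform_bmap q1 p1 jq jp)).
apply: (etrans _ (esym (congr1 (fun c => (c^*)%C) (wform_bmap p1 q1 jp jq)))).
rewrite rmorph_sum.
by apply: eq_bigr => j _; exact: edge_termC.
Qed.

Lemma jet_prescribed j (c d : 'I_3 -> R) : exists v, [/\ jet (edge L j) (left_end j) v,
  forall i : 'I_3, v i (left_end j) = c i & j = ord0 -> forall i : 'I_3, v i L = d i].
Proof.
have [->|j0] := eqVneq j ord0.
  have [v [jv vcd]] := jet_exists_bounded c d NLL.
  exists v; rewrite /edge /left_end eqxx; split => //; first by move=> i; have [] := vcd i.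
  by move=> _ i; have [] := vcd i.
have eI x : edge L j x <-> left_end j < x.
  by split; [exact: edge_left|exact: edge_half_line].
have [v [jv v0 v1 v2]] := jet_exists_unbounded (c (inord 0)) (c (inord 1)) (c (inord 2))
  (@edge_open j) eI.
exists v; split => //; last by move=> /eqP; rewrite (negbTE j0).
move=> i; rewrite -[in RHS](inord_val i).
by case: i => [[|[|[|m]]] i3] //; rewrite ?v0 ?v1 ?v2.
Qed.

Lemma cjet_prescribed j (c d : 'cV[R[i]]_3) : exists p : (nat -> R -> R) * (nat -> R -> R),
  [/\ jet (edge L j) (left_end j) p.1, jet (edge L j) (left_end j) p.2,
  forall i : 'I_3, cjet_fun p.1 p.2 i (left_end j) = c i ord0 &
  j = ord0 -> forall i : 'I_3, cjet_fun p.1 p.2 i L = d i ord0].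
Proof.
have [p [jp pc pd]] := jet_prescribed j (fun i => complex.Re (c i ord0))
  (fun i => complex.Re (d i ord0)).
have [q [jq qc qd]] := jet_prescribed j (fun i => complex.Im (c i ord0))
  (fun i => complex.Im (d i ord0)).
exists (p, q); split => // [i|j0 i]; apply: complex_eq => /=.
- exact: pc.
- exact: qc.
- exact: pd.
- exact: qd.
Qed.

Lemma bmap_surjective xy : exists2 p, airy_adjoint_graph L alpha beta p & bmap L p.1 = xy.
Proof.
(* [c j] is the data at the left end of edge [j]: the block index [uphalf j] is 0 for the loop and
   [i] for both edges [2 * i - 1] and [2 * i]. *)
pose c j := if (j == ord0) || odd j then submxcol xy.1 (inord (uphalf j) : 'I_k.+1)
  else submxcol xy.2 (inord (uphalf j)).
(* The last argument prescribes the data at the right end of the loop, block 0 of the second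
   component. *)
have [f Hf] := choice (fun j => cjet_prescribed j (c j) (submxcol xy.2 ord0)).
pose U : gfun R k := fun j => cjet_fun (f j).1 (f j).2 0.
pose W : gfun R k := fun j => adj_fun (alpha j) (beta j) (f j).1 (f j).2.
have jU : gjet U (fun j => (f j).1) (fun j => (f j).2).
  by move=> j; have [jp jq _ _] := Hf j; split => //; exact: aeW.
have Us : gL2 L U.
  by move=> j; exact: (cjet_fun_csq (@edge_open j) (jU j)).
exists (U, W) => /=.
  apply/airy_adjoint_graphP; exists (fun j => (f j).1), (fun j => (f j).2); split => // j.
    by have [jp jq _ _] := Hf j; exact: (adj_fun_csq (@edge_open j) _ _ jp jq).
  exact: aeW.
have V j x (i : 'I_3) : closure (edge L j) x ->
    bdata (edge L j) (U j) x i ord0 = cjet_fun (f j).1 (f j).2 i x.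
  move=> cx; rewrite mxE.
  exact: (cjet_cvalue (@edge_open j) (@edge_interval j) (@edge_nonempty j) (@edge_left j)
    (Us j) (jU j) (ltn_ord i) cx).
have o0 : odd_edge ord0 = ord0 :> 'I_(2 * k).+1 by rewrite /odd_edge muln0; apply: val_inj; rewrite /= inordK.
have e0 : even_edge ord0 = ord0 :> 'I_(2 * k).+1 by rewrite /even_edge muln0; apply: val_inj; rewrite /= inordK.
have cL j : j != ord0 -> closure (edge L j) L.
  by move=> j0; have := @closure_left_end j; rewrite /left_end (negbTE j0).
have vo (i : 'I_k.+1) : odd_edge i = (2 * i).-1 :> nat.
  rewrite inordK// ltnS (leq_trans (leq_pred _))// leq_mul2l -ltnS ltn_ord.
  by rewrite orbT.
have ve (i : 'I_k.+1) : even_edge i = (2 * i)%N :> nat.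
  by rewrite inordK// ltnS leq_mul2l -ltnS ltn_ord orbT.
have cE (i : 'I_k.+1) j (x : 'cV[R[i]]_(bdim k)) (n : 'I_3) : uphalf j = i ->
    (submxcol x (inord (uphalf j)) : 'cV_3) n ord0 = (submxcol x i : 'cV_3) n ord0.
  by move=> ->; rewrite inord_val.
rewrite [xy]surjective_pairing -(submxcolK xy.1) -(submxcolK xy.2) /bmap.
congr (_, _); apply/eq_mxcolP => i; apply/colP => n.
  have [->|i0] := eqVneq i ord0.
    rewrite o0 V; last by have := @closure_left_end ord0; rewrite /left_end eqxx.
    have [_ _ H _] := Hf ord0; move: (H n); rewrite /left_end eqxx => ->.
    by rewrite /c eqxx orTb; apply: cE.
  have [m im] : exists m, nat_of_ord i = m.+1.
    by case: (i) i0 => [[|m] mk] // _; exists m.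
  have oi : odd_edge i = (m.*2).+1 :> nat by rewrite vo im mul2n doubleS.
  have j0 : odd_edge i != ord0 by rewrite -val_eqE /= oi.
  rewrite V; last exact: cL.
  have [_ _ H _] := Hf (odd_edge i); move: (H n); rewrite /left_end (negbTE j0) => ->.
  have od : odd (odd_edge i) by rewrite oi /= odd_double.
  rewrite /c od orbT; apply: cE.
  by rewrite oi im /= doubleK.
have [->|i0] := eqVneq i ord0.
  rewrite e0 V; last exact: closure_loop_right.
  by have [_ _ _ H] := Hf ord0; rewrite H.
have ei := ve i; have j0 : even_edge i != ord0.
  by move: i0; rewrite -!val_eqE /= ei mul2n double_eq0.
rewrite V; last exact: cL.
have [_ _ H _] := Hf (even_edge i); move: (H n); rewrite /left_end (negbTE j0) => ->.
have od : odd (even_edge i) = false by rewrite ei mul2n odd_double.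
rewrite /c (negbTE j0) od; apply: cE.
by rewrite ei mul2n uphalf_double.
Qed.

Lemma sqint_rtest (I : set R) (f : R -> R) : open I -> rtest I f -> sqint I f.
Proof.
move=> oI tf; split; first exact: (rtest_measurable (open_measurable oI) tf).
apply: (eq_intble (open_measurable oI) _ (integrable_mul_test oI (rtest_left_integrable oI tf) tf)) => x _.
by rewrite expr2.
Qed.

Lemma csquare_integrable_real (I : set R) (f : R -> R) : open I -> sqint I f ->
  csquare_integrable I (fun x => (f x)%:C%C).
Proof.
move=> oI fs; apply/(csquare_integrableP oI); split => //.
have -> : im (fun x => (f x)%:C%C) = (fun x => 0 * f x).
  by apply/funext => x; rewrite mul0r.
exact: (sqintZ (open_measurable oI)).
Qed.

Lemma csquare_integrable0 (I : set R) : csquare_integrable I (fun=> 0).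
Proof.
split; [exact: measurable_cst|exact: measurable_cst|].
have -> : (fun x => ((re (fun=> 0) x) ^+ 2 + (im (fun=> 0) x) ^+ 2)%:E) = cst (0 : \bar R).
  by apply/funext => x; rewrite /re /im /= expr0n addr0.
exact: integrable0.
Qed.

Lemma sesq0 (I : set R) (v : R -> R[i]) : sesq I (fun=> 0) v = 0.
Proof.
have Z : (fun x => (0 : R[i]) * (v x)^*%C) = (fun=> 0) by apply/funext => x; rewrite mul0r.
by apply: complex_eq; rewrite /sesq Z; exact: (congr1 fine (integral0 mu I)).
Qed.

Lemma test_fun0 (I : set R) : test_fun I (fun=> 0).
Proof.
split; [exact: (@smooth_cst R 0)|exact: (@smooth_cst R 0)|].
by exists set0; split => //; exact: compact0.
Qed.

Definition on_edge j (f : R -> R) : gfun R k :=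
  fun j' => if j' == j then fun x => (f x)%:C%C else fun=> 0.

Lemma ginner_on_edge j f W : ginner L (on_edge j f) W =
  sesq (edge L j) (fun x => (f x)%:C%C) (W j).
Proof.
rewrite /ginner (bigD1 j)//= big1 ?addr0 => [|i ij].
  by rewrite /on_edge eqxx.
by rewrite -/(sesq (edge L i) _ _) /on_edge (negbTE ij) sesq0.
Qed.

Lemma airy_on_edge j f : airy alpha beta (on_edge j f) =
  on_edge j (fun x => alpha j * derive1n 3 f x + beta j * derive1n 1 f x).
Proof.
apply/funext => i; apply/funext => x; rewrite /airy.
have -> : on_edge j f i = fun x => (if i == j then f x else 0)%:C%C.
  by apply/funext => y; rewrite /on_edge; case: ifP.
rewrite !cderiv_real /on_edge; case: ifP => [/eqP ->|_].
  by rewrite rmorphD !rmorphM.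
by rewrite !derive1n_cst0 !mulr0 addr0.
Qed.

Lemma ginner_gequiv U U' V V' : gL2 L U -> gL2 L U' -> gL2 L V -> gL2 L V' ->
  gequiv L U U' -> gequiv L V V' -> ginner L U V = ginner L U' V'.
Proof.
move=> Us Us' Vs Vs' UU VV; apply: eq_bigr => j _.
exact: (ae_sesq (@edge_open j) (Us j) (Us' j) (Vs j) (Vs' j) (UU j) (VV j)).
Qed.

(** Testing with functions carried by a single edge reduces the claim to that edge; [A] is known on
    such functions because it extends [A_0]. *)
Lemma adjoint_graph_sub (A : operator k L) : extends_airy alpha beta A ->
  adjoint_graph A `<=` airy_adjoint_graph L alpha beta.
Proof.
move=> extA p [p1 p2 H]; apply/airy_adjoint_graphP.
have D j : exists P : (nat -> R -> R) * (nat -> R -> R),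
    cjet (edge L j) (left_end j) (p.1 j) P.1 P.2 /\
    ceq_ae (edge L j) (p.2 j) (adj_fun (alpha j) (beta j) P.1 P.2).
  suff [P [Q PQ]] : exists P Q, cjet (edge L j) (left_end j) (p.1 j) P Q /\
      ceq_ae (edge L j) (p.2 j) (adj_fun (alpha j) (beta j) P Q) by exists (P, Q).
  apply: (cadjoint_regularity (@edge_open j) (@edge_interval j) (@edge_nonempty j)
    (@edge_left j) (edge_end j) (alpha_neq0 j) (p1 j) (p2 j)) => f tf.
  have dU : airy_dom L (on_edge j f).
    move=> i; rewrite /on_edge; case: ifP => [/eqP ->|_]; last exact: test_fun0.
    exact: (rtest_test_fun (@edge_interval j)).
  have [dA eA] := extA _ dU; have := H _ dA; rewrite ginner_on_edge => <-.
  rewrite -ginner_on_edge -airy_on_edge; apply: ginner_gequiv => //.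
  - rewrite airy_on_edge => i; rewrite /on_edge; case: ifP => [/eqP ->|_].
      apply: (csquare_integrable_real (@edge_open j)); apply: (sqint_rtest (@edge_open j)).
      by apply: rtestD; apply: rtestZ; exact: rtest_derive1n.
    exact: csquare_integrable0.
  - exact: app_L2.
  - by move=> i; apply: ae_mono (eA i) => x e Ix; rewrite e.
  - by move=> i; exact: aeW.
have [f Hf] := choice D.
by exists (fun j => (f j).1), (fun j => (f j).2); split => // j; have [] := Hf j.
Qed.

Lemma csquare_integrableN (I : set R) (u : R -> R[i]) : open I ->
  csquare_integrable I u -> csquare_integrable I (fun x => - u x).
Proof.
move=> oI /(csquare_integrableP oI)[ur ui]; apply/(csquare_integrableP oI).
have -> : re (fun x => - u x) = fun x => - re u x by apply/funext => x; exact: Re_opp.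
have -> : im (fun x => - u x) = fun x => - im u x by apply/funext => x; exact: Im_opp.
by split; exact: (sqintN (open_measurable oI)).
Qed.

Lemma sesqN (I : set R) (u v : R -> R[i]) : open I ->
  csquare_integrable I u -> csquare_integrable I v ->
  sesq I (fun x => - u x) v = - sesq I u v.
Proof.
move=> oI /(csquare_integrableP oI)[ur ui] /(csquare_integrableP oI)[vr vi].
have mI := open_measurable oI.
have M := sqintM mI.
have reN x : re (fun x => - u x) x = - re u x by exact: Re_opp.
have imN x : im (fun x => - u x) x = - im u x by exact: Im_opp.
apply: complex_eq; rewrite ?Re_opp ?Im_opp ?sesq_re ?sesq_im -mulN1r -RintegralZl//.
- by apply: eq_Rintegral => x _; rewrite reN imN; ring.
- by apply: intbleD => //; exact: M.
- by apply: eq_Rintegral => x _; rewrite reN imN; ring.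
- by apply: intbleB => //; exact: M.
Qed.

Lemma ginner_gopp U V : gL2 L U -> gL2 L V -> ginner L (gopp U) V = - ginner L U V.
Proof.
move=> Us Vs; rewrite /ginner -sumrN; apply: eq_bigr => j _.
exact: (sesqN (@edge_open j) (Us j) (Vs j)).
Qed.

(** Puts adjointness in the form of the left-hand side of Green's formula. *)
Lemma adjoint_graphP (A : operator k L) q : adjoint_graph A q <->
  [/\ gL2 L q.1, gL2 L q.2 & forall p, opp_graph A p ->
    ginner L p.2 q.1 + ginner L p.1 q.2 = 0].
Proof.
have gN U : gL2 L U -> gL2 L (gopp U).
  by move=> Us j; exact: (csquare_integrableN (@edge_open j) (Us j)).
split=> -[q1 q2 H]; split => //.
  move=> p [Ap p2 pe]; have As := app_L2 Ap.
  rewrite -(H _ Ap) (@ginner_gequiv p.2 (gopp (app A p.1)) q.1 q.1)//; last 2 first.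
  - exact: gN.
  - by move=> j; exact: aeW.
  by rewrite ginner_gopp// addNr.
move=> U AU; have As := app_L2 AU; have /H : opp_graph A (U, gopp (app A U)).
  by split => //=; [exact: gN|move=> j; exact: aeW].
by rewrite /= ginner_gopp// addrC => /eqP; rewrite subr_eq0 => /eqP ->.
Qed.

Lemma cdot_linear n (c : R[i]) (x y z : 'cV[R[i]]_n) :
  cdot (c *: x + y) z = c * cdot x z + cdot y z.
Proof.
by rewrite /cdot mulr_sumr -big_split; apply: eq_bigr => i _; rewrite !mxE mulrDl mulrA.
Qed.

Lemma wform_linear c x y z : wform alpha beta (c *: x + y) z =
  c * wform alpha beta x z + wform alpha beta y z.
Proof.
by rewrite /wform /= !mulmxDr -!scalemxAr !cdot_linear mulrBr opprD addrACA.
Qed.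

(** Green's formula turns membership in the adjoint into a boundary condition; it produces
    [w (F p, F q)], and Hermitian symmetry exchanges the arguments. *)
Lemma adjoint_graph_wform (A : operator k L) q : extends_airy alpha beta A ->
  opp_graph A `<=` airy_adjoint_graph L alpha beta ->
  adjoint_graph A q <-> airy_adjoint_graph L alpha beta q /\
    forall p, opp_graph A p -> wform alpha beta (bmap L q.1) (bmap L p.1) = 0.
Proof.
move=> extA oppA; split=> [Aq|[qG H]].
  have qG := adjoint_graph_sub extA Aq; split => // p pA.
  rewrite (wform_bmapC (oppA _ pA) qG) -(green_graph (oppA _ pA) qG).
  by have /adjoint_graphP[_ _ ->] := Aq; rewrite ?rmorph0.
have [q3 q2 _] := qG; apply/adjoint_graphP; split => //; first exact: gH3_gL2.
move=> p pA; rewrite (green_graph (oppA _ pA) qG) (wform_bmapC qG (oppA _ pA)).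
by rewrite H// rmorph0.
Qed.

End graph.

(** * Skew-self-adjointness as a boundary condition *)

Theorem proposition4p2 (R : realType) (L : R) (k : nat)
    (alpha beta : 'I_(2 * k).+1 -> R) (A : operator k L)
    (L_gt0 : 0 < L) (k_ge1 : (1 <= k)%N)
    (alpha_neq0 : forall j, alpha j != 0)
    (alpha_odd : forall j : 'I_(2 * k).+1, odd j -> 0 < alpha j)
    (alpha_even : forall j : 'I_(2 * k).+1,
      (2 <= j)%N -> ~~ odd j -> alpha j < 0)
    (A_ext : extends_airy alpha beta A) :
  skew_self_adjoint A <->
  exists X : {vspace 'cV[R[i]]_(bdim k) * 'cV[R[i]]_(bdim k)},
    w_self_orthogonal alpha beta X /\
    opp_graph A = bmap_preimage L alpha beta X.
Proof.
rewrite /skew_self_adjoint.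
split=> [skew|[X [oX AX]]].
  have sub : opp_graph A `<=` airy_adjoint_graph L alpha beta.
    by rewrite -skew; exact: adjoint_graph_sub.
  (* [P] is the w-orthogonal of [F (G (-A))]; unlike the image itself, it is linear by the linearity
     of [w] alone. *)
  pose P x := forall p, opp_graph A p -> wform alpha beta x (bmap L p.1) = 0.
  have [||X XP] := @vspace_of_linear _ _ P.
  (* With [c = -1] and zero vectors, linearity gives [w (0, .) = 0]. *)
  - move=> p _; have := wform_linear alpha beta (-1) 0 0 (bmap L p.1).
    by rewrite scaler0 addr0 mulN1r addNr.
  - by move=> c x y Px Py p pA; rewrite wform_linear Px// Py// mulr0 addr0.
  have AX : opp_graph A = bmap_preimage L alpha beta X.
    rewrite -[LHS]skew; apply/seteqP; split=> q.
      move=> /(adjoint_graph_wform L_gt0 alpha_neq0 q A_ext sub)[qG H].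
      by split => //; apply/XP.
    move=> [qG /XP H].
    by apply/(adjoint_graph_wform L_gt0 alpha_neq0 q A_ext sub).
  exists X; split => // x; split => [/XP Xx y|H].
    (* Since [F] is onto, every [y] in [X] is the boundary value of an element of [G (-A)], to which
       [x] is orthogonal by definition of [P]. *)
    have [q qG <-] := bmap_surjective alpha beta L_gt0 y.
    by move=> Xq; apply: Xx; rewrite AX.
  by apply/XP => p; rewrite AX => -[_ Xp]; exact: H.
have sub : opp_graph A `<=` airy_adjoint_graph L alpha beta by rewrite AX => q [].
apply/seteqP; split=> q.
  move=> /(adjoint_graph_wform L_gt0 alpha_neq0 q A_ext sub)[qG H].
  (* Surjectivity turns orthogonality to [F (G (-A))] into orthogonality to all of [X], and [X]
     contains its w-orthogonal. *)
  rewrite AX; split => //; apply/oX => y Xy.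
  have [p pG py] := bmap_surjective alpha beta L_gt0 y.
  by rewrite -py; apply: H; rewrite AX; split => //; rewrite py.
rewrite {1}AX => -[qG /oX H].
apply/(adjoint_graph_wform L_gt0 alpha_neq0 q A_ext sub); split => // p.
by rewrite AX => -[_ Xp]; exact: H.
Qed.
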